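(* Suppose that $f(u_\ell)=f(u_r)$, $f'(u_r)<0<f'(u_\ell)$, $\max(\alpha_\ell,|\alpha_r|)<1$, and that $\underline{\Delta}'(1)\neq0$ and $\underline{\Delta}$ does not vanish on $\{\zeta\in\mathbb{C}:|\zeta|\ge1\}\setminus\{1\}$. Then for any real numbers $\gamma_2\ge\gamma_1\ge0$, there exists a constant $C$ such that, for any $\mathbf{h}\in\ell^1_{\gamma_2}(\mathbb{Z};\mathbb{C})$ that satisfies $\sum_{j\in\mathbb{Z}}h_j=0$, there holds for all integers $n\ge1$: $$\|\mathscr{L}^n\mathbf{h}\|_{\ell^1_{\gamma_1}}\le\frac{C}{n^{\gamma_2-\gamma_1-1/8}}\,\|\mathbf{h}\|_{\ell^1_{\gamma_2}},\qquad \|\mathscr{L}^n\mathbf{h}\|_{\ell^\infty_{\gamma_1}}\le\frac{C}{n^{\gamma_2-\gamma_1+\min(1/3,\gamma_1)}}\,\|\mathbf{h}\|_{\ell^1_{\gamma_2}}.$$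
   Context: Let $f\in\mathscr{C}^\infty(\mathbb{R};\mathbb{R})$ and consider the scalar conservation law $\partial_t u+\partial_x f(u)=0$, $x\in\mathbb{R}$. Let $u_\ell,u_r\in\mathbb{R}$ (left and right states of the stationary shock $u(t,x)=u_\ell$ for $x<0$, $u_r$ for $x>0$). Let $\lambda>0$ and set $\alpha_\ell:=\lambda f'(u_\ell)$, $\alpha_r:=\lambda f'(u_r)$, $\alpha_m:=\lambda f'\big(\frac{u_\ell+u_r}{2}\big)$. The bounded linear operator $\mathscr{L}$ on $\ell^q(\mathbb{Z};\mathbb{C})$, $1\le q\le+\infty$ (linearized Lax-Wendroff scheme), is defined by $$(\mathscr{L}\mathbf{w})_j:=\begin{cases} w_j-\frac{\alpha_r}{2}(w_{j+1}-w_{j-1})+\frac{\alpha_r^2}{2}(w_{j+1}-2w_j+w_{j-1}), & j\ge2,\\ w_j-\frac{\alpha_\ell}{2}(w_{j+1}-w_{j-1})+\frac{\alpha_\ell^2}{2}(w_{j+1}-2w_j+w_{j-1}), & j\le-1,\\ w_0-\frac12(\alpha_r w_1-\alpha_\ell w_{-1})+\frac12\big(\alpha_r\alpha_m w_1-\alpha_\ell(\alpha_\ell+\alpha_m)w_0+\alpha_\ell^2 w_{-1}\big), & j=0,\\ w_1-\frac12(\alpha_r w_2-\alpha_\ell w_0)+\frac12\big(\alpha_r^2 w_2-\alpha_r(\alpha_r+\alpha_m)w_1+\alpha_\ell\alpha_m w_0\big), & j=1.\end{cases}$$ Lopatinskii determinant. For $z\in\mathbb{C}$ with $|z|>\max(\sqrt{1-\alpha_\ell^2},\sqrt{1-\alpha_r^2})$,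 let $\kappa_\ell(z)$ denote the root of largest modulus of $\frac{\alpha_\ell(\alpha_\ell-1)}{2}\kappa^2+(1-\alpha_\ell^2-z)\kappa+\frac{\alpha_\ell(\alpha_\ell+1)}{2}=0$, and let $\kappa_r(z)$ denote the root of smallest modulus of $\frac{\alpha_r(\alpha_r-1)}{2}\kappa^2+(1-\alpha_r^2-z)\kappa+\frac{\alpha_r(\alpha_r+1)}{2}=0$ (in each case the two roots have distinct moduli and are nonzero). The function $$\underline{\Delta}(z):=1-\alpha_m^2+\big(\alpha_\ell-\alpha_m+(1-\alpha_\ell)\kappa_\ell(z)\big)\Big(\alpha_r-\alpha_m-\frac{1+\alpha_r}{\kappa_r(z)}\Big)$$ is holomorphic on that set, with $\underline{\Delta}(1)=0$. Weighted spaces. For $\gamma\ge0$ and $q\in[1,+\infty]$, $\ell^q_\gamma(\mathbb{Z};\mathbb{C})$ is the space of sequences $\mathbf{h}$ such that $((1+|j|^\gamma)h_j)_{j\in\mathbb{Z}}\in\ell^q(\mathbb{Z};\mathbb{C})$, with norm $\|\mathbf{h}\|_{\ell^q_\gamma}:=\|((1+|j|^\gamma)h_j)_{j\in\mathbb{Z}}\|_{\ell^q}$. *)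

(* Defs.v *)
From HB Require Import structures.
From mathcomp Require Export all_boot all_order all_algebra.
From mathcomp Require Export finmap.
From mathcomp Require Export all_classical all_reals all_analysis.
From mathcomp Require Export complex.

Set Implicit Arguments.
Unset Strict Implicit.
Unset Printing Implicit Defensive.

Export Order.TTheory GRing.Theory Num.Theory.
Export numFieldNormedType.Exports.

Local Open Scope ring_scope.
Local Open Scope complex_scope.
Local Open Scope classical_set_scope.

Section LaxWendroff.
Context {R : realType}.
Implicit Types (al am ar a : R) (w h : int -> R[i]) (j : int).

Definition smooth (f : R -> R) : Prop :=
  forall (n : nat) (x : R), derivable (derive1n n f) x 1.

Definition lax_wendroff al am ar w j : R[i] :=
  if 2 <= j then
    w j - (ar / 2)%:C * (w (j + 1) - w (j - 1))
      + (ar ^+ 2 / 2)%:C * (w (j + 1) - 2 * w j + w (j - 1))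
  else if j <= -1 then
    w j - (al / 2)%:C * (w (j + 1) - w (j - 1))
      + (al ^+ 2 / 2)%:C * (w (j + 1) - 2 * w j + w (j - 1))
  else if j == 0 then
    w 0 - 2^-1 * (ar%:C * w 1 - al%:C * w (-1))
      + 2^-1 * ((ar * am)%:C * w 1 - (al * (al + am))%:C * w 0
                + (al ^+ 2)%:C * w (-1))
  else
    w 1 - 2^-1 * (ar%:C * w 2 - al%:C * w 0)
      + 2^-1 * ((ar ^+ 2)%:C * w 2 - (ar * (ar + am))%:C * w 1
                + (al * am)%:C * w 0).

(* The quadratic satisfied by k when w_j = k ^ j solves L w = z w away from the
   shock, where the scheme has constant coefficient a. *)
Definition dispersion a (z k : R[i]) : R[i] :=
  (a * (a - 1) / 2)%:C * k ^+ 2 + ((1 - a ^+ 2)%:C - z) * k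
    + (a * (a + 1) / 2)%:C.

(* [xget] picks an arbitrary root among those of extremal modulus. For
   0 < |a| < 1 and |z| ^ 2 > 1 - a ^ 2 the two roots have distinct moduli, so
   the choice is unique; this covers |z| >= 1 and a neighbourhood of z = 1. *)
Definition kappa_l al (z : R[i]) : R[i] :=
  xget 0 [set k | dispersion al z k = 0 /\
                  forall k', dispersion al z k' = 0 -> `|k'| <= `|k|].

Definition kappa_r ar (z : R[i]) : R[i] :=
  xget 0 [set k | dispersion ar z k = 0 /\
                  forall k', dispersion ar z k' = 0 -> `|k| <= `|k'|].

Definition Lopatinskii al am ar (z : R[i]) : R[i] :=
  (1 - am ^+ 2)%:C
    + ((al - am)%:C + (1 - al)%:C * kappa_l al z)
      * ((ar - am)%:C - (1 + ar)%:C / kappa_r ar z).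

(* 0 `^ 0 = 1 and 0 `^ g = 0 for g != 0, so the weight at j = 0 is 2 for g = 0
   and 1 otherwise. *)
Definition weight (g : R) j : R := 1 + `|j%:~R| `^ g.

Definition l1norm (g : R) h : \bar R :=
  (\esum_(j in [set: int]) (weight g j * Normc.normc (h j))%:E)%E.

Definition linftynorm (g : R) h : \bar R :=
  ereal_sup (range (fun j => (weight g j * Normc.normc (h j))%:E)).

(* Unconditional summation: convergence along the net of finite subsets of Z. *)
Definition has_sum h (s : R[i]) : Prop :=
  forall e : R, 0 < e -> exists A : {fset int}, forall B : {fset int},
    (A `<=` B)%fset -> Normc.normc (\sum_(j <- B) h j - s) < e.

End LaxWendroff.

(* Main.v *)
(* Away from the shock the scheme is a convolution with kernel [green a n]. Energy identities,
   a Nash inequality and the relation (j - a n) g^n_j = mu n (second difference of g^(n-1))_j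
   bound its l^1 norm by n^(1/8); a Sonin-type monotone quadratic form bounds its sup norm
   by n^(-1/3); conjugating by a geometric weight makes it exponentially small at j <= n / K
   for some K.

   Generating series in time, with X in the role of 1/z, turn the equations at j = 0 and j = 1
   into a 2 x 2 linear system whose determinant [Phi] is the Lopatinskii determinant up to a
   factor. Its simple zero at 1 is the only one in the closed unit disk, so the inverse of
   Phi / (1 - X) has coefficients that decay exponentially. Multiplying [Phi] by its conjugates
   (the sign changes of the two square roots) gives a polynomial whose roots are divided out
   one at a time, hence no appeal to Wiener's theorem. The factor 1 / (1 - X) that remains is
   absorbed by the tails of the kernel, and a source on either side of the shock leaves the same
   constant there in the limit; the condition that the masses sum to 0 cancels it, and what is
   left at time n decays as fast as the tail of the initial datum beyond a distance of order n. *)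
From HB Require Import structures.
Require Import Defs.
From mathcomp Require Import zify ring lra.

Set Implicit Arguments.
Unset Strict Implicit.
Unset Printing Implicit Defensive.

Local Open Scope ring_scope.

(** * Energy of a three-point scheme on the line *)

(** The kernel changes sign and oscillates behind its front at [j = a n]: no maximum principle
    applies and no uniform l^1 bound is available, so every estimate comes from a quadratic identity
    or from cancellation. The exponents have distinct origins. The energy decays like n^(-1/4) while
    the mean square width is n^(1/2); Cauchy-Schwarz then costs (n^(1/2) n^(-1/4))^(1/2) = n^(1/8).
    The power n^(-1/3) is the Airy scale at the front. The boundary layer at the shock keeps the
    whole decay n^(-g2) = n^(-(g2 - g1)) n^(-g1), since it is geometrically localised and the target
    weight costs nothing there; this gives [g1] in the minimum. The common loss n^(-(g2 - g1)) is
    transport at a positive speed: what is still visible at time n started at a distance of order n,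
    where the weights differ by that power. Only the left half line is studied, since the reflection
    [j -> 1 - j] exchanges the two sides of the shock. *)

Section WindowSum.
Context {R : realFieldType}.
Implicit Types (f u : int -> R) (W N : nat) (j : int).

(** A sum over Z seen through the window [-W, W]: iterates of a three-point scheme have finite
    support, so no infinite sum is needed once [W] exceeds it. *)
Definition zsum W f : R := \sum_(i < W.*2.+1) f (i%:Z - W%:Z).

Definition supp N u := forall j, (N < `|j|)%N -> u j = 0.

Lemma zsumE W f : zsum W f = \sum_(0 <= i < W.*2.+1) f (i%:Z - W%:Z).
Proof. by rewrite big_mkord. Qed.

Lemma zsum_tel W (h : int -> R) :
  zsum W (fun j => h (j + 1) - h j) = h (W%:Z + 1) - h (- W%:Z).
Proof.
rewrite zsumE (eq_bigr (fun i : nat => h (i.+1%:Z - W%:Z) - h (i%:Z - W%:Z))); last first.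
  by move=> i _; congr (h _ - _); lia.
rewrite (telescope_sumr (fun i : nat => h (i%:Z - W%:Z))) //.
by congr (h _ - h _); lia.
Qed.

(** Energy identities are proved by adding such a vanishing sum, with [h] quadratic in [u (j - 1)]
    and [u j], after which both sides agree term by term. *)
Lemma zsum_tel0 W N h : supp N h -> (N < W)%N ->
  zsum W (fun j => h (j + 1) - h j) = 0.
Proof. by move=> s NW; rewrite zsum_tel !s ?subr0 //; lia. Qed.

Lemma eq_zsum W f1 f2 : f1 =1 f2 -> zsum W f1 = zsum W f2.
Proof. by move=> e; apply: eq_bigr. Qed.

Lemma zsumD W f1 f2 : zsum W (fun j => f1 j + f2 j) = zsum W f1 + zsum W f2.
Proof. exact: big_split. Qed.

Lemma zsumZ W c f : zsum W (fun j => c * f j) = c * zsum W f.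
Proof. by rewrite /zsum mulr_sumr. Qed.

Lemma le_zsum W f1 f2 : (forall j, f1 j <= f2 j) -> zsum W f1 <= zsum W f2.
Proof. by move=> e; apply: ler_sum. Qed.

Lemma zsum_ge0 W f : (forall j, 0 <= f j) -> 0 <= zsum W f.
Proof. by move=> e; apply: sumr_ge0. Qed.

Lemma zsum_shift W N u (k : nat) : supp N u -> (N + k <= W)%N ->
  zsum W (fun j => u (j + k%:Z)) = zsum W u.
Proof.
move=> s; elim: k => [|k IH] NkW.
  by apply: eq_zsum => j; rewrite addr0.
rewrite -IH; last lia.
apply/eqP; rewrite -subr_eq0 -[X in _ - X]mul1r -mulNr -zsumZ -zsumD.
rewrite (@eq_zsum _ _ (fun j => u (j + 1 + k%:Z) - u (j + k%:Z))); last first.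
  by move=> j; rewrite mulN1r; congr (u _ - _); lia.
rewrite (zsum_tel W (fun j => u (j + k%:Z))) !s ?subr0 //; lia.
Qed.

Lemma zsum_widen W W' N u : supp N u -> (N <= W)%N -> (W <= W')%N ->
  zsum W' u = zsum W u.
Proof.
move=> s NW; elim: W' => [|V IH].
  by rewrite leqn0 => /eqP ->.
rewrite leq_eqVlt => /orP[/eqP -> //|WV].
rewrite -(IH WV) !zsumE doubleS big_nat_recr //= big_nat_recl //=.
rewrite (s (0%:Z - V.+1%:Z)) ?(s ((V.*2.+2)%:Z - V.+1%:Z)) ?add0r ?addr0; try lia.
by apply: eq_bigr => i _; congr u; lia.
Qed.

Lemma zsum_term W u j : (forall j, 0 <= u j) -> (`|j| <= W)%N -> u j <= zsum W u.
Proof.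
move=> u0 jW; rewrite /zsum.
have jlt : (absz (j + W%:Z)%R < W.*2.+1)%N by lia.
rewrite (bigD1 (Ordinal jlt)) //= (_ : (absz (j + W%:Z))%:Z - W%:Z = j); last lia.
by rewrite lerDl sumr_ge0.
Qed.

End WindowSum.

Lemma sum_CS (R : realFieldType) (I : Type) (r : seq I) (P : pred I) (f g : I -> R) :
  (\sum_(i <- r | P i) f i * g i) ^+ 2 <=
  (\sum_(i <- r | P i) f i ^+ 2) * (\sum_(i <- r | P i) g i ^+ 2).
Proof.
set B := \sum_(i <- r | P i) f i * g i.
set A := \sum_(i <- r | P i) f i ^+ 2; set C := \sum_(i <- r | P i) g i ^+ 2.
have A0 : 0 <= A by apply: sumr_ge0 => i _; exact: sqr_ge0.
have quad s t : 0 <= s ^+ 2 * A + (s * t) * (2 * B) + t ^+ 2 * C.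
  rewrite /A /B /C !mulr_sumr -!big_split /=; apply: sumr_ge0 => i _.
  by rewrite (_ : _ + _ = (s * f i + t * g i) ^+ 2) ?sqr_ge0 //; ring.
have [A00|An0] := eqVneq A 0; last first.
  have Agt : 0 < A by rewrite lt_def An0.
  have := quad B (- A); rewrite (_ : _ + _ = A * (A * C - B ^+ 2)); last by ring.
  by rewrite pmulr_rge0 // subr_ge0.
have C0 : 0 <= C by apply: sumr_ge0 => i _; exact: sqr_ge0.
have [->|Bn0] := eqVneq B 0; first by rewrite A00 expr0n /= mul0r.
(* With [A = 0] the form is affine in [s], and this [s] brings it down to [- C - 2]. *)
have := quad (- (C + 1) / B) 1; rewrite A00 mulr0 add0r mulr1 expr1n mul1r.
rewrite mulrA [_ / B * 2]mulrAC divfK //; lra.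
Qed.

Lemma zsum_CS (R : realFieldType) W (f g : int -> R) :
  zsum W (fun j => f j * g j) ^+ 2 <=
  zsum W (fun j => f j ^+ 2) * zsum W (fun j => g j ^+ 2).
Proof. exact: sum_CS. Qed.

Section ThreePoint.
Context {R : realFieldType}.
Implicit Types (u v : int -> R) (W N n : nat) (j : int) (c : R).

Definition energy W u := zsum W (fun j => u j ^+ 2).
Definition dif u j := u (j + 1) - u j.
Definition lap u j := u (j - 1) - 2 * u j + u (j + 1).
Definition tstep c1 c0 cm u j : R := c1 * u (j - 1) + c0 * u j + cm * u (j + 1).
Definition delta0 j : R := (j == 0)%:R.
Definition kern c1 c0 cm n := iter n (tstep c1 c0 cm) delta0.

Lemma energy_ge0 W u : 0 <= energy W u.
Proof. by apply: zsum_ge0 => j; exact: sqr_ge0. Qed.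

Lemma supp_delta0 : supp 0 delta0.
Proof. by move=> j j0; rewrite /delta0; case: eqP => // e; move: j0; rewrite e. Qed.

Lemma supp_tstep c1 c0 cm N u : supp N u -> supp N.+1 (tstep c1 c0 cm u).
Proof. by move=> s j jN; rewrite /tstep !s ?mulr0 ?addr0 //; lia. Qed.

Lemma supp_kern c1 c0 cm n : supp n (kern c1 c0 cm n).
Proof. by elim: n => [|n IH]; [exact: supp_delta0 | exact: supp_tstep]. Qed.

Lemma supp_dif N u : supp N u -> supp N.+1 (dif u).
Proof. by move=> s j jN; rewrite /dif !s ?subr0 //; lia. Qed.

Lemma supp_lap N u : supp N u -> supp N.+1 (lap u).
Proof. by move=> s j jN; rewrite /lap !s ?mulr0 ?subr0 ?addr0 //; lia. Qed.

(** On the Fourier side: |F|^2 = F(1)^2 - beta y + c1 cm y^2 with y = |x - 1|^2, where F is the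
    symbol and |x| = 1. Positive beta is diffusion, negative [c1 * cm] is fourth-order diffusion. *)
Lemma energy_tstep c1 c0 cm N W u : supp N u -> (N.+1 < W)%N ->
  energy W (tstep c1 c0 cm u) =
  (c1 + c0 + cm) ^+ 2 * energy W u
  - (c0 * (c1 + cm) + 4 * (c1 * cm)) * energy W (dif u)
  + c1 * cm * energy W (lap u).
Proof.
move=> s NW; set be := c0 * (c1 + cm) + 4 * (c1 * cm).
pose h j := - (c1 ^+ 2 - c1 * cm) * u (j - 1) ^+ 2
            - (2 * (c1 * c0) + 4 * (c1 * cm)) * (u (j - 1) * u j)
            + (cm ^+ 2 + be - c1 * cm) * u j ^+ 2.
have sh : supp N.+1 h.
  by move=> j jN; rewrite /h !s ?expr0n /= ?mulr0 ?addr0 ?subr0 //; lia.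
have := zsum_tel0 sh NW.
rewrite /energy -mulNr -!zsumZ -!zsumD => z; rewrite -[RHS]addr0 -z -zsumD.
apply: eq_zsum => j; rewrite /tstep /dif /lap /h /be (addrK 1 j).
ring.
Qed.

Lemma energy_dif_CS N W u : supp N u -> (N.+1 < W)%N ->
  energy W (dif u) ^+ 2 <= energy W u * energy W (lap u).
Proof.
move=> s NW.
pose h j := u j ^+ 2 - u (j - 1) * u j.
have sh : supp N.+1 h.
  by move=> j jN; rewrite /h !s ?expr0n /= ?mulr0 ?addr0 ?subr0 //; lia.
have z := zsum_tel0 sh NW.
have -> : energy W (dif u) = - zsum W (fun j => u j * lap u j).
  apply/eqP; rewrite -addr_eq0 /energy -zsumD -z; apply/eqP.
  by apply: eq_zsum => j; rewrite /dif /lap /h (addrK 1 j); ring.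
rewrite sqrrN; exact: zsum_CS.
Qed.

(** Discrete Agmon inequality: [u j ^+ 2] is the sum of the increments of [u ^+ 2] to the left of
    [j], to which Cauchy-Schwarz applies. *)
Lemma sup_energy N W u j : supp N u -> (N.+1 < W)%N ->
  u j ^+ 4 <= 8 * (energy W u * energy W (dif u)).
Proof.
move=> s NW.
have [jW|Wj] := leqP `|j| W; last first.
  rewrite s ?expr0n /= ?mulr_ge0 ?energy_ge0 //; lia.
pose f i := (if i < j then u (i + 1) ^+ 2 - u i ^+ 2 else 0).
have fE : u j ^+ 2 = zsum W f.
  pose h i := (if i <= j then u i ^+ 2 else u j ^+ 2).
  have hr : h (W%:Z + 1) = u j ^+ 2 by rewrite /h ifF //; apply/negbTE; lia.
  have hl : h (- W%:Z) = 0.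
    rewrite /h ifT; last lia.
    by rewrite s ?expr0n //=; lia.
  rewrite -hr -[LHS]subr0 -hl -zsum_tel; apply: eq_zsum => i.
  rewrite /h /f; have [ij|ji] := ltP i j.
    by rewrite (ltW ij) ifT //; lia.
  rewrite ifF; last by apply/negbTE; lia.
  by case: ifP => h'; rewrite ?subrr // (_ : i = j) ?subrr //; lia.
have f2 : u j ^+ 2 <= zsum W (fun i => `|dif u i| * (`|u (i + 1)| + `|u i|)).
  rewrite fE; apply: le_zsum => i; rewrite /f; case: ifP => _.
    rewrite subr_sqr /dif; apply: le_trans (ler_norm _) _.
    by rewrite normrM ler_wpM2l // ler_normD.
  by rewrite mulr_ge0 // addr_ge0.
have f3 : zsum W (fun i => `|dif u i| * (`|u (i + 1)| + `|u i|)) ^+ 2 <=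
   energy W (dif u) * (4 * energy W u).
  apply: (le_trans (zsum_CS W (fun i => `|dif u i|) _)).
  rewrite (_ : zsum W (fun j0 => `|dif u j0| ^+ 2) = energy W (dif u)); last first.
    by apply: eq_zsum => i; rewrite real_normK ?num_real.
  apply: ler_wpM2l; first exact: energy_ge0.
  have su2 : supp N (fun i => u i ^+ 2) by move=> i iN; rewrite s // expr0n.
  have e1 : zsum W (fun i => u (i + 1) ^+ 2) = energy W u.
    by apply: (zsum_shift (k := 1) su2); lia.
  have -> : 4 * energy W u = zsum W (fun i => 2 * u (i + 1) ^+ 2 + 2 * u i ^+ 2).
    rewrite zsumD !zsumZ e1 /energy; ring.
  apply: le_zsum => i; rewrite -[u (i+1) ^+ 2]real_normK ?num_real //.
  rewrite -[u i ^+ 2]real_normK ?num_real //.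
  have := sqr_ge0 (`|u (i + 1)| - `|u i|); nra.
rewrite (_ : u j ^+ 4 = (u j ^+ 2) ^+ 2); last by rewrite -exprM.
have e0 := energy_ge0 W u; have d0 := energy_ge0 W (dif u).
have u0 := sqr_ge0 (u j).
set z := zsum _ _ in f2 f3.
have : (u j ^+ 2) ^+ 2 <= z ^+ 2 by rewrite ler_pXn2r // nnegrE //; exact: le_trans f2.
nra.
Qed.

Lemma dif_tstep c1 c0 cm u :
  dif (tstep c1 c0 cm u) =1 tstep c1 c0 cm (dif u).
Proof. by move=> j; rewrite /dif /tstep (_ : j - 1 + 1 = j + 1 - 1); [ring|lia]. Qed.

Lemma lap_tstep c1 c0 cm u :
  lap (tstep c1 c0 cm u) =1 tstep c1 c0 cm (lap u).
Proof.
move=> j; rewrite /lap /tstep.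
have -> : j - 1 + 1 = j by lia.
have -> : j + 1 - 1 = j by lia.
ring.
Qed.

End ThreePoint.

(** Discrete form of x' <= - c x^(p+1), whose solutions stay below (c p t)^(-1/p); the factor p is
    given up. *)
Lemma decay_rec (R : realFieldType) (p : nat) (c : R) (x : nat -> R) :
  (0 < p)%N -> 0 <= c -> (forall n, 0 <= x n) ->
  (forall n, x n.+1 <= x n * (1 - c * x n ^+ p)) ->
  forall n, n%:R * (c * x n ^+ p) <= 1.
Proof.
move=> p0 c0 x0 rec; elim=> [|n IH]; first by rewrite mul0r ler01.
have [xn0|xnn0] := eqVneq (x n) 0.
  have /eqP -> : x n.+1 == 0.
    by rewrite eq_le x0 andbT; apply: le_trans (rec n) _; rewrite xn0 mul0r.
  by rewrite expr0n gtn_eqF // !mulr0 ler01.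
have xn : 0 < x n by rewrite lt_def xnn0 x0.
set Y := c * x n ^+ p in IH *.
have Y0 : 0 <= Y by rewrite mulr_ge0 // exprn_ge0.
have Y1 : 0 <= 1 - Y.
  by have := le_trans (x0 n.+1) (rec n); rewrite pmulr_rge0.
have step : c * x n.+1 ^+ p <= Y * (1 - Y).
  apply: (@le_trans _ _ (c * (x n * (1 - Y)) ^+ p)).
    by apply: ler_wpM2l => //; rewrite lerXn2r ?nnegrE // mulr_ge0 // ltW.
  rewrite exprMn mulrA; apply: ler_wpM2l => //.
  by rewrite -[leRHS]expr1 ler_wiXn2l //; lra.
apply: (@le_trans _ _ (n.+1%:R * (Y * (1 - Y)))).
  by apply: ler_wpM2l.
rewrite -natr1; set N := n%:R in IH *.
have : N * Y * (1 - Y) <= 1 - Y by rewrite -[leRHS]mul1r ler_wpM2r.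
nra.
Qed.

(** * Nash inequality and decay of the energy *)

Section Nash.
Context {R : realType}.
Implicit Types (u v : int -> R) (W N n H : nat) (j : int).
Variables c1 c0 cm : R.
Local Notation T := (tstep c1 c0 cm).
Local Notation K := (kern c1 c0 cm).
(** The diffusion coefficient. It vanishes for Lax-Wendroff, where [- c1 * cm] alone dissipates, and
    is positive for the scheme conjugated by a growing geometric weight; both cases are used. *)
Local Notation be := (c0 * (c1 + cm) + 4 * (c1 * cm)).
Hypothesis sum1 : c1 + c0 + cm = 1.
Hypothesis be0 : 0 <= be.
Hypothesis c1cm : c1 * cm <= 0.

Lemma eq_energy W u v : u =1 v -> energy W u = energy W v.
Proof. by move=> e; apply: eq_zsum => j; rewrite e. Qed.

Lemma energy_widen W W' N u : supp N u -> (N <= W)%N -> (W <= W')%N ->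
  energy W' u = energy W u.
Proof.
by move=> s; apply: zsum_widen => j jN; rewrite s // expr0n.
Qed.

Lemma energy_shift W N u (k : nat) : supp N u -> (N + k <= W)%N ->
  energy W (fun j => u (j + k%:Z)) = energy W u.
Proof.
move=> s; apply: (@zsum_shift _ W N (fun j => u j ^+ 2)) => j jN.
by rewrite s // expr0n.
Qed.

Lemma energy_tstep_eq N W u : supp N u -> (N.+1 < W)%N ->
  energy W (T u) = energy W u - be * energy W (dif u) + c1 * cm * energy W (lap u).
Proof. by move=> s NW; rewrite (energy_tstep _ _ _ s NW) sum1 expr1n mul1r. Qed.

Lemma energy_contract N W u : supp N u -> (N.+1 < W)%N ->
  energy W (T u) <= energy W u.
Proof.
move=> s NW; rewrite (energy_tstep_eq s NW).
have : 0 <= be * energy W (dif u) by rewrite mulr_ge0 ?energy_ge0.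
have : c1 * cm * energy W (lap u) <= 0 by rewrite mulr_le0_ge0 ?energy_ge0.
lra.
Qed.

Lemma supp_iter N n u : supp N u -> supp (N + n) (iter n T u).
Proof.
by move=> s; elim: n => [|n IH]; rewrite ?addn0 // addnS; apply: supp_tstep.
Qed.

Lemma energy_iter N n W u : supp N u -> (N + n < W)%N ->
  energy W (iter n T u) <= energy W u.
Proof.
move=> s; elim: n => [//|n IH] NW; apply: le_trans (IH _); last lia.
by apply: (@energy_contract (N + n)); [exact: supp_iter | lia].
Qed.

(* [u] is close to [box H u / H] when its differences are small, while the energy of [box H]
   applied to the kernel stays below [H]: letting [H] be about [4 / en n] gives [nash]. *)
Definition box H u j : R := \sum_(i < H) u (j + i%:Z).

Lemma supp_box H N u : supp N u -> supp (N + H) (box H u).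
Proof.
move=> s j jN; apply: big1 => i _; apply: s; have := ltn_ord i; lia.
Qed.

Lemma box_tstep H u : box H (T u) =1 T (box H u).
Proof.
move=> j; rewrite /box /tstep !big_split /= -!mulr_sumr.
by congr (_ * _ + _ * _ + _ * _); apply: eq_bigr => i _; congr u; lia.
Qed.

Lemma box_iter H n u : box H (iter n T u) = iter n T (box H u).
Proof.
by elim: n => //= n IH; apply/funext => j; rewrite box_tstep IH.
Qed.

Lemma energy_box_delta0 H W : (H <= W)%N -> energy W (box H delta0) <= H%:R.
Proof.
move=> HW.
have b01 j : box H delta0 j <= 1 :> R.
  rewrite /box /delta0.
  have [/existsP[i /eqP ji]|/existsPn ne] := boolP [exists i : 'I_H, j + i%:Z == 0].
    rewrite (bigD1 i) //= ji eqxx big1 ?addr0 // => k ki.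
    by case: eqP => // jk; move/eqP: ki; case; apply: val_inj => /=; lia.
  by rewrite big1 ?ler01 // => i _; rewrite (negbTE (ne i)).
have b0 j : 0 <= box H delta0 j :> R by apply: sumr_ge0.
apply: (@le_trans _ _ (zsum W (box H delta0))).
  by apply: le_zsum => j; have := b01 j; have := b0 j; nra.
rewrite /zsum exchange_big /=.
apply: (@le_trans _ _ (\sum_(i < H) zsum W (@delta0 R))); last first.
  rewrite sumr_const card_ord -[leRHS]mulr1n -[_ *+ H]mulr_natr ler_piMl //.
  rewrite (zsum_widen (W := 0) supp_delta0) // /zsum big_ord_recl big_ord0.
  by rewrite addr0.
apply: ler_sum => i _; rewrite -(zsum_shift (W := W) (k := i) supp_delta0) //.
by have := ltn_ord i; lia.
Qed.

Lemma energy_increment N W u (i : nat) : supp N u -> (N + i.+1 <= W)%N ->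
  zsum W (fun j => (u (j + i%:Z) - u j) ^+ 2) <= i%:R ^+ 2 * energy W (dif u).
Proof.
move=> s NW.
apply: (@le_trans _ _ (zsum W (fun j => i%:R * \sum_(l < i) dif u (j + l%:Z) ^+ 2))).
  apply: le_zsum => j.
  have -> : u (j + i%:Z) - u j = \sum_(l < i) 1 * dif u (j + l%:Z).
    rewrite -(big_mkord xpredT (fun l => 1 * dif u (j + l%:Z))).
    rewrite (eq_bigr (fun l : nat => u (j + l.+1%:Z) - u (j + l%:Z))); last first.
      by move=> l _; rewrite mul1r /dif; congr (u _ - _); lia.
    by rewrite (telescope_sumr (fun l => u (j + l%:Z))) // addr0.
  apply: (le_trans (sum_CS _ _ _ _)); rewrite expr1n sumr_const card_ord //.
rewrite zsumZ expr2 -mulrA; apply: ler_wpM2l => //.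
rewrite /zsum exchange_big /= mulr_natl -[i in leRHS]card_ord -sumr_const.
apply: ler_sum => l _; rewrite -(energy_shift (W := W) (k := l) (supp_dif s)) //.
by have := ltn_ord l; lia.
Qed.

Lemma energy_sub_box N W u H : supp N u -> (N + H.+1 <= W)%N ->
  energy W (fun j => H%:R * u j - box H u j) <= H%:R ^+ 4 * energy W (dif u).
Proof.
move=> s NW.
apply: (@le_trans _ _ (zsum W (fun j =>
    H%:R * \sum_(i < H) (u (j + i%:Z) - u j) ^+ 2))).
  apply: le_zsum => j.
  have -> : H%:R * u j - box H u j = \sum_(i < H) (-1) * (u (j + i%:Z) - u j).
    rewrite -mulr_sumr sumrB mulN1r opprB; congr (_ - _).
    by rewrite sumr_const card_ord mulr_natl.
  apply: (le_trans (sum_CS _ _ _ _)).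
  by rewrite sqrrN expr1n sumr_const card_ord.
rewrite zsumZ (_ : H%:R ^+ 4 * _ = H%:R * (H%:R * (H%:R ^+ 2 * energy W (dif u)))); last ring.
apply: ler_wpM2l => //.
rewrite /zsum exchange_big /= [leRHS]mulr_natl -[H in leRHS]card_ord -sumr_const.
apply: ler_sum => i _; have iH := ltn_ord i.
rewrite card_ord; apply: le_trans (energy_increment s _) _; first lia.
apply: ler_wpM2r; first exact: energy_ge0.
by rewrite lerXn2r ?nnegrE // ler_nat ltnW.
Qed.

Definition en n := energy n (K n).
Definition den n := energy n.+1 (dif (K n)).
Definition len n := energy n.+1 (lap (K n)).

Lemma enE n W : (n <= W)%N -> energy W (K n) = en n.
Proof. by move=> nW; exact: (energy_widen (@supp_kern _ c1 c0 cm n) (leqnn n) nW). Qed.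
Lemma denE n W : (n < W)%N -> energy W (dif (K n)) = den n.
Proof. by move=> nW; exact: (energy_widen (supp_dif (@supp_kern _ c1 c0 cm n)) (leqnn _) nW). Qed.
Lemma lenE n W : (n < W)%N -> energy W (lap (K n)) = len n.
Proof. by move=> nW; exact: (energy_widen (supp_lap (@supp_kern _ c1 c0 cm n)) (leqnn _) nW). Qed.

Lemma en_ge0 n : 0 <= en n. Proof. exact: energy_ge0. Qed.
Lemma den_ge0 n : 0 <= den n. Proof. exact: energy_ge0. Qed.
Lemma len_ge0 n : 0 <= len n. Proof. exact: energy_ge0. Qed.

Lemma en_step n : en n.+1 = en n - be * den n + c1 * cm * len n.
Proof.
rewrite -(@enE n.+1 n.+3) //; last lia.
by rewrite (energy_tstep_eq (@supp_kern _ c1 c0 cm n)) // enE ?denE ?lenE //; lia.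
Qed.

Lemma den_decr n : den n.+1 <= den n.
Proof.
rewrite -(@denE n.+1 n.+4) -?(@denE n n.+4); try lia.
rewrite (eq_energy _ (dif_tstep c1 c0 cm (K n))).
by apply: (@energy_contract n.+1); [exact: supp_dif (@supp_kern _ c1 c0 cm n) | lia].
Qed.

Lemma len_decr n : len n.+1 <= len n.
Proof.
rewrite -(@lenE n.+1 n.+4) -?(@lenE n n.+4); try lia.
rewrite (eq_energy _ (lap_tstep c1 c0 cm (K n))).
by apply: (@energy_contract n.+1); [exact: supp_lap (@supp_kern _ c1 c0 cm n) | lia].
Qed.

Lemma en0 : en 0 = 1.
Proof. by rewrite /en /energy /zsum big_ord_recl big_ord0 addr0 /= expr1n. Qed.

Lemma en_decr n : en n.+1 <= en n.
Proof.
have : 0 <= be * den n by rewrite mulr_ge0 ?den_ge0.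
have : c1 * cm * len n <= 0 by rewrite mulr_le0_ge0 ?len_ge0.
rewrite en_step; lra.
Qed.

Lemma en_le1 n : en n <= 1.
Proof. by elim: n => [|n IH]; [rewrite en0 | apply: le_trans (en_decr n) IH]. Qed.

(** Nash's argument would use the l^1 norm of the kernel, on which nothing is known yet. Its
    substitute: [box H] commutes with the scheme, which contracts the energy, so [box H (K n)] has
    at most the energy of [box H delta0]. *)
Lemma nash_box n H : (0 < H)%N -> H%:R * en n <= 2 + 2 * H%:R ^+ 3 * den n.
Proof.
move=> H0; pose W := (n + H).+3.
have sK : supp n (K n) by exact: supp_kern.
have e1 : energy W (box H (K n)) <= H%:R.
  rewrite /kern box_iter.
  apply: le_trans (energy_box_delta0 (H := H) (W := W) _); last lia.
  by apply: (@energy_iter (0 + H)); [exact: supp_box supp_delta0 | lia].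
have e2 : energy W (fun j => H%:R * K n j - box H (K n) j) <= H%:R ^+ 4 * den n.
  by rewrite -(@denE n W); [apply: energy_sub_box sK _ |]; lia.
have e3 : H%:R ^+ 2 * en n <=
   2 * energy W (box H (K n)) + 2 * energy W (fun j => H%:R * K n j - box H (K n) j).
  rewrite -(@enE n W); last lia.
  rewrite /energy -!zsumZ -zsumD; apply: le_zsum => j.
  have := sqr_ge0 (H%:R * K n j - 2 * box H (K n) j); nra.
have Hgt : 0 < H%:R :> R by rewrite ltr0n.
have : H%:R * (H%:R * en n) <= H%:R * (2 + 2 * H%:R ^+ 3 * den n) by nra.
by rewrite ler_pM2l.
Qed.

Lemma nash n : en n ^+ 3 <= 125 * den n.
Proof.
have := en_ge0 n; rewrite le_eqVlt => /orP[/eqP <-|x0].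
  by rewrite expr0n /= mulr_ge0 // den_ge0.
have x1 := en_le1 n; set x := en n in x0 x1 *.
pose H := (Num.truncn (4 / x)).+1.
have y0 : 0 <= 4 / x by rewrite divr_ge0 // ltW.
have [Hl Hu] : (Num.truncn (4 / x))%:R <= 4 / x /\ 4 / x < H%:R.
  by have /andP[] := truncn_itv y0.
have Hx4 : 4 < H%:R * x by rewrite -ltr_pdivrMr.
have Hx5 : H%:R * x <= 5.
  move: Hl; rewrite ler_pdivlMr // /H -natr1; lra.
have := @nash_box n H isT; rewrite -/x => nb.
have d0 := den_ge0 n.
(* [4 < H x] in [nash_box] leaves this; multiplying by [x ^+ 3] and using [H x <= 5] produces 125 =
   5^3. *)
have D1 : 1 <= H%:R ^+ 3 * den n by lra.
apply: (@le_trans _ _ (x ^+ 3 * (H%:R ^+ 3 * den n))).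
  by rewrite ler_peMr // exprn_ge0 // ltW.
rewrite mulrA; apply: ler_wpM2r => //; rewrite -exprMn.
rewrite (_ : 125 = 5 ^+ 3 :> R); last by rewrite -natrX.
by rewrite lerXn2r ?nnegrE //; lra.
Qed.

(* [be * den] is the loss of energy per step and [den] decreases, so [l] steps lose at least [l]
   times the last loss. *)
Lemma den_halve (m l : nat) : be * (l%:R * den (m + l)) <= en m.
Proof.
suff : be * (l%:R * den (m + l)) <= en m - en (m + l).
  by have := en_ge0 (m + l); lra.
elim: l => [|l IH]; first by rewrite mul0r mulr0 addn0 subrr.
rewrite addnS en_step -[l.+1%:R]natr1; have := den_decr (m + l); have := len_ge0 (m + l).
have := den_ge0 (m + l).+1; have l0 : 0 <= l%:R :> R by [].
move=> d0 q0 dd.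
have : be * (l%:R * den (m + l).+1) <= be * (l%:R * den (m + l)).
  by apply: ler_wpM2l => //; apply: ler_wpM2l.
have : be * den (m + l).+1 <= be * den (m + l) by apply: ler_wpM2l.
have : c1 * cm * len (m + l) <= 0 by apply: mulr_le0_ge0.
lra.
Qed.

Lemma len_halve (m l : nat) : - (c1 * cm) * (l%:R * len (m + l)) <= en m.
Proof.
suff : - (c1 * cm) * (l%:R * len (m + l)) <= en m - en (m + l).
  by have := en_ge0 (m + l); lra.
elim: l => [|l IH]; first by rewrite mul0r mulr0 addn0 subrr.
rewrite addnS en_step -[l.+1%:R]natr1; have := len_decr (m + l); have := den_ge0 (m + l).
have := len_ge0 (m + l).+1; have l0 : 0 <= l%:R :> R by [].
have k0 : 0 <= - (c1 * cm) by rewrite oppr_ge0.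
move=> q0 d0 dd.
have : - (c1 * cm) * (l%:R * len (m + l).+1) <= - (c1 * cm) * (l%:R * len (m + l)).
  by apply: ler_wpM2l => //; apply: ler_wpM2l.
have : - (c1 * cm) * len (m + l).+1 <= - (c1 * cm) * len (m + l) by apply: ler_wpM2l.
have : 0 <= be * den (m + l) by apply: mulr_ge0.
lra.
Qed.

Lemma en_diffusive n : n%:R * (be / 125 * en n ^+ 2) <= 1.
Proof.
apply: (@decay_rec _ 2 _ en) => //; [by rewrite divr_ge0 | exact: en_ge0 |].
move=> {}n; rewrite en_step.
have := nash n; have := len_ge0 n; move=> q0 nn.
have : be * (en n ^+ 3) <= be * (125 * den n) by apply: ler_wpM2l.
have : c1 * cm * len n <= 0 by apply: mulr_le0_ge0.
have -> : en n * (1 - be / 125 * en n ^+ 2) = en n - be * en n ^+ 3 / 125 by field.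
lra.
Qed.

(** [nash] and [energy_dif_CS] combine into [en n ^+ 5 <= 5 ^+ 6 * len n], so the loss
    [- c1 * cm * len n] alone yields an energy of order n^(-1/4). *)
Lemma en_hyperdiffusive n : n%:R * (- (c1 * cm) / 5 ^+ 6 * en n ^+ 4) <= 1.
Proof.
have k0 : 0 <= - (c1 * cm) by rewrite oppr_ge0.
apply: (@decay_rec _ 4 _ en) => //; [by rewrite divr_ge0 | exact: en_ge0 |].
move=> {}n; rewrite en_step.
have cs : den n ^+ 2 <= en n * len n.
  rewrite -(@denE n n.+3) -?(@enE n n.+3) -?(@lenE n n.+3); try lia.
  by apply: energy_dif_CS (@supp_kern _ c1 c0 cm n) _; lia.
have x0 := en_ge0 n; have d0 := den_ge0 n; have q0 := len_ge0 n.
have n6 : (en n ^+ 3) ^+ 2 <= (125 * den n) ^+ 2.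
  by rewrite lerXn2r ?nnegrE ?exprn_ge0 ?mulr_ge0 // nash.
have n5 : en n ^+ 5 <= 5 ^+ 6 * len n.
  have [->|xn0] := eqVneq (en n) 0; first by rewrite expr0n /= mulr_ge0.
  have xgt : 0 < en n by rewrite lt_def xn0.
  rewrite -(ler_pM2l xgt) -exprS.
  have -> : en n ^+ 6 = (en n ^+ 3) ^+ 2 by rewrite -exprM.
  nra.
have : - (c1 * cm) * en n ^+ 5 <= - (c1 * cm) * (5 ^+ 6 * len n) by apply: ler_wpM2l.
have : 0 <= be * den n by apply: mulr_ge0.
have -> : en n * (1 - - (c1 * cm) / 5 ^+ 6 * en n ^+ 4)
   = en n - (- (c1 * cm) * en n ^+ 5) / 5 ^+ 6 by field.
lra.
Qed.

Lemma kern_sq_le1 n j : K n j ^+ 2 <= 1.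
Proof.
have [jn|nj] := leqP `|j| n; last by rewrite (supp_kern _ _ _ nj) expr0n.
apply: le_trans (en_le1 n).
by apply: (@zsum_term _ n (fun j => K n j ^+ 2)) jn => i; exact: sqr_ge0.
Qed.

Lemma kern_pow4 n j : K n j ^+ 4 <= 8 * (en n * den n).
Proof.
have e : energy n.+3 (K n) = en n by apply: enE; lia.
have d : energy n.+3 (dif (K n)) = den n by apply: denE; lia.
by rewrite -e -d; apply: (@sup_energy _ n); [exact: supp_kern | lia].
Qed.

(** The energies at times n and n/2 are of order (n be)^(-1/2); the loss between these times bounds
    [den n] at order (n be)^(-3/2), and [kern_pow4] multiplies the two. *)
Lemma kern_diffusive n j : n%:R * be * K n j ^+ 2 <= 64.
Proof.
(* The first step loses at most the whole energy [en 0 = 1], while [den 0 >= 1]. *)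
have be1 : be <= 1.
  have := en_ge0 1; rewrite en_step en0.
  have : 1 <= den 0.
    apply: le_trans (_ : dif (K 0) 0 ^+ 2 <= _).
      by rewrite /dif /= /delta0 /= sub0r sqrrN expr1n.
    by apply: (@zsum_term _ 1 (fun j => dif (K 0) j ^+ 2)) => // i; exact: sqr_ge0.
  move=> d1 h; have : be * 1 <= be * den 0 by apply: ler_wpM2l.
  have : c1 * cm * len 0 <= 0 by apply: mulr_le0_ge0; rewrite ?len_ge0.
  lra.
have k0 : 0 <= K n j ^+ 2 := sqr_ge0 _.
have [n1|n2] := leqP n 1.
  have : n%:R <= 1 :> R by rewrite lern1.
  have : 0 <= n%:R :> R by [].
  have := kern_sq_le1 n j; move: k0; set k := K n j ^+ 2.
  set N := n%:R => k0 k1 N0 N1.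
  have : N * be <= 1 * 1 by apply: ler_pM.
  have : 0 <= N * be by apply: mulr_ge0.
  nra.
pose m := n./2; have nm : n = (m + (n - m))%N by lia.
have Nm : n%:R <= 3 * m%:R :> R by rewrite -natrM ler_nat /m; clear -n2; lia.
have Nl : n%:R <= 2 * (n - m)%:R :> R by rewrite -natrM ler_nat /m; clear -n2; lia.
have := den_halve m (n - m); rewrite -nm => dh.
have hx := en_diffusive n; have hy := en_diffusive m.
have sk := kern_pow4 n j.
rewrite (exprM _ 2 2) in sk; rewrite mulrA in hx; rewrite mulrA in hy.
have x0 := en_ge0 n; have y0 := en_ge0 m; have d0 := den_ge0 n.
have N0 : 0 <= n%:R :> R by [].
set P := n%:R * be; have P0 : 0 <= P by apply: mulr_ge0.
have Px : P * en n ^+ 2 <= 125 by rewrite /P; lra.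
have Py : P * en m ^+ 2 <= 375.
  have : P * en m ^+ 2 <= 3 * m%:R * be * en m ^+ 2.
    by apply: ler_wpM2r; [exact: sqr_ge0 | apply: ler_wpM2r].
  lra.
have PD : P * den n <= 2 * en m.
  have : P * den n <= 2 * (n - m)%:R * be * den n.
    by apply: ler_wpM2r => //; apply: ler_wpM2r.
  lra.
clearbody P; clear hx hy dh Nm Nl.
set k := K n j ^+ 2 in k0 sk *; set x := en n in x0 Px sk *.
set y := en m in y0 Py PD *; set D := den n in d0 PD sk *.
have h1 : (P * k) ^+ 2 <= 16 * (P * (x * y)).
  have : P * x * (P * D) <= P * x * (2 * y) by apply: ler_wpM2l => //; apply: mulr_ge0.
  have : P ^+ 2 * k ^+ 2 <= P ^+ 2 * (8 * (x * D)) by apply: ler_wpM2l => //; exact: sqr_ge0.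
  rewrite exprMn; nra.
(* The constants fit because 125 * 375 <= 240^2 and then 16 * 240 <= 64^2. *)
have h2 : (P * (x * y)) ^+ 2 <= (12 * 20) ^+ 2.
  have -> : (P * (x * y)) ^+ 2 = (P * x ^+ 2) * (P * y ^+ 2) by ring.
  rewrite exprMn; apply: ler_pM; try (by apply: mulr_ge0 => //; exact: sqr_ge0); lra.
have h3 : P * (x * y) <= 12 * 20.
  by move: h2; rewrite ler_pXn2r ?nnegrE ?mulr_ge0.
rewrite -(@ler_pXn2r _ 2) // ?nnegrE; first last.
- exact: ler0n.
- exact: mulr_ge0.
by apply: le_trans h1 _; lra.
Qed.

End Nash.

(** * The Lax-Wendroff kernel *)

Ltac positivity :=
  repeat first [ assumption | (apply: ltW; assumption) | exact: ltr0n | exact: ler0n | exact: ltr01 | exact: ler01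
               | exact: sqr_ge0 | exact: normr_ge0
               | apply: exprn_gt0 | apply: mulr_gt0 | apply: addr_gt0
               | rewrite invr_gt0
               | apply: exprn_ge0 | apply: mulr_ge0 | apply: addr_ge0
               | rewrite invr_ge0 | apply: ltW ].

(** The bounded increasing function [x / (B + |x|)] is a rational stand-in for the arctangent: its
    unit increments dominate the summand up to the factor [8 * B], and they telescope to at most
    2. *)
Lemma zsum_cauchy (R : realFieldType) (W : nat) (B y : R) : 1 <= B ->
  zsum W (fun j => B ^+ 2 / (B ^+ 2 + (j%:~R - y) ^+ 2)) <= 16 * B.
Proof.
move=> B1; have B0 : 0 < B by lra.
pose h x : R := x / (B + `|x|).
have hb x : `|h x| <= 1.
  have p : 0 < B + `|x| by have := normr_ge0 x; lra.
  by rewrite normrM normfV (gtr0_norm p) ler_pdivrMr // mul1r lerDr ltW.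
have step (x : R) : B ^+ 2 / (B ^+ 2 + x ^+ 2) <= 8 * B * (h (x + 1) - h x).
  have q : 0 < B ^+ 2 + x ^+ 2.
    by apply: ltr_wpDr; [exact: sqr_ge0 | exact: exprn_gt0].
  have fin c d : 0 < d -> h (x + 1) - h x = c / d ->
      B * d <= 8 * c * (B ^+ 2 + x ^+ 2) ->
      B ^+ 2 / (B ^+ 2 + x ^+ 2) <= 8 * B * (h (x + 1) - h x).
    move=> d0 -> le; rewrite ler_pdivrMr //.
    have -> : 8 * B * (c / d) * (B ^+ 2 + x ^+ 2) = B * ((8 * c * (B ^+ 2 + x ^+ 2)) / d).
      by field; rewrite gt_eqF.
    by rewrite expr2 ler_pM2l // ler_pdivlMr.
  have [x0|x0] := leP 0 x.
    apply: (fin B ((B + x) * (B + x + 1))).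
    - by apply: mulr_gt0; lra.
    - rewrite /h !ger0_norm; try lra.
      by field; apply/andP; split; apply/eqP; lra.
    - rewrite -mulrA [8 * _]mulrC -!mulrA ler_pM2l //.
      have := sqr_ge0 (B - x); nra.
  have [x1|x1] := leP x (-1).
    apply: (fin B ((B - x) * (B - x - 1))).
    - by apply: mulr_gt0; lra.
    - rewrite /h !ler0_norm; try lra.
      by field; apply/andP; split; apply/eqP; lra.
    - rewrite -mulrA [8 * _]mulrC -!mulrA ler_pM2l //.
      have := sqr_ge0 (B + x); nra.
  apply: (fin ((x + 1) * (B - x) - x * (B + x + 1)) ((B - x) * (B + x + 1))).
  - by apply: mulr_gt0; lra.
  - rewrite /h (ger0_norm (x := x + 1)) ?ler0_norm; try lra.
    by field; apply/andP; split; apply/eqP; lra.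
  - have -> : (x + 1) * (B - x) - x * (B + x + 1) = B - 2 * x - 2 * x ^+ 2 by ring.
    have c1 : B <= B - 2 * x - 2 * x ^+ 2 by nra.
    have d1 : (B - x) * (B + x + 1) <= 4 * B ^+ 2 by nra.
    have : 8 * B * (B ^+ 2 + x ^+ 2) <= 8 * (B - 2 * x - 2 * x ^+ 2) * (B ^+ 2 + x ^+ 2).
      by apply: ler_wpM2r; [exact: ltW | lra].
    have : B * ((B - x) * (B + x + 1)) <= B * (4 * B ^+ 2) by apply: ler_wpM2l => //; lra.
    have : 0 <= B * x ^+ 2 by apply: mulr_ge0; [lra | exact: sqr_ge0].
    have : 0 <= B * B ^+ 2 by apply: mulr_ge0; [lra | exact: sqr_ge0].
    lra.
apply: (@le_trans _ _ (zsum W (fun j => 8 * B * (h ((j + 1)%:~R - y) - h (j%:~R - y))))).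
  apply: le_zsum => j; apply: le_trans (step _) _.
  by rewrite intrD (_ : j%:~R - y + 1 = j%:~R + 1%:~R - y) //; ring.
rewrite zsumZ (zsum_tel W (fun j : int => h (j%:~R - y))).
rewrite (_ : 16 * B = 8 * B * 2); last ring.
apply: ler_wpM2l; first lra.
have := hb ((W%:Z + 1)%:~R - y); have := hb ((- W%:Z)%:~R - y).
by rewrite !ler_norml => /andP[? ?] /andP[? ?]; lra.
Qed.

Section LaxWendroffKernel.
Context {R : realType}.
Implicit Types (a : R) (n W : nat) (j : int).

(** Weights of [j - 1], [j], [j + 1] in Lax-Wendroff at a positive Courant number [a]. The right
    side of the shock, whose Courant number is negative, is the mirror image of such a scheme. *)
Definition b1 a : R := a * (1 + a) / 2.
Definition b0 a : R := 1 - a ^+ 2.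
Definition bm a : R := - (a * (1 - a) / 2).
Definition lw a := tstep (b1 a) (b0 a) (bm a).
Definition green a n := kern (b1 a) (b0 a) (bm a) n.
Definition mu a : R := a * (1 - a ^+ 2) / 2.

Lemma b_sum a : b1 a + b0 a + bm a = 1.
Proof. by rewrite /b1 /b0 /bm; field. Qed.

(** Second order accuracy: the diffusive term of [energy_tstep] cancels, and energy is lost through
    the second difference only. *)
Lemma b_beta a : b0 a * (b1 a + bm a) + 4 * (b1 a * bm a) = 0.
Proof. by rewrite /b1 /b0 /bm; field. Qed.

Lemma b1bm a : - (b1 a * bm a) = a ^+ 2 * (1 - a ^+ 2) / 4.
Proof. by rewrite /b1 /bm; field. Qed.

Lemma b1bm_lt0 a : 0 < a < 1 -> b1 a * bm a < 0.
Proof.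
move=> /andP[a0 a1]; rewrite -oppr_gt0 b1bm divr_gt0 //.
by rewrite mulr_gt0 ?exprn_gt0 // subr_gt0 expr_lt1 // ltW.
Qed.

Lemma mu_gt0 a : 0 < a < 1 -> 0 < mu a.
Proof.
move=> /andP[a0 a1]; rewrite /mu divr_gt0 // mulr_gt0 // subr_gt0 expr_lt1 //.
exact: ltW.
Qed.

Lemma supp_green a n : supp n (green a n).
Proof. exact: supp_kern. Qed.

(* The symbol F of the scheme satisfies x F'(x) - a F(x) = mu (x - 2 + 1/x). *)
Lemma green_airy a n j :
  (j%:~R - a * n.+1%:R) * green a n.+1 j = n.+1%:R * mu a * lap (green a n) j.
Proof.
elim: n j => [|n IH] j.
  rewrite /green /= /tstep /lap /delta0 mulr1 mul1r.
  have [->|j0] := eqVneq j 0.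
    by rewrite /= /b0 /mu; field.
  have [->|j1] := eqVneq j 1; first by rewrite /= /b1 /mu; field.
  have [->|jm] := eqVneq j (-1); first by rewrite /= /bm /mu; field.
  have -> : (j - 1 == 0) = false by apply/negbTE; lia.
  have -> : (j + 1 == 0) = false by apply/negbTE; lia.
  by rewrite /= !mulr0 !addr0 subr0 !mulr0.
set g := green a n.+1 in IH *.
have -> : green a n.+2 j = lw a g j by [].
have e1 : (j%:~R - a * n.+2%:R) * lw a g j =
   lw a (fun i => (i%:~R - a * n.+1%:R) * g i) j + mu a * lap g j.
  by rewrite /lw /tstep /lap -[n.+2%:R]natr1 /= !intrD /mu /b1 /b0 /bm; field.
rewrite e1 (_ : (fun i => _) = (fun i => n.+1%:R * mu a * lap (green a n) i)); last first.
  by apply/funext => i; rewrite IH.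
have -> : lw a (fun i => n.+1%:R * mu a * lap (green a n) i) j
       = n.+1%:R * mu a * lap g j.
  have -> : lap g j = lw a (lap (green a n)) j.
    by rewrite /g /green /= lap_tstep.
  by rewrite /lw /tstep; ring.
rewrite -[n.+2%:R]natr1; ring.
Qed.

(** [th] stands for n^(1/8), which turns fractional powers into integer ones. The factor 4 lets the
    [th] of a time serve at about half that time. *)
Lemma green_energy a : 0 < a < 1 -> exists2 C : R, 0 < C &
  forall n (th : R), 0 < th -> th ^+ 8 <= 4 * n%:R ->
    en (b1 a) (b0 a) (bm a) n <= C / th ^+ 2.
Proof.
move=> a01; have k0 : 0 < - (b1 a * bm a) by rewrite oppr_gt0 b1bm_lt0.
set k := - (b1 a * bm a) in k0.
pose C := 1 + 4 * 5 ^+ 6 / k.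
have C1 : 1 <= C by rewrite /C lerDl divr_ge0 // ltW.
exists C; first lra.
move=> n th th0 thn; set x := en _ _ _ n.
have x0 : 0 <= x := en_ge0 _ _ _ _.
have hyp := @en_hyperdiffusive R (b1 a) (b0 a) (bm a) (b_sum a) _ _ n.
have {}hyp : n%:R * (k / 5 ^+ 6 * x ^+ 4) <= 1.
  by apply: hyp; rewrite ?b_beta // ltW // b1bm_lt0.
have t20 : 0 < th ^+ 2 by exact: exprn_gt0.
have C0 : 0 <= C by lra.
rewrite ler_pdivlMr // -(@ler_pXn2r _ 4) ?nnegrE //; last exact: mulr_ge0 (ltW t20).
have -> : (x * th ^+ 2) ^+ 4 = th ^+ 8 * x ^+ 4 by ring.
have : th ^+ 8 * x ^+ 4 <= C.
  apply: (@le_trans _ _ (4 * n%:R * x ^+ 4)).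
    by apply: ler_wpM2r => //; exact: exprn_ge0.
  have -> : 4 * n%:R * x ^+ 4 = (n%:R * (k / 5 ^+ 6 * x ^+ 4)) * (4 * 5 ^+ 6 / k).
    by field; rewrite gt_eqF.
  rewrite /C; have : 0 <= 4 * 5 ^+ 6 / k by rewrite divr_ge0 // ltW.
  set z := 4 * 5 ^+ 6 / k; set w := n%:R * _ in hyp *; nra.
by move=> h; apply: le_trans h _; apply: ler_eXnr.
Qed.

(** By [green_airy] the moment is (n mu)^2 times a [len], which [len_halve] bounds by the energy at
    half time over n: n^2 * n^(-1) * n^(-1/4) = th^6. *)
Lemma green_moment a : 0 < a < 1 -> exists2 C : R, 0 < C &
  forall n (th : R), (0 < n)%N -> 0 < th -> th ^+ 8 = n%:R ->
    zsum n (fun j => (j%:~R - a * n%:R) ^+ 2 * green a n j ^+ 2) <= C * th ^+ 6.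
Proof.
move=> a01; have [C C0 HC] := green_energy a01.
have k0 : 0 < - (b1 a * bm a) by rewrite oppr_gt0 b1bm_lt0.
have m0 := mu_gt0 a01.
set k := - (b1 a * bm a) in k0 *.
pose D := 96 * mu a ^+ 2 + 8 * mu a ^+ 2 * C / k.
have D0 : 0 < D.
  have m2 : 0 < mu a ^+ 2 by exact: exprn_gt0.
  have : 0 <= 8 * mu a ^+ 2 * C / k by positivity.
  by rewrite /D; lra.
exists D => // -[//|n] th _ th0 thn.
have t1 : 1 <= th.
  have : 1 <= th ^+ 8 by rewrite thn ler1n.
  by rewrite expr_ge1 // ltW.
pose L i := len (b1 a) (b0 a) (bm a) i.
have -> : zsum n.+1 (fun j => (j%:~R - a * n.+1%:R) ^+ 2 * green a n.+1 j ^+ 2)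
   = (n.+1%:R * mu a) ^+ 2 * L n.
  rewrite /L /len /energy -zsumZ; apply: eq_zsum => j.
  by rewrite -!exprMn green_airy.
have L0 i : 0 <= L i := len_ge0 _ _ _ _.
have be0 : 0 <= b0 a * (b1 a + bm a) + 4 * (b1 a * bm a) by rewrite b_beta.
have kle : b1 a * bm a <= 0 by rewrite ltW // b1bm_lt0.
have Ldecr i : L i.+1 <= L i by apply: len_decr (b_sum a) be0 kle i.
have L6 i : L i <= 6.
  elim: i => [|i IH]; last exact: le_trans (Ldecr i) IH.
  rewrite /L /len /energy /zsum !big_ord_recl big_ord0 /= /lap /delta0 /=.
  by rewrite !(mulr0, subr0, addr0, add0r, mulr1, expr1n, sub0r, sqrrN) /= ; lra.
have [n3|n3] := leqP n 3.
  have : n.+1%:R <= 4 :> R by rewrite ler_nat.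
  have : 0 <= n.+1%:R :> R by [].
  set N := n.+1%:R => N0 N4.
  have : (N * mu a) ^+ 2 * L n <= (4 * mu a) ^+ 2 * 6.
    apply: ler_pM => //; first exact: sqr_ge0.
    rewrite ler_pXn2r // ?nnegrE; first by rewrite ler_pM2r.
      by apply: mulr_ge0 => //; exact: ltW.
    by apply: mulr_ge0 => //; exact: ltW.
  have : D * 1 <= D * th ^+ 6 by apply: ler_wpM2l; [exact: ltW | exact: exprn_ege1].
  have : 0 <= 8 * mu a ^+ 2 * C / k by positivity.
  move=> h1 h2 h3; apply: le_trans h3 (le_trans _ h2).
  rewrite mulr1 /D exprMn; lra.
pose m := n./2; have nm : n = (m + (n - m))%N by rewrite /m; clear; lia.
have Nm : n.+1%:R <= 4 * m%:R :> R by rewrite -natrM ler_nat /m; clear -n3; lia.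
have Nl : n.+1%:R <= 4 * (n - m)%:R :> R by rewrite -natrM ler_nat /m; clear -n3; lia.
have := @len_halve R (b1 a) (b0 a) (bm a) (b_sum a) be0 kle m (n - m).
rewrite -nm -/(L n) -/k => kl.
have t20 : 0 < th ^+ 2 by exact: exprn_gt0.
have := HC m th th0; rewrite thn => /(_ Nm); set E := en _ _ _ m in kl * => HE.
have h1 : n.+1%:R * L n <= 4 * E / k.
  rewrite ler_pdivlMr //; have : n.+1%:R * L n <= 4 * (n - m)%:R * L n by apply: ler_wpM2r.
  nra.
have h2 : n.+1%:R * L n <= 4 * (C / th ^+ 2) / k.
  by apply: le_trans h1 _; rewrite ler_pM2r ?invr_gt0 // ler_pM2l.
apply: (@le_trans _ _ (th ^+ 8 * mu a ^+ 2 * (4 * (C / th ^+ 2) / k))).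
  rewrite thn exprMn.
  have -> : n.+1%:R ^+ 2 * mu a ^+ 2 * L n = n.+1%:R * mu a ^+ 2 * (n.+1%:R * L n) by ring.
  by apply: ler_wpM2l => //; rewrite mulr_ge0 ?sqr_ge0.
have -> : th ^+ 8 * mu a ^+ 2 * (4 * (C / th ^+ 2) / k) = 4 * mu a ^+ 2 * C / k * th ^+ 6.
  by field; rewrite !gt_eqF.
apply: ler_wpM2r; first by apply: exprn_ge0; exact: ltW.
have : 0 <= mu a ^+ 2 * C / k by positivity.
have := sqr_ge0 (mu a); rewrite /D; lra.
Qed.

(* Cauchy-Schwarz against the weight [B^2 / (B^2 + (j - a n)^2)] with [B = th^4 = n^(1/2)]. *)
Lemma green_l1 a : 0 < a < 1 -> exists2 C : R, 0 < C &
  forall n (th : R), (0 < n)%N -> 0 < th -> th ^+ 8 = n%:R ->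
    zsum n (fun j => `|green a n j|) <= C * th.
Proof.
move=> a01; have [C C0 HC] := green_energy a01; have [D D0 HD] := green_moment a01.
exists ((C + D) / 2 + 8); first lra.
move=> n th n0 th0 thn.
have t1 : 1 <= th.
  have : 1 <= th ^+ 8 by rewrite thn ler1n.
  by rewrite expr_ge1 // ltW.
have B1 : 1 <= th ^+ 4 by exact: exprn_ege1.
have hE : zsum n (fun j => green a n j ^+ 2) <= C / th ^+ 2.
  by apply: HC => //; rewrite thn; have : 0 <= n%:R :> R by []; lra.
have hM := HD n th n0 th0 thn.
have hS := zsum_cauchy n (a * n%:R) B1.
set M := zsum _ _ in hM; set S := zsum _ _ in hS; set E := zsum _ _ in hE.
(* Cauchy-Schwarz in pointwise form: the combination of the three summands exceeds [|g|] by a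
   square, and the powers of [th] make each of the three sums of order [th]. *)
apply: (@le_trans _ _ (th ^+ 3 / 2 * E + (2 * th ^+ 5)^-1 * M + (2 * th ^+ 3)^-1 * S)).
  rewrite /E /M /S -!zsumZ -!zsumD; apply: le_zsum => j.
  set g := green a n j; set y := j%:~R - _.
  have q : 0 < (th ^+ 4) ^+ 2 + y ^+ 2.
    by apply: ltr_pwDl; rewrite ?sqr_ge0 // !exprn_gt0.
  have -> : th ^+ 3 / 2 * g ^+ 2 + (2 * th ^+ 5)^-1 * (y ^+ 2 * g ^+ 2) +
      (2 * th ^+ 3)^-1 * ((th ^+ 4) ^+ 2 / ((th ^+ 4) ^+ 2 + y ^+ 2)) =
     (((th ^+ 4) ^+ 2 + y ^+ 2) * `|g| - th ^+ 5) ^+ 2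
       / (2 * ((th ^+ 4) ^+ 2 + y ^+ 2) * th ^+ 5) + `|g|.
    rewrite -[g ^+ 2]real_normK ?num_real //.
    by field; rewrite !gt_eqF.
  by rewrite lerDr divr_ge0 ?sqr_ge0 // ltW // !mulr_gt0 // exprn_gt0.
have p k : 0 < th ^+ k by exact: exprn_gt0.
have -> : ((C + D) / 2 + 8) * th = th ^+ 3 / 2 * (C / th ^+ 2) + (2 * th ^+ 5)^-1 * (D * th ^+ 6)
  + (2 * th ^+ 3)^-1 * (16 * th ^+ 4).
  by field; rewrite gt_eqF.
apply: lerD; first apply: lerD.
- by apply: ler_wpM2l => //; rewrite divr_ge0 // ltW.
- by apply: ler_wpM2l => //; rewrite invr_ge0 mulr_ge0 // ltW.
- by apply: ler_wpM2l => //; rewrite invr_ge0 mulr_ge0 // ltW.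
Qed.

End LaxWendroffKernel.

(** * Taylor bounds for the exponential *)

Section ExpBounds.
Context {R : realType}.
Implicit Types (x t : R).

Lemma nincr_derive (f df : R -> R) : (forall x, is_derive x 1 f (df x)) ->
  (forall x, 0 <= x -> df x <= 0) -> forall x, 0 <= x -> f x <= f 0.
Proof.
move=> fd dle x; rewrite le_eqVlt => /orP[/eqP <- //|x0].
have [] := @MVT R f df 0 x x0 (fun x _ => fd x).
  apply: continuous_subspaceT => y; apply: differentiable_continuous.
  by apply/derivable1_diffP; have [] := fd y.
move=> c; rewrite in_itv /= => /andP[c0 cx] e.
rewrite -subr_le0 e mulr_le0_ge0 //; first by apply: dle; exact: ltW.
by rewrite subr0 ltW.
Qed.

Lemma expRN_ge_cubic x : 0 <= x ->
  expR x * (1 - x + x ^+ 2 / 2 - x ^+ 3 / 6) <= 1.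
Proof.
move=> x0.
have := @nincr_derive (fun x => expR x * (1 - x + x ^+ 2 / 2 - x ^+ 3 / 6))
  (fun x => - (expR x * (x ^+ 3 / 6))) _ _ x x0.
rewrite expR0 !expr0n /= !mul0r !subr0 addr0 mul1r; apply.
  move=> {x0}x; apply: is_derive_eq.
  by rewrite /GRing.scale /=; field.
by move=> y y0; rewrite oppr_le0 mulr_ge0 ?expR_ge0 // divr_ge0 // exprn_ge0.
Qed.

Lemma expR_ge_quad x : 0 <= x -> 1 + x + x ^+ 2 / 2 <= expR x.
Proof.
move=> x0; rewrite -subr_le0.
have := @nincr_derive (fun x => 1 + x + x ^+ 2 / 2 - expR x)
  (fun x => 1 + x - expR x) _ _ x x0.
rewrite expR0 !expr0n /= !mul0r !addr0 subrr; apply.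
  move=> {x0}x; apply: is_derive_eq.
  by rewrite /GRing.scale /=; field.
by move=> y y0; rewrite subr_le0 expR_ge1Dx.
Qed.

Lemma expR_le_cubic x : 0 <= x <= 1 -> expR x <= 1 + x + x ^+ 2 / 2 + 2 * x ^+ 3.
Proof.
move=> /andP[x0 x1]; have h := expRN_ge_cubic x0.
have p0 : 0 < 1 - x + x ^+ 2 / 2 - x ^+ 3 / 6 by nra.
rewrite -(ler_pM2r p0); apply: le_trans h _.
rewrite -subr_ge0.
have -> : (1 + x + x ^+ 2 / 2 + 2 * x ^+ 3) * (1 - x + x ^+ 2 / 2 - x ^+ 3 / 6) - 1
  = x ^+ 3 * (11 / 6 - 23 / 12 * x + 11 / 12 * x ^+ 2 - x ^+ 3 / 3) by field.
apply: mulr_ge0; first exact: exprn_ge0.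
nra.
Qed.

End ExpBounds.

(** * Conjugation of the kernel by geometric weights *)

Section Tilt.
Context {R : realType}.
Implicit Types (s t a : R) (n : nat) (j : int).

Lemma kern_conj (c1 c0 cm s t : R) n j : t != 0 ->
  kern (s * (t * c1)) (s * c0) (s * (t^-1 * cm)) n j
  = s ^+ n * t ^ j * kern c1 c0 cm n j.
Proof.
move=> t0; elim: n j => [|n IH] j.
  rewrite expr0 mul1r /= /delta0; have [->|_] := eqVneq j 0.
    by rewrite expr0z mul1r.
  by rewrite /= mulr0.
rewrite /kern !iterS -!/(kern _ _ _ n) /tstep !IH exprS.
by rewrite !(expfzDr _ _ t0) expr1z exprN1; field.
Qed.

(** Multiplying the kernel by exp(j / nu) and normalising by the symbol [F] gives a scheme with
    diffusion of order 1/nu, so [kern_diffusive] bounds it by (n / nu)^(-1/2), of order 1/nu.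
    Undoing the weight leaves the exponential. The slack in [nu ^+ 3] lets one [nu] serve the times
    n and n + 1. *)
Lemma green_right a : 0 < a < 1 -> exists2 C : R, 0 < C &
  forall n (nu : R) j, 0 < nu -> n%:R <= nu ^+ 3 <= 4 * n%:R ->
    `|green a n j| <= C / nu * expR (- ((j%:~R - a * n%:R) / nu)).
Proof.
move=> a01; have /andP[a0 a1] := a01.
have b10 : 0 < b1 a by rewrite /b1; positivity; lra.
have b00 : 0 < b0 a by rewrite subr_gt0 expr_lt1 // ltW.
have bm0 : bm a < 0 by rewrite oppr_lt0 divr_gt0 // mulr_gt0 // subr_gt0.
pose k := b0 a * b1 a; have k0 : 0 < k by exact: mulr_gt0.
exists (16 / Num.sqrt k * expR 8); first by rewrite mulr_gt0 ?expR_gt0 // divr_gt0 // sqrtr_gt0.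
move=> n nu j nu0 /andP[nun1 nun4].
have n1 : 1 <= n%:R :> R.
  by rewrite ler1n; case: n nun4 {nun1} => //; rewrite mulr0 leNgt exprn_gt0.
have nu1 : 1 <= nu.
  have : 1 <= nu ^+ 3 by apply: le_trans n1 nun1.
  by rewrite expr_ge1 // ltW.
pose eta := nu^-1; have e0 : 0 < eta by rewrite invr_gt0.
have e1 : eta <= 1 by rewrite invf_le1.
pose t := expR eta; have t0 : 0 < t := expR_gt0 _.
have tge : 1 + eta <= t := expR_ge1Dx _.
pose F := t * b1 a + b0 a + t^-1 * bm a.
have ti : t^-1 <= 1 by rewrite invf_le1 //; lra.
have ti0 : 0 < t^-1 by rewrite invr_gt0.
have F0 : 0 < F.
  have : b1 a * 1 <= b1 a * t by apply: ler_wpM2l; [exact: ltW | lra].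
  have : bm a * 1 <= bm a * t^-1 by apply: ler_wnM2l; [exact: ltW | lra].
  by rewrite /F /b1 /b0 /bm; lra.
(* As [b1 - bm = a] and [b1 + bm = a ^+ 2], [F] agrees with [expR (a * eta)] to second order; the
   cubic error is harmless over n steps because [n * eta ^+ 3 <= 1]. *)
have FE : F <= expR (a * eta + 3 * eta ^+ 3).
  have q0 : 0 <= a * eta + 3 * eta ^+ 3 by positivity.
  apply: le_trans (expR_ge_quad q0).
  have h1 : t <= 1 + eta + eta ^+ 2 / 2 + 2 * eta ^+ 3.
    by apply: expR_le_cubic; rewrite (ltW e0).
  have h2 : 1 - eta + eta ^+ 2 / 2 - eta ^+ 3 / 6 <= t^-1.
    by rewrite -[t^-1]mul1r ler_pdivlMr // mulrC expRN_ge_cubic // ltW.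
  have h3 : t * b1 a <= (1 + eta + eta ^+ 2 / 2 + 2 * eta ^+ 3) * b1 a.
    by rewrite ler_pM2r.
  have h4 : t^-1 * bm a <= (1 - eta + eta ^+ 2 / 2 - eta ^+ 3 / 6) * bm a.
    by rewrite ler_nM2r.
  apply: (@le_trans _ _ (1 + a * eta + a ^+ 2 * eta ^+ 2 / 2 + 3 * eta ^+ 3)).
    have e3 : 0 <= eta ^+ 3 by apply: exprn_ge0; exact: ltW.
    have : (2 * b1 a - bm a / 6 * (- 1) * (-1)) * eta ^+ 3 <= 3 * eta ^+ 3.
      by apply: ler_wpM2r => //; rewrite /b1 /bm; nra.
    rewrite /F; move: h3 h4; rewrite /b1 /b0 /bm.
    move=> h3 h4 h5; apply: le_trans (lerD (lerD h3 (lexx _)) h4) _; lra.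
  have : 0 <= 3 * eta ^+ 3 * (2 * (a * eta) + 3 * eta ^+ 3) by positivity.
  lra.
have s1 : F^-1 * (t * b1 a) + F^-1 * b0 a + F^-1 * (t^-1 * bm a) = 1.
  by rewrite -!mulrDr mulVf // gt_eqF.
(* The diffusion coefficient is 0 at [t = 1] by [b_beta] and grows at least linearly in [t - 1]. *)
have be_ge : F^-1 ^+ 2 * (k * eta) <= F^-1 * b0 a * (F^-1 * (t * b1 a) + F^-1 * (t^-1 * bm a)) +
   4 * (F^-1 * (t * b1 a) * (F^-1 * (t^-1 * bm a))).
  have -> : F^-1 * b0 a * (F^-1 * (t * b1 a) + F^-1 * (t^-1 * bm a)) +
   4 * (F^-1 * (t * b1 a) * (F^-1 * (t^-1 * bm a))) = F^-1 ^+ 2 *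
     (b0 a * (t * b1 a + t^-1 * bm a) + 4 * (b1 a * bm a)).
    by field; rewrite !gt_eqF.
  apply: ler_wpM2l; first exact: sqr_ge0.
  have -> : b0 a * (t * b1 a + t^-1 * bm a) + 4 * (b1 a * bm a) =
      k * (t - 1) + b0 a * (bm a * (t^-1 - 1)).
    rewrite -[RHS]addr0 -(b_beta a) /k; ring.
  have : k * eta <= k * (t - 1) by rewrite ler_pM2l //; lra.
  have : 0 <= b0 a * (bm a * (t^-1 - 1)).
    apply: mulr_ge0; first exact: ltW.
    by apply: mulr_le0; [exact: ltW | lra].
  lra.
have ke0 : 0 <= F^-1 ^+ 2 * (k * eta) by rewrite mulr_ge0 ?sqr_ge0 // mulr_ge0 // ltW.
have be0 := le_trans ke0 be_ge.
have neg : F^-1 * (t * b1 a) * (F^-1 * (t^-1 * bm a)) <= 0.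
  rewrite (_ : _ * _ = F^-1 ^+ 2 * (b1 a * bm a)); last by field; rewrite !gt_eqF.
  by rewrite mulr_ge0_le0 ?sqr_ge0 // ltW // b1bm_lt0.
have := kern_diffusive s1 be0 neg n j; rewrite kern_conj ?gt_eqF //.
rewrite -/(green a n) => main.
have {}main : n%:R * (F^-1 ^+ 2 * (k * eta)) * (F^-1 ^+ n * t ^ j * green a n j) ^+ 2 <= 64.
  apply: le_trans main; apply: ler_wpM2r; first exact: sqr_ge0.
  by apply: ler_wpM2l.
have tj0 : 0 < t ^ j by exact: exprz_gt0.
have tj : t ^ j = expR (eta * j%:~R).
  rewrite /t; case: (j) => m; first by rewrite -exprnP -expRM_natr.
  by rewrite NegzE -exprnN -expRM_natr mulrNz mulrN expRN.
have q0 : 0 < Num.sqrt k by rewrite sqrtr_gt0.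
have FV : 0 < F^-1 ^+ n.+1 by rewrite exprn_gt0 // invr_gt0.
have {}main : (nu * Num.sqrt k * F^-1 ^+ n.+1 * t ^ j * `|green a n j|) ^+ 2 <= 16 ^+ 2.
  have -> : (nu * Num.sqrt k * F^-1 ^+ n.+1 * t ^ j * `|green a n j|) ^+ 2 =
     nu ^+ 3 * (F^-1 ^+ 2 * (k * eta)) * (F^-1 ^+ n * t ^ j * green a n j) ^+ 2.
    rewrite (exprS F^-1 n) !exprMn real_normK ?num_real // sqr_sqrtr ?(ltW k0) // /eta.
    by field; rewrite !gt_eqF.
  move: main; set z := (F^-1 ^+ n * _ * _) ^+ 2; set w := F^-1 ^+ 2 * _ => main.
  have : nu ^+ 3 * w * z <= 4 * n%:R * w * z.
    by apply: ler_wpM2r; [exact: sqr_ge0 | apply: ler_wpM2r].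
  lra.
have {}main : nu * Num.sqrt k * F^-1 ^+ n.+1 * t ^ j * `|green a n j| <= 16.
  move: main; rewrite ler_pXn2r // ?nnegrE ?mulr_ge0 //; exact: ltW.
have FB : F ^+ n.+1 <= expR (8 + a * n%:R * eta).
  apply: (@le_trans _ _ (expR (a * eta + 3 * eta ^+ 3) ^+ n.+1)).
    by apply: lerXn2r => //; rewrite nnegrE ?expR_ge0 // ltW.
  rewrite -expRM_natr ler_expR.
  have en : eta ^+ 3 * n%:R <= 1.
    by rewrite /eta exprVn mulrC ler_pdivrMr ?exprn_gt0 // mul1r.
  rewrite -[n.+1%:R]natr1 (_ : (a * eta + 3 * eta ^+ 3) * (n%:R + 1) =
     a * n%:R * eta + a * eta + 3 * (eta ^+ 3 * n%:R) + 3 * eta ^+ 3); last ring.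
  have : eta ^+ 3 <= 1 by rewrite exprn_ile1 // ltW.
  have : a * eta <= 1 by rewrite mulr_ile1 // ltW.
  lra.
set D := nu * Num.sqrt k * F^-1 ^+ n.+1 * t ^ j in main.
have D0 : 0 < D by rewrite !mulr_gt0.
have -> : 16 / Num.sqrt k * expR 8 / nu * expR (- ((j%:~R - a * n%:R) / nu))
   = 16 / D * (expR (8 + a * n%:R * eta) / F ^+ n.+1).
  have -> : expR (8 + a * n%:R * eta) = expR 8 * t ^ j * expR (- ((j%:~R - a * n%:R) / nu)).
    by rewrite tj -!expRD; congr expR; rewrite /eta; ring.
  by rewrite /D exprVn; field; rewrite !gt_eqF // exprn_gt0.
apply: (@le_trans _ _ (16 / D)); first by rewrite ler_pdivlMr // mulrC.
rewrite ler_peMr ?divr_ge0 ?(ltW D0) //.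
by rewrite ler_pdivlMr ?exprn_gt0 // mul1r.
Qed.

(* With r^2 = (1 - a) / (1 + a), conjugating by r^j turns the scheme into b0 plus a
   skew-symmetric operator. *)
Lemma green_left a n j : 0 < a < 1 ->
  green a n j ^+ 2 * ((1 - a) / (1 + a)) ^ j <= (1 - a ^+ 2) ^+ n.
Proof.
move=> /andP[a0 a1].
have r0 : 0 < (1 - a) / (1 + a) by rewrite divr_gt0; lra.
set r2 := (1 - a) / (1 + a) in r0 *.
pose t := Num.sqrt r2; have t0 : 0 < t by rewrite sqrtr_gt0.
have t2 : t ^+ 2 = r2 by rewrite sqr_sqrtr // ltW.
pose c := t * b1 a.
have cm : t^-1 * bm a = - c.
  apply: (@mulfI _ t); first by rewrite gt_eqF.
  rewrite mulVKf ?gt_eqF // /c mulrN mulrA -expr2 t2 /r2 /bm /b1.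
  by field; rewrite gt_eqF //; lra.
have cc : b0 a ^+ 2 + 4 * c ^+ 2 = 1 - a ^+ 2.
  rewrite (_ : c ^+ 2 = r2 * b1 a ^+ 2); last by rewrite /c exprMn t2.
  by rewrite /b0 /b1 /r2; field; rewrite gt_eqF //; lra.
have q0 : 0 <= 1 - a ^+ 2 by rewrite -cc; positivity.
pose K i := kern c (b0 a) (- c) i.
have KE i : K i =1 (fun j => t ^ j * green a i j).
  move=> l; have := @kern_conj (b1 a) (b0 a) (bm a) 1 t i l.
  by rewrite !mul1r cm expr1n mul1r gt_eqF // => /(_ isT); rewrite /K /c.
have en i : (i <= n)%N -> energy n.+2 (K i) <= (1 - a ^+ 2) ^+ i.
  elim: i => [_|i IH ilt].
    rewrite /energy /zsum (bigD1 (inord n.+2)) //= inordK; last by lia.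
    rewrite subrr /delta0 eqxx expr1n big1 ?addr0 // => l ll.
    case: eqP => [e|]; last by rewrite expr0n.
    by case/eqP: ll; apply/val_inj; rewrite /= inordK; lia.
  have sK : supp i (K i) by exact: supp_kern.
  have iW : (i.+1 < n.+2)%N by lia.
  have -> : K i.+1 = tstep c (b0 a) (- c) (K i) by [].
  rewrite (energy_tstep _ _ _ sK iW).
  pose h j := 4 * (K i (j - 1) * K i j) - 4 * K i j ^+ 2.
  have sh : supp i.+1 h.
    by move=> l ln; rewrite /h !sK ?expr0n /= ?mulr0 ?subr0 //; lia.
  have z := zsum_tel0 sh iW.
  (* The skew part has norm at most [2 * c]: the defect is the energy of [u (l - 1) + u (l + 1)]. *)
  have pos : 0 <= 4 * energy n.+2 (K i) - 4 * energy n.+2 (dif (K i)) + energy n.+2 (lap (K i)).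
    have -> : 4 * energy n.+2 (K i) - 4 * energy n.+2 (dif (K i)) + energy n.+2 (lap (K i))
      = zsum n.+2 (fun l => (K i (l - 1) + K i (l + 1)) ^+ 2).
      rewrite -[RHS]addr0 -z /energy -mulNr -!zsumZ -!zsumD.
      by apply: eq_zsum => l; rewrite /dif /lap /h (addrK 1 l); ring.
    by apply: zsum_ge0 => l; exact: sqr_ge0.
  rewrite (exprS (1 - a ^+ 2)); apply: (@le_trans _ _ ((1 - a ^+ 2) * energy n.+2 (K i))).
    have := sqr_ge0 c; rewrite -cc; nra.
  by apply: ler_wpM2l => //; apply: IH; lia.
have [jn|nj] := leqP `|j| n; last by rewrite (supp_green a nj) expr0n /= mul0r exprn_ge0.
apply: le_trans (en n (leqnn n)).
apply: (@le_trans _ _ (K n j ^+ 2)).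
  by rewrite KE exprMn mulrC -t2 !expr2 expfzMl.
apply: (@zsum_term _ n.+2 (fun j => K n j ^+ 2)) => [i|]; [exact: sqr_ge0 | lia].
Qed.

End Tilt.

(** * Sonin's function and the bound n^(-1/3) *)

Section Sonin.
Context {R : realType}.
Implicit Types (a x N X Y : R).

(** [X] and [Y] are two consecutive values of the kernel. The difference of the sides is [P] times a
    square plus a nonnegative multiple of [(X - Y) ^+ 2]; the distance [a^-1] from the front is what
    makes [P] nonnegative. *)
Lemma sonin_form a x N X Y : 0 < a < 1 -> 1 <= x -> a^-1 <= a * N - x ->
  ((1 - a ^+ 2) * (x - 1) / a * X - (1 - a) * (N + x - 1) * Y) ^+ 2
     / ((a * N - x + 1) * (a * N + x - 1)) + (1 - a ^+ 2) / a ^+ 2 * X ^+ 2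
  <= ((1 + a) * (N - x) * X - (1 - a ^+ 2) * x / a * Y) ^+ 2
     / ((a * N - x) * (a * N + x)) + (1 - a ^+ 2) / a ^+ 2 * Y ^+ 2.
Proof.
move=> /andP[a0 a1] x1 sa.
have ai : 1 < a^-1 by rewrite invf_gt1.
have [s [e [sE eE]]] : exists s e, s = a * N - x /\ e = a * N + x by exists (a * N - x), (a * N + x).
have NE : N = (s + e) / (2 * a) by rewrite sE eE; field; rewrite gt_eqF.
have xE : x = (e - s) / 2 by rewrite sE eE; field.
rewrite -sE -eE.
have s0 : 0 < s by rewrite sE; lra.
have e1 : 0 < e - 1 by rewrite eE; lra.
have e0 : 0 < e by lra.
have s1 : 0 < s + 1 by lra.
pose P := 4 * s / (a * e) - 2 * (1 - a) ^+ 2 * N / (a * e * (e - 1)).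
pose T := ((1 - a ^+ 2) * x / a) ^+ 2 / (s * e)
        - ((1 - a ^+ 2) * (x - 1) / a) ^+ 2 / ((s + 1) * (e - 1)).
have N0 : 0 < N by rewrite NE divr_gt0 //; [lra | rewrite mulr_gt0].
have P0 : 0 <= P.
  have -> : P = (4 * s * (e - 1) - 2 * (1 - a) ^+ 2 * N) / (a * e * (e - 1)).
    by rewrite /P; field; rewrite !gt_eqF.
  apply: divr_ge0; last by positivity.
  have aN : a * N <= e - 1 by rewrite eE; lra.
  have sas : 1 <= a * s by rewrite mulrC -ler_pdivrMr // div1r sE.
  have : 4 * s * (a * N) <= 4 * s * (e - 1) by apply: ler_wpM2l => //; positivity.
  have : N * 1 <= N * (a * s) by apply: ler_wpM2l => //; exact: ltW.
  have : (1 - a) ^+ 2 * N <= 1 * N by apply: ler_wpM2r; [exact: ltW | nra].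
  lra.
have T0 : 0 <= T.
  rewrite subr_ge0; apply: ler_pM.
  - exact: sqr_ge0.
  - by rewrite invr_ge0; positivity.
  - have k0 : 0 <= (1 - a ^+ 2) / a by apply: divr_ge0; [nra | exact: ltW].
    have ee y : (1 - a ^+ 2) * y / a = (1 - a ^+ 2) / a * y by rewrite mulrAC.
    rewrite !ee; apply: lerXn2r; rewrite ?nnegrE; try (by apply: mulr_ge0 => //; lra).
    by apply: ler_wpM2l => //; lra.
  - by rewrite lef_pV2 ?posrE; [rewrite sE eE; nra | positivity..].
rewrite -subr_ge0.
set Z := (X in 0 <= X).
have -> : Z = P * (Y + (1 + a) / 2 * (X - Y)) ^+ 2
   + ((1 + a) * (1 - a) / a
      + (1 + a) ^+ 2 / 4 * (2 * (1 - a) ^+ 2 * N / (a * e * (e - 1))) + T) * (X - Y) ^+ 2.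
  rewrite /Z /P /T (_ : N + x - 1 = N + (x - 1)); last ring.
  rewrite NE xE.
  by field; rewrite !gt_eqF //; lra.
have h1 : 0 <= (1 + a) * (1 - a) / a.
  by apply: divr_ge0; [nra | exact: ltW].
have h2 : 0 <= (1 + a) ^+ 2 / 4 * (2 * (1 - a) ^+ 2 * N / (a * e * (e - 1))).
  apply: mulr_ge0; first by apply: divr_ge0; rewrite ?sqr_ge0.
  by apply: divr_ge0; [apply: mulr_ge0; [apply: mulr_ge0; rewrite ?sqr_ge0 | exact: ltW] | positivity].
have h3 := addr_ge0 (addr_ge0 h1 h2) T0.
by apply: addr_ge0; apply: mulr_ge0 => //; exact: sqr_ge0.
Qed.

(** Inserting one time step into [green_airy] leaves a recurrence in [j] at a fixed time. With
    [N = n + 1] it oscillates for [|j| < a N] and has its turning point at [j = a N]. *)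
Lemma green_rec a n j : a != 0 ->
  (1 + a) * (n.+1%:R - j%:~R) * green a n (j - 1)
  + (1 - a) * (n.+1%:R + j%:~R) * green a n (j + 1)
  = 2 * ((1 - a ^+ 2) * j%:~R / a) * green a n j.
Proof.
move=> a0; have := green_airy a n j; rewrite (_ : green a n.+1 j = lw a (green a n) j) //.
move/eqP; rewrite -subr_eq0 => /eqP h; apply/eqP; rewrite -subr_eq0.
rewrite -(mulr0 (- (2 / a))) -h /lw /tstep /lap /mu /b1 /b0 /bm.
by apply/eqP; field.
Qed.

(* Sonin's function of the three-term recurrence [green_rec] in [j]: the analogue for this
   discrete turning-point problem of [u'^2 / q + u^2] for [u'' + q u = 0]. *)
Definition sonin a n (j : int) : R :=
  ((1 + a) * (n.+1%:R - j%:~R) * green a n (j - 1) - (1 - a ^+ 2) * j%:~R / a * green a n j) ^+ 2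
     / ((a * n.+1%:R - j%:~R) * (a * n.+1%:R + j%:~R))
  + (1 - a ^+ 2) / a ^+ 2 * green a n j ^+ 2.

Lemma sonin_step a n (j : int) : 0 < a < 1 -> 1 <= j -> a^-1 <= a * n.+1%:R - j%:~R ->
  sonin a n (j - 1) <= sonin a n j.
Proof.
move=> a01 j1 sj; have /andP[a0 a1] := a01.
have x1 : 1 <= j%:~R :> R by rewrite ler1z.
apply: le_trans (sonin_form (green a n (j - 1)) (green a n j) a01 x1 sj).
rewrite /sonin.
have := green_rec n (j - 1) (lt0r_neq0 a0); rewrite subrK => /eqP.
move=> /eqP e.
have {}e : (1 + a) * (n.+1%:R - (j - 1)%:~R) * green a n (j - 1 - 1) =
  2 * ((1 - a ^+ 2) * (j - 1)%:~R / a) * green a n (j - 1)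
  - (1 - a) * (n.+1%:R + (j - 1)%:~R) * green a n j by rewrite -e addrK.
rewrite e intrB le_eqVlt; apply/orP; left; apply/eqP; congr (_ ^+ 2 / _ + _); ring.
Qed.

(** Landau-Kolmogorov interpolation: the mean of the differences over [h] points is at most
    [2 A / h], and each differs from the first by at most [h L]. *)
Lemma dif_interp (v : int -> R) p (h : nat) (A L : R) : (0 < h)%N ->
  (forall i : nat, (i <= h)%N -> `|v (p + i%:Z)| <= A) ->
  (forall i : nat, (0 < i < h)%N -> `|lap v (p + i%:Z)| <= L) -> 0 <= L ->
  `|dif v p| <= 2 * A / h%:R + h%:R * L.
Proof.
move=> h0 hA hL L0.
have hd (i : nat) : (i < h)%N -> `|dif v (p + i%:Z) - dif v p| <= i%:R * L.
  elim: i => [|i IH] ih; first by rewrite addr0 subrr normr0 mul0r.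
  have -> : dif v (p + i.+1%:Z) - dif v p = lap v (p + i.+1%:Z) + (dif v (p + i%:Z) - dif v p).
    rewrite /dif /lap (_ : p + i.+1%:Z - 1 = p + i%:Z); last lia.
    by rewrite (_ : p + i%:Z + 1 = p + i.+1%:Z); [ring | lia].
  apply: le_trans (ler_normD _ _) _; rewrite -natr1 mulrDl mul1r addrC.
  by apply: lerD; [apply: IH; lia | apply: hL; lia].
have hR : 0 < h%:R :> R by rewrite ltr0n.
have e : h%:R * dif v p = (v (p + h%:Z) - v p) - \sum_(i < h) (dif v (p + i%:Z) - dif v p).
  rewrite sumrB sumr_const card_ord -mulr_natl opprB addrC addrAC.
  rewrite (_ : \sum_(i < h) dif v (p + i%:Z) = v (p + h%:Z) - v p); first by ring.
  rewrite -(big_mkord xpredT (fun i => dif v (p + i%:Z))).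
  rewrite (eq_bigr (fun i : nat => v (p + i.+1%:Z) - v (p + i%:Z))); last first.
    by move=> i _; rewrite /dif; congr (v _ - _); lia.
  by rewrite (telescope_sumr (fun i : nat => v (p + i%:Z))) // addr0.
have {}e : h%:R * `|dif v p| <= 2 * A + h%:R * (h%:R * L).
  rewrite -[X in X * _](gtr0_norm hR) -normrM e.
  apply: le_trans (ler_normB _ _) _; apply: lerD.
    apply: le_trans (ler_normB _ _) _.
    have := hA h (leqnn h); have := hA 0%N isT; rewrite addr0; lra.
  apply: le_trans (ler_norm_sum _ _ _) _.
  rewrite mulr_natl -[X in _ *+ X]card_ord -sumr_const; apply: ler_sum => i _.
  apply: le_trans (hd i (ltn_ord i)) _; apply: ler_wpM2r => //.
  by rewrite ler_nat ltnW.
rewrite -(ler_pM2l hR); apply: le_trans e _.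
by rewrite mulrDr [_ * (_ / _)]mulrC divfK // gt_eqF.
Qed.

Lemma geom_poly (q : R) (k : nat) : 0 <= q < 1 -> exists2 C : R, 0 < C &
  forall n, n.+1%:R ^+ k * q ^+ n <= C.
Proof.
move=> /andP[q0 q1].
(* [q] may be 0, where the logarithm is of no use. *)
pose r := Num.max q (2^-1); have r1 : r < 1 by rewrite gt_max q1 /=; lra.
have r0 : 0 < r by rewrite lt_max; apply/orP; right; lra.
have qr : q <= r by rewrite le_max lexx.
pose c := - ln r; have c0 : 0 < c by rewrite oppr_gt0 ln_lt0 // r0.
have rE : r = expR (- c) by rewrite opprK lnK.
exists (k.+1`!%:R / c ^+ k.+1 * expR c).
  by rewrite mulr_gt0 ?expR_gt0 // divr_gt0 ?exprn_gt0 // ltr0n fact_gt0.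
move=> n.
have N1 : 1 <= n.+1%:R :> R by rewrite ler1n.
have x0 : 0 <= c * n.+1%:R by rewrite mulr_ge0 // ltW.
have h := expR_ge1Dxn k x0.
have {}h : c ^+ k.+1 * n.+1%:R ^+ k.+1 <= k.+1`!%:R * expR (c * n.+1%:R).
  rewrite -exprMn [leRHS]mulrC -ler_pdivrMr ?ltr0n ?fact_gt0 //.
  by apply: le_trans h; rewrite lerDr.
have cc : 0 < c ^+ k.+1 by exact: exprn_gt0.
rewrite mulrAC ler_pdivlMr //.
apply: (@le_trans _ _ (c ^+ k.+1 * n.+1%:R ^+ k.+1 * r ^+ n)).
  rewrite mulrC mulrA; apply: ler_pM.
  - by rewrite mulr_ge0 ?exprn_ge0 // ltW.
  - exact: exprn_ge0.
  - by rewrite ler_pM2l // ler_weXn2l.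
  - by rewrite lerXn2r // nnegrE // ltW.
apply: (@le_trans _ _ (k.+1`!%:R * expR (c * n.+1%:R) * r ^+ n)).
  by rewrite ler_wpM2r // exprn_ge0 // ltW.
rewrite -mulrA ler_wpM2l // rE -expRM_natr -expRD ler_expR -natr1; lra.
Qed.

Lemma green_le1 a n j : 0 < a < 1 -> `|green a n j| <= 1.
Proof.
move=> a01; rewrite -(@ler_pXn2r _ 2) ?nnegrE // real_normK ?num_real // expr1n.
by apply: kern_sq_le1 (b_sum a) _ _ _ _; rewrite ?b_beta // ltW // b1bm_lt0.
Qed.

Lemma green_left_decay a : 0 < a < 1 -> exists2 C : R, 0 < C &
  forall n j, j <= 0 -> `|green a n j| <= C / n.+1%:R.
Proof.
move=> a01; have /andP[a0 a1] := a01.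
have q : 0 <= 1 - a ^+ 2 < 1.
  by rewrite subr_ge0 exprn_ile1 ?ltW //= ltrBlDr ltrDl exprn_gt0.
have [C C0 HC] := geom_poly 2 q.
exists (C + 1); first lra.
move=> n j j0; rewrite ler_pdivlMr //.
have l0 : 0 <= `|green a n j| * n.+1%:R by rewrite mulr_ge0.
have C10 : 0 <= C + 1 by lra.
rewrite -(@ler_pXn2r _ 2) ?nnegrE //.
apply: (@le_trans _ _ C); last nra.
apply: le_trans (HC n); rewrite exprMn real_normK ?num_real // mulrC.
apply: ler_wpM2l; first exact: sqr_ge0.
apply: le_trans (green_left n j a01).
rewrite ler_peMr ?sqr_ge0 //.
have r0 : 0 < (1 - a) / (1 + a) by rewrite divr_gt0; lra.
have r1 : (1 - a) / (1 + a) <= 1 by rewrite ler_pdivrMr; lra.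
case: j j0 {l0} => [[|m]|m] //= _; rewrite ?expr0z //.
by rewrite NegzE -exprnN -exprVn exprn_ege1 // invf_ge1.
Qed.

(** Close to the front and ahead of it this is [green_right], and for [j <= 0] it is
    [green_left_decay]. In between, [sonin] decreases towards the left, so its value at a distance
    about [nu] behind the front controls the kernel: there the kernel is O(1/nu) and its differences
    O(1/nu^2), which makes [sonin] O(1/nu^2). *)
Lemma green_sup a : 0 < a < 1 -> exists2 C : R, 0 < C &
  forall n (nu : R) j, 0 < nu -> nu ^+ 3 = n.+1%:R -> `|green a n j| <= C / nu.
Proof.
move=> a01; have /andP[a0 a1] := a01.
have [C1 C10 HR] := green_right a01; have [CL CL0 HL] := green_left_decay a01.
have m0 := mu_gt0 a01.
pose k := (1 - a ^+ 2) / a ^+ 2.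
have k0 : 0 < k.
  by apply: divr_gt0; [rewrite subr_gt0 expr_lt1 // ltW | exact: exprn_gt0].
pose C2 := C1 * expR 3; have C20 : 0 < C2 by rewrite mulr_gt0 ?expR_gt0.
pose C3 := 2 * C2 + 6 * C2 / mu a.
have C30 : 0 < C3 by rewrite /C3; positivity.
pose C4 := 4 * C2 / a + 2 * C3; have C40 : 0 < C4 by rewrite /C4; positivity.
pose C5 := C4 ^+ 2 / a + k * C2 ^+ 2; have C50 : 0 < C5 by rewrite /C5; positivity.
(* For [nu > 4 / a] the front is well away from the origin, [a N >= 16 nu]; smaller [nu] are covered
   by [green_le1]. *)
pose K := 4 / a; have K4 : 4 < K by rewrite /K ltr_pdivlMr //; lra.
have q0 : 0 < C5 / k by rewrite divr_gt0.
exists (K + CL + C2 + (C5 / k + 1)); first lra.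
move=> n nu j nu0 nuN.
have weak c : c <= K + CL + C2 + (C5 / k + 1) -> `|green a n j| <= c / nu ->
   `|green a n j| <= (K + CL + C2 + (C5 / k + 1)) / nu.
  by move=> cle h; apply: le_trans h _; rewrite ler_pM2r ?invr_gt0.
have nu1 : 1 <= nu.
  have : 1 <= nu ^+ 3 by rewrite nuN ler1n.
  by rewrite expr_ge1 // ltW.
have [nuK|Knu] := leP nu K.
  apply: (weak K); first lra.
  by apply: le_trans (green_le1 n j a01) _; rewrite ler_pdivlMr // mul1r.
have [j0|j0] := leP j 0.
  apply: (weak CL); first lra.
  apply: le_trans (HL n j j0) _; rewrite ler_pM2l // lef_pV2 ?posrE ?ltr0n //.
  by rewrite -nuN -[leLHS]expr1 ler_weXn2l.
set N := n.+1%:R in nuN.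
have aN16 : 16 * nu <= a * N.
  have : 4 < a * nu by move: Knu; rewrite /K ltr_pdivrMr // mulrC.
  rewrite -nuN => h; have -> : a * nu ^+ 3 = (a * nu) * nu * nu by ring.
  have : 4 * nu <= a * nu * nu by rewrite ler_pM2r // ltW.
  nra.
have nv : n%:R = N - 1 by rewrite /N -[n.+1%:R]natr1 addrK.
have N64 : 64 <= N.
  have nu4 := ltW (lt_trans K4 Knu).
  rewrite -nuN (_ : 64 = 4 ^+ 3); last by ring.
  by apply: lerXn2r => //; rewrite nnegrE // ltW.
have right i : a * N - 3 * nu <= i%:~R ->
    `|green a n i| <= C2 / nu /\ `|green a n.+1 i| <= C2 / nu.
  have ex (y : R) : - (3 * nu) <= y -> C1 / nu * expR (- (y / nu)) <= C2 / nu.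
    move=> h; rewrite /C2 mulrAC ler_pM2r ?invr_gt0 // ler_pM2l // ler_expR.
    by rewrite lerNl ler_pdivlMr // mulNr.
  move=> hi; split.
    apply: le_trans (HR n nu i nu0 _) (ex _ _); rewrite nv ?nuN; clear -hi a0 a1 nu0 N64 aN16; lra.
  apply: le_trans (HR n.+1 nu i nu0 _) (ex _ _); rewrite ?nuN -/N; clear -hi a0 a1 nu0 N64 aN16; lra.
have [p [pl pu]] : exists p : int, p%:~R <= a * N - nu /\ a * N - nu < p%:~R + 1.
  by exists (Num.floor (a * N - nu)); have := floor_itv (a * N - nu); rewrite intrD => /andP[].
have [jp|pj] := ltP p j.
  apply: (weak C2); first lra.
  have : p%:~R + 1 <= j%:~R :> R by rewrite -[1]/(1%:~R) -intrD ler_int; clear -jp; lia.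
  by move=> h; apply: (right j _).1; lra.
have base : sonin a n p <= C5 / nu ^+ 2.
  pose h := (Num.truncn nu).+1.
  have [hl hu] : nu < h%:R /\ h%:R <= 2 * nu.
    have /andP[] := truncn_itv (ltW nu0); rewrite -/h => h1 h2; split=> //.
    by rewrite /h -natr1; clear -h1 nu1; lra.
  (* Near the front [green_airy] bounds the second difference by O(1/nu^3), and interpolating over
     about [nu] points gives the first one. *)
  have dv : `|dif (green a n) (p - 1)| <= C3 / nu ^+ 2.
    have bnd (i : nat) : (i <= h)%N -> a * N - 3 * nu <= (p - 1 + i%:Z)%:~R
         /\ (p - 1 + i%:Z)%:~R <= a * N + 3 * nu.
      move=> ih; have i0 : 0 <= i%:R :> R by [].
      have : i%:R <= h%:R :> R by rewrite ler_nat.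
      by rewrite !intrD /= intrN; clear -i0 pl pu hu nu1; lra.
    apply: le_trans (@dif_interp (green a n) (p - 1) h (C2 / nu) (3 * C2 / (mu a * N)) isT _ _ _) _.
    - by move=> i ih; apply: (right _ _).1; apply: (bnd i ih).1.
    - move=> i /andP[_ ih]; have [b1 b2] := bnd i (ltnW ih).
      set l := p - 1 + i%:Z in b1 b2 *.
      have NM : 0 < N * mu a by rewrite mulr_gt0 // ltr0n.
      rewrite [mu a * N]mulrC ler_pdivlMr // -[N * mu a in leLHS](gtr0_norm NM) -normrM.
      rewrite mulrC -green_airy normrM.
      rewrite (_ : 3 * C2 = (3 * nu) * (C2 / nu)); last by field; rewrite gt_eqF.
      apply: ler_pM => //; last exact: (right _ b1).2.
      by rewrite ler_norml -/N; clear -b1 b2; apply/andP; split; lra.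
    - by apply: divr_ge0; [rewrite mulr_ge0 // ltW | rewrite mulr_ge0 ?ler0n // ltW].
    have -> : C3 / nu ^+ 2 = 2 * (C2 / nu) / nu + 2 * nu * (3 * C2 / (mu a * N)).
      by rewrite /C3 -nuN; field; rewrite !gt_eqF.
    apply: lerD.
      apply: ler_wpM2l; first by positivity.
      by rewrite lef_pV2 ?posrE ?ltr0n // ltW.
    apply: ler_wpM2r => //.
    by apply: divr_ge0; [rewrite mulr_ge0 // ltW | rewrite mulr_ge0 ?ler0n // ltW].
  have hY : `|green a n p| <= C2 / nu by apply: (right p _).1; clear -pu nu1; lra.
  have p1 : 0 <= p%:~R :> R by clear -pu aN16 nu1; lra.
  rewrite /sonin -/N -/k.
  set Y := green a n p in hY *; set dl := dif _ _ in dv.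
  have XE : green a n (p - 1) = Y - dl by rewrite /dl /dif subrK subKr.
  have -> : C5 / nu ^+ 2 = (nu * C4) ^+ 2 / (nu * (a * N)) + k * (C2 / nu) ^+ 2.
    by rewrite /C5 -nuN; field; rewrite !gt_eqF.
  have Y2 : Y ^+ 2 <= (C2 / nu) ^+ 2.
    by rewrite -[Y ^+ 2]real_normK ?num_real // lerXn2r ?nnegrE ?divr_ge0 // ltW.
  apply: lerD; last by rewrite ler_pM2l.
  have u1 : nu <= a * N - p%:~R by clear -pl; lra.
  have u2 : a * N <= a * N + p%:~R by clear -p1; lra.
  have u3 : 0 < a * N by clear -aN16 nu0; lra.
  have u4 := lt_le_trans nu0 u1; have u5 := lt_le_trans u3 u2.
  apply: ler_pM; rewrite ?sqr_ge0 //.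
  - by rewrite invr_ge0 mulr_ge0 // ltW.
  - rewrite -[(_ - _) ^+ 2]real_normK ?num_real // lerXn2r ?nnegrE // ?mulr_ge0 ?(ltW C40) ?(ltW nu0) //.
    (* The coefficients of the two values nearly cancel: in terms of [Y] and [dl], [Y] carries the
       factor [a N - p], which is of order [nu] only. *)
    have -> : (1 + a) * (N - p%:~R) * green a n (p - 1) - (1 - a ^+ 2) * p%:~R / a * Y
       = (1 + a) * (a * N - p%:~R) / a * Y - (1 + a) * (N - p%:~R) * dl.
      by rewrite XE; field; rewrite gt_eqF.
    apply: le_trans (ler_normB _ _) _; rewrite !normrM.
    have -> : nu * C4 = (2 * (2 * nu ^+ 2)) / a * (C2 / nu) + 2 * nu ^+ 3 * (C3 / nu ^+ 2).
      by rewrite /C4; field; rewrite !gt_eqF.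
    have aN1 : a * N <= 1 * N by rewrite ler_pM2r ?ltr0n // ltW.
    have n1a : `|1 + a| <= 2 by clear -a0 a1; rewrite ger0_norm; lra.
    have ns : `|a * N - p%:~R| <= 2 * nu ^+ 2 by rewrite (gtr0_norm u4); clear -pu nu1; nra.
    have nN : `|N - p%:~R| <= nu ^+ 3 by rewrite nuN; clear -pl nu0 aN1 p1; rewrite ger0_norm; lra.
    have na : `|a^-1| <= a^-1 by rewrite ger0_norm // invr_ge0 ltW.
    by apply: lerD; do !apply: ler_pM => //; rewrite ?mulr_ge0.
  - by rewrite lef_pV2 ?posrE; [apply: ler_pM => //; exact: ltW | exact: mulr_gt0 | exact: mulr_gt0].
have desc (i : nat) : (i%:Z < p) -> sonin a n (p - i%:Z) <= sonin a n p.
  elim: i => [|i IH] ip; first by rewrite subr0.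
  have ip' : i%:Z < p by clear -ip; lia.
  apply: le_trans (IH ip').
  rewrite (_ : p - i.+1%:Z = p - i%:Z - 1); last by clear; lia.
  apply: sonin_step => //; first by clear -ip'; lia.
  rewrite -/N intrB.
  have : a^-1 <= nu by apply: le_trans (ltW Knu); rewrite /K; clear -a0; rewrite ler_peMl ?invr_ge0 //; lra.
  have : 0 <= (i%:Z)%:~R :> R by rewrite ler0z.
  lra.
apply: (weak (C5 / k + 1)); first lra.
have pjE : (`|p - j|%N : int) = p - j by clear -pj; lia.
have pjp : p - j < p by clear -j0; lia.
have := desc `|p - j|%N; rewrite pjE subKr => /(_ pjp) h; have {}h := le_trans h base.
have hk : k * green a n j ^+ 2 <= C5 / nu ^+ 2.
  apply: le_trans h; rewrite /sonin -/k lerDr; apply: divr_ge0; first exact: sqr_ge0.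
  have : j%:~R <= p%:~R :> R by rewrite ler_int.
  have : 0 <= j%:~R :> R by rewrite ler0z ltW.
  by rewrite -/N => u1 u2; clear -u1 u2 pl nu0; apply: mulr_ge0; lra.
rewrite ler_pdivlMr //.
have l0 : 0 <= `|green a n j| * nu by rewrite mulr_ge0 // ltW.
have r0 : 0 <= C5 / k + 1 by clear -q0; lra.
rewrite -(@ler_pXn2r _ 2) ?nnegrE // exprMn real_normK ?num_real //.
apply: (@le_trans _ _ (C5 / k)); last by clear -q0; nra.
rewrite ler_pdivlMr // mulrC mulrA -ler_pdivlMr ?exprn_gt0 //.
Qed.

End Sonin.

Section Abel.
Context {R : realFieldType}.

Lemma abel_monotone (E V : nat -> R) (A : R) m :
  (forall i, `|V i| <= A) -> 0 <= E 0%N -> (forall i, (i < m)%N -> E i <= E i.+1) ->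
  `|\sum_(i < m) E i * (V i.+1 - V i)| <= 2 * A * E m.
Proof.
move=> VA E0 Ei.
have A0 : 0 <= A by apply: le_trans (VA 0%N).
suff h k : (k <= m)%N -> `|\sum_(i < k) E i * (V i.+1 - V i) - E k * V k| <= A * E k /\ 0 <= E k.
  have [h1 h2] := h m (leqnn m).
  have h3 : `|E m * V m| <= A * E m.
    by rewrite normrM (ger0_norm h2) mulrC ler_wpM2r.
  rewrite -[X in `|X|](subrK (E m * V m)); apply: le_trans (ler_normD _ _) _; lra.
elim: k => [_|k IH km].
  by rewrite big_ord0 sub0r normrN normrM (ger0_norm E0) mulrC ler_wpM2r.
have [h1 h2] := IH (ltnW km); have ek := Ei k km.
split; last exact: le_trans ek.
have -> : \sum_(i < k.+1) E i * (V i.+1 - V i) - E k.+1 * V k.+1 =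
  (\sum_(i < k) E i * (V i.+1 - V i) - E k * V k) - (E k.+1 - E k) * (V k.+1).
  rewrite big_ord_recr /=; ring.
apply: le_trans (ler_normB _ _) _.
have : `|(E k.+1 - E k) * V k.+1| <= (E k.+1 - E k) * A.
  by rewrite normrM ger0_norm ?subr_ge0 // ler_wpM2l // subr_ge0.
lra.
Qed.

(** Two summations by parts. The increments of [f] are nonnegative and increasing, so their
    variation is controlled by the last one and the sup norm of [V] suffices beyond the boundary
    terms. *)
Lemma abel_twice (f V : nat -> R) (A B : R) m :
  (forall i, `|V i| <= A) ->
  `|f 0%N * (V 1%N - V 0%N)| <= B -> `|f m * (V m.+1 - V m)| <= B ->
  0 <= f 1%N - f 0%N ->
  (forall i, (i < m)%N -> f i.+1 - f i <= f i.+2 - f i.+1) ->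
  `|\sum_(i < m) f i * (V i.+2 - 2 * V i.+1 + V i)| <=
  2 * B + 2 * A * (f m.+1 - f m).
Proof.
move=> VA h0 hm E0 Ei.
have -> : \sum_(i < m) f i * (V i.+2 - 2 * V i.+1 + V i) =
  f m * (V m.+1 - V m) - f 0%N * (V 1%N - V 0%N)
  - \sum_(i < m) (f i.+1 - f i) * (V i.+2 - V i.+1).
  elim: m {hm Ei} => [|m IH]; first by rewrite !big_ord0 subr0 subrr.
  rewrite !big_ord_recr /= IH; ring.
have h : `|\sum_(i < m) (f i.+1 - f i) * (V i.+2 - V i.+1)| <= 2 * A * (f m.+1 - f m).
  by apply: (@abel_monotone (fun i => f i.+1 - f i) (fun i => V i.+1)).
apply: le_trans (ler_normB _ _) _; apply: lerD => //.
apply: le_trans (ler_normB _ _) _; lra.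
Qed.

End Abel.

(** * Tail sums of the kernel *)

Section Tail.
Context {R : realType}.
Implicit Types (a : R) (n W : nat) (j p : int).

(** The value at [p] of the free evolution of the step equal to 1 on [j <= 0]. *)
Definition tailsum a n p : R := zsum n (fun j => if p <= j then green a n j else 0).

Lemma ler_norm_zsum W (f : int -> R) : `|zsum W f| <= zsum W (fun j => `|f j|).
Proof. exact: ler_norm_sum. Qed.

Lemma root_exists (k : nat) (x : R) : (0 < k)%N -> 0 < x ->
  exists2 y : R, 0 < y & y ^+ k = x.
Proof.
move=> k0 x0; have kn : k%:R != 0 :> R by rewrite pnatr_eq0 -lt0n.
exists (x `^ k%:R^-1); first by rewrite powR_gt0.
by rewrite -powR_mulrn ?powR_ge0 // -powRrM mulVf // powRr1 // ltW.
Qed.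

Lemma zsum_point W p (f : int -> R) : (`|p| <= W)%N ->
  zsum W (fun j => if j == p then f j else 0) = f p.
Proof.
move=> pW; have plt : (absz (p + W%:Z)%R < W.*2.+1)%N by lia.
have pE : (absz (p + W%:Z)%R)%:Z - W%:Z = p by lia.
rewrite /zsum (bigD1 (Ordinal plt)) //= pE eqxx big1 ?addr0 // => i ii.
case: eqP => // e; case/eqP: ii; apply: val_inj => /=; lia.
Qed.

Lemma tailsumE a n p W : (n <= W)%N ->
  tailsum a n p = zsum W (fun j => if p <= j then green a n j else 0).
Proof.
move=> nW; symmetry; apply: (@zsum_widen _ n W n) => // j jn.
by case: ifP => // _; exact: (@supp_green R a n j jn).
Qed.

Lemma tailsum_dif a n p : tailsum a n p - tailsum a n (p + 1) = green a n p.
Proof.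
pose W := (n + `|p|)%N.
have nW : (n <= W)%N by rewrite /W; lia.
rewrite !(tailsumE a _ nW) -[RHS](@zsum_point W p); last by rewrite /W; lia.
apply/eqP; rewrite subr_eq -zsumD; apply/eqP; apply: eq_zsum => j.
have [->|jp] := eqVneq j p; first by rewrite lexx ifF ?addr0 //; apply/negbTE; lia.
by rewrite add0r; congr (if _ then _ else _); lia.
Qed.

Lemma tailsum_sum a n p (m : nat) :
  tailsum a n p = \sum_(i < m) green a n (p + i%:Z) + tailsum a n (p + m%:Z).
Proof.
elim: m => [|m IH]; first by rewrite big_ord0 add0r addr0.
rewrite IH big_ord_recr /= -(tailsum_dif a n (p + m%:Z)).
by rewrite (_ : p + m.+1%:Z = p + m%:Z + 1); [ring | lia].
Qed.

Lemma tailsum_flux a n p :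
  tailsum a n.+1 p = tailsum a n p + b1 a * green a n (p - 1) - bm a * green a n p.
Proof.
set g := green a n; pose W := n.+2.
pose Q j := - b1 a * g (j - 1) + bm a * g j.
have Q0 j : (n.+1 < `|j|)%N -> Q j = 0.
  by move=> jn; rewrite /Q /g !(@supp_green R a n) ?mulr0 ?addr0 //; lia.
(* Freezing the flux [Q] to the left of [p] turns a sum over [j >= p] into a telescoping sum over
   the whole window. *)
pose h j := if j < p then Q p else Q j.
have e : zsum W (fun j => h (j + 1) - h j) = - Q p.
  rewrite zsum_tel; have hr : h (W%:Z + 1) = if W%:Z + 1 < p then Q p else 0.
    by rewrite /h; case: ifP => // _; rewrite Q0 // /W; lia.
  have hl : h (- W%:Z) = if - W%:Z < p then Q p else 0.
    by rewrite /h; case: ifP => // _; rewrite Q0 // /W; lia.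
  rewrite hr hl; case: ifP => c1; case: ifP => c2; rewrite ?sub0r ?subr0 //.
  - have ph : (n.+1 < `|p|)%N by move: c1; rewrite /W; clear; lia.
    by rewrite subrr Q0 ?oppr0.
  - by exfalso; move/negP: c2; apply; lia.
  - have ph : (n.+1 < `|p|)%N by move: c2; rewrite /W; clear; lia.
    by rewrite Q0 ?oppr0.
rewrite (@tailsumE a n.+1 p W) // (@tailsumE a n p W); last by rewrite /W; lia.
rewrite -/g (_ : _ - _ = zsum W (fun j => if p <= j then g j else 0) - Q p); last first.
  by rewrite /Q; ring.
rewrite -e -zsumD; apply: eq_zsum => j; rewrite /h.
have -> : green a n.+1 j = lw a g j by [].
have [pj|jp] := leP p j.
  rewrite ifF; last by apply/negbTE; lia.
  rewrite /Q /lw /tstep (_ : b0 a = 1 - b1 a - bm a); last first.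
    by rewrite -(b_sum a); ring.
  by rewrite (addrK 1 j); ring.
case: ifP => jp1; first by rewrite subrr addr0.
by rewrite (_ : j + 1 = p) ?subrr ?addr0 //; lia.
Qed.

Lemma zsum_green a n W : (n <= W)%N -> zsum W (green a n) = 1.
Proof.
move=> nW; rewrite (zsum_widen (@supp_green R a n) (leqnn n) nW) {nW W}.
have e : tailsum a n (- n%:Z - 1) = zsum n (green a n).
  rewrite /tailsum /zsum; apply: eq_bigr => i _; rewrite ifT //; lia.
rewrite -e; have -> : - n%:Z - 1 = - (n.+1)%:Z by lia.
have hz m : (n <= m)%N -> tailsum a n (- (m.+1)%:Z) = 1.
  elim: n m {e} => [|n IH] m nm.
    by rewrite /tailsum /zsum big_ord_recl big_ord0 addr0.
  rewrite tailsum_flux IH; last lia.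
  by rewrite !(@supp_green R a n) ?mulr0 ?subr0 ?addr0 //; lia.
exact: hz.
Qed.

Lemma expR_le_cauchy (u : R) : - 3 <= u -> expR (- u) <= 10 * expR 3 / (1 + u ^+ 2).
Proof.
move=> u3; have q : 0 < 1 + u ^+ 2 by have := sqr_ge0 u; lra.
rewrite ler_pdivlMr //; have e3 := expR_ge1Dx (3 : R).
have [u0|u0] := leP 0 u.
  have h := expR_ge_quad u0; rewrite expRN mulrC ler_pdivrMr ?expR_gt0 //.
  apply: (@le_trans _ _ (10 * expR u)); first nra.
  by rewrite ler_pM2r ?expR_gt0 //; lra.
have h1 : expR (- u) <= expR 3 by rewrite ler_expR; lra.
rewrite mulrC; apply: ler_pM => //; [lra|nra].
Qed.

(** Ahead of the front the exponential of [green_right] is summable. Behind it absolute values would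
    lose the oscillations: [green_airy] writes the kernel as [N mu] times a second difference over
    [s = a N - j], and as 1/s is increasing and convex in [j] along this range, [abel_twice]
    applies. *)
Lemma tailsum_bounded a : 0 < a < 1 -> exists2 C : R, 0 < C &
  forall n p, `|tailsum a n p| <= C.
Proof.
move=> a01; have /andP[a0 a1] := a01.
have [C1 C10 HR] := green_right a01; have [C2 C20 HS] := green_sup a01.
have m0 := mu_gt0 a01.
pose D := 160 * C1 * expR 3; have D0 : 0 < D by rewrite /D; have := expR_gt0 (3 : R) => ?; positivity.
pose B := 2 * C2 + 6 * C2 / mu a; have B0 : 0 < B by rewrite /B; positivity.
pose E := mu a * (2 * B + 2 * C2); have E0 : 0 < E by rewrite /E; positivity.
exists (1 + D + E); first lra.
case=> [|n] p.
  rewrite /tailsum /zsum big_ord_recl big_ord0 addr0 /=.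
  by case: ifP => _; rewrite ?normr0 ?normr1; lra.
set N := n.+1%:R : R.
have [nu nu0 nuN] : exists2 nu : R, 0 < nu & nu ^+ 3 = N.
  by apply: root_exists => //; rewrite ltr0n.
have nu1 : 1 <= nu.
  have : 1 <= nu ^+ 3 by rewrite nuN ler1n.
  by rewrite expr_ge1 // ltW.
have right q : a * N - 3 * nu <= q%:~R -> `|tailsum a n.+1 q| <= D.
  move=> qN; apply: (@le_trans _ _ (zsum n.+1 (fun j =>
     (10 * C1 * expR 3 / nu) * (nu ^+ 2 / (nu ^+ 2 + (j%:~R - a * N) ^+ 2))))).
    apply: le_trans (ler_norm_zsum _ _) _; apply: le_zsum => j.
    case: ifP => [qj|_]; last first.
      rewrite normr0; have := expR_gt0 (3 : R) => e3.
      have : 0 < nu ^+ 2 + (j%:~R - a * N) ^+ 2.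
        by apply: ltr_pwDl; [exact: exprn_gt0 | exact: sqr_ge0].
      by move=> d0; positivity.
    apply: le_trans (HR n.+1 nu j nu0 _) _; first by rewrite nuN lexx; have : 0 <= N; [rewrite ler0n|lra].
    rewrite -/N; set u := (j%:~R - a * N) / nu.
    have uE : j%:~R - a * N = u * nu by rewrite /u divfK // gt_eqF.
    have u3 : - 3 <= u.
      rewrite ler_pdivlMr //; have : q%:~R <= j%:~R :> R by rewrite ler_int.
      lra.
    rewrite uE; have q1 : 0 < 1 + u ^+ 2 by have := sqr_ge0 u; lra.
    have -> : 10 * C1 * expR 3 / nu * (nu ^+ 2 / (nu ^+ 2 + (u * nu) ^+ 2)) =
       C1 / nu * (10 * expR 3 / (1 + u ^+ 2)).
      rewrite (_ : nu ^+ 2 + (u * nu) ^+ 2 = nu ^+ 2 * (1 + u ^+ 2)); last ring.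
      by field; rewrite !gt_eqF.
    by rewrite ler_pM2l ?divr_gt0 // expR_le_cauchy.
  rewrite zsumZ; apply: (@le_trans _ _ (10 * C1 * expR 3 / nu * (16 * nu))).
    apply: ler_wpM2l; last exact: zsum_cauchy.
    by have := expR_gt0 (3 : R) => e3; positivity.
  rewrite /D (_ : _ * (16 * nu) = 160 * C1 * expR 3) //.
  by field; rewrite gt_eqF.
have [pN|Np] := leP (a * N - 3 * nu) p%:~R; first by have := right p pN; lra.
have [p0 [pl pu]] : exists p0 : int, p0%:~R <= a * N - 2 * nu /\ a * N - 2 * nu < p0%:~R + 1.
  by exists (Num.floor (a * N - 2 * nu)); have := floor_itv (a * N - 2 * nu); rewrite intrD => /andP[].
have pp0 : p < p0 by rewrite -(ltr_int R); lra.
have [m mE] : exists m : nat, p0 = p + m%:Z by exists `|p0 - p|%N; clear -pp0; lia.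
rewrite (tailsum_sum a n.+1 p m) -mE.
apply: le_trans (ler_normD _ _) _.
have rp0 : `|tailsum a n.+1 p0| <= D by apply: right; lra.
suff mid : `|\sum_(i < m) green a n.+1 (p + i%:Z)| <= E by lra.
pose v := green a n.
have vb j : `|v j| <= C2 / nu by apply: HS.
have gb j : `|green a n.+1 j| <= C2 / nu.
  have [nu' nu'0 nu'N] := @root_exists 3 n.+2%:R isT (ltr0Sn _ _).
  apply: le_trans (HS n.+1 nu' j nu'0 nu'N) _; rewrite ler_pM2l // lef_pV2 ?posrE //.
  by rewrite -(@ler_pXn2r _ 3) ?nnegrE ?(ltW nu0) ?(ltW nu'0) // nuN nu'N ler_nat.
have N0 : 0 < N by rewrite ltr0n.
pose s (i : nat) : R := a * N - p%:~R - i%:R.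
have sm i : (i <= m)%N -> 2 * nu <= s i.
  move=> im; rewrite /s; have : (p + m%:Z)%:~R <= a * N - 2 * nu by rewrite -mE.
  have : i%:R <= m%:R :> R by rewrite ler_nat.
  rewrite intrD /=; clear; lra.
have sm1 i : (i <= m.+1)%N -> nu <= s i.
  case: i => [|i] im; first by have := sm 0%N isT; clear -nu0; lra.
  have := sm i im; rewrite /s -[i.+1%:R]natr1; clear -nu1; lra.
have sS i : s i.+1 = s i - 1 by rewrite /s -[i.+1%:R]natr1; ring.
pose V i := v (p - 1 + i%:Z).
have df i : (i <= m)%N -> `|(s i)^-1 * (V i.+1 - V i)| <= B / N.
  move=> im; have s0 : 0 < s i by have := sm i im; clear -nu0; lra.
  have VE : V i.+1 - V i = dif v (p - 1 + i%:Z) by rewrite /V /dif; congr (v _ - _); clear; lia.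
  pose h := (Num.truncn nu).+1.
  have [hl hu] : nu < h%:R /\ h%:R <= 2 * nu.
    have /andP[] := truncn_itv (ltW nu0); rewrite -/h => h1 h2; split=> //.
    by rewrite /h -natr1; clear -h1 nu1; lra.
  have L0 : 0 <= 2 * s i * (C2 / nu) / (N * mu a) by positivity.
  have hd := @dif_interp R v (p - 1 + i%:Z) h (C2 / nu) (2 * s i * (C2 / nu) / (N * mu a)) isT (fun k _ => vb _) _ L0.
  rewrite VE normrM normfV (gtr0_norm s0) mulrC ler_pdivrMr //.
  apply: le_trans (hd _) _.
    move=> k /andP[k0 kh].
    have NM : 0 < N * mu a by rewrite mulr_gt0.
    rewrite ler_pdivlMr // -[X in _ * X <= _](gtr0_norm NM) -normrM mulrC -green_airy normrM.
    apply: ler_pM => //.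
    have : k%:R <= h%:R :> R by rewrite ler_nat ltnW.
    have : 1 <= k%:R :> R by rewrite ler1n.
    have := sm i im; rewrite -/N !intrD /= intrN /s => h1 h2 h3.
    by clear -h1 h2 h3 hu; rewrite ler_norml; apply/andP; split; lra.
  apply: (@le_trans _ _ (2 * (C2 / nu) / nu + 2 * nu * (2 * s i * (C2 / nu) / (N * mu a)))).
    apply: lerD.
      apply: ler_wpM2l; first by positivity.
      by rewrite lef_pV2 ?posrE ?ltr0n // ltW.
    by apply: ler_wpM2r.
  have -> : 2 * (C2 / nu) / nu = 2 * C2 * nu / N.
    by rewrite -nuN; field; rewrite gt_eqF.
  have -> : 2 * nu * (2 * s i * (C2 / nu) / (N * mu a)) = 4 * C2 / mu a * s i / N.
    by field; rewrite !gt_eqF.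
  rewrite -mulrDl [leRHS]mulrAC ler_pM2r ?invr_gt0 // /B.
  have : 2 * C2 * nu <= 2 * C2 * s i.
    by rewrite ler_pM2l ?mulr_gt0 //; have := sm i im; clear -nu0; lra.
  have : 0 <= C2 / mu a * s i by positivity.
  clear; lra.
have -> : \sum_(i < m) green a n.+1 (p + i%:Z) =
   - (N * mu a) * \sum_(i < m) (s i)^-1 * (V i.+2 - 2 * V i.+1 + V i).
  rewrite mulr_sumr; apply: eq_bigr => i _.
  have s0 : 0 < s i by have := sm i (ltnW (ltn_ord i)); clear -nu0; lra.
  have := green_airy a n (p + i%:Z); rewrite -/N.
  have -> : lap (green a n) (p + i%:Z) = V i.+2 - 2 * V i.+1 + V i.
    rewrite /lap /V /v (_ : p - 1 + i.+2%:Z = p + i%:Z + 1); last by clear; lia.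
    rewrite (_ : p - 1 + i.+1%:Z = p + i%:Z); last by clear; lia.
    by rewrite (_ : p - 1 + i%:Z = p + i%:Z - 1); [ring | clear; lia].
  have -> : (p + i%:Z)%:~R - a * N = - s i by rewrite intrD /s /=; ring.
  move=> e; apply: (@mulfI _ (- s i)); first by rewrite oppr_eq0 gt_eqF.
  by rewrite e; field; rewrite gt_eqF.
rewrite normrM normrN (gtr0_norm (mulr_gt0 N0 m0)).
have sp i : (i <= m.+1)%N -> 0 < s i by move=> im; have := sm1 i im; clear -nu0; lra.
have fd i : (i <= m)%N -> (s i.+1)^-1 - (s i)^-1 = (s i * s i.+1)^-1.
  move=> im; have u1 := sp i (leqW im); have u2 := sp i.+1 im.
  have e : s i = s i.+1 + 1 by rewrite sS subrK.
  by rewrite e in u1 *; field; rewrite !gt_eqF.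
apply: (@le_trans _ _ (N * mu a * (2 * (B / N) + 2 * (C2 / nu) * ((s m.+1)^-1 - (s m)^-1)))).
  apply: ler_wpM2l; first by apply: ltW; rewrite mulr_gt0.
  apply: (@abel_twice R (fun i => (s i)^-1) V) => //.
  - by move=> i; exact: vb.
  - exact: df.
  - exact: df.
  - by rewrite fd // invr_ge0 mulr_ge0 // ltW // sp.
  - move=> i im; rewrite !fd ?(ltnW im) //.
    have u1 := sp i (leqW (ltnW im)); have u2 := sp i.+1 (leqW im).
    have u3 := sp i.+2 im.
    rewrite lef_pV2 ?posrE ?mulr_gt0 // mulrC ler_pM2r //.
    by rewrite !sS; clear; lra.
rewrite fd //.
have : (s m * s m.+1)^-1 <= (nu ^+ 2)^-1.
  rewrite lef_pV2 ?posrE ?exprn_gt0 ?mulr_gt0 ?sp // expr2.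
  by apply: ler_pM; rewrite ?(ltW nu0) ?sm1.
move=> hs; apply: (@le_trans _ _ (N * mu a * (2 * (B / N) + 2 * (C2 / nu) * (nu ^+ 2)^-1))).
  apply: ler_wpM2l; first by apply: ltW; rewrite mulr_gt0.
  by rewrite lerD2l ler_wpM2l //; positivity.
rewrite /E le_eqVlt; apply/orP; left; apply/eqP; rewrite -nuN.
by field; rewrite gt_eqF.
Qed.

Lemma ratio_expz_ge (r q : R) (K : nat) j n : 0 < q -> q <= 1 -> 0 < r <= 1 -> q ^+ K <= r ->
  (K%:Z * (2 * j) <= n%:Z) -> q ^+ n <= (r ^ j) ^+ 2.
Proof.
move=> q0 q1 /andP[r0 r1] qr Kj.
case: j Kj => [m|m] Kj.
  rewrite -exprnP; apply: (@le_trans _ _ ((q ^+ K) ^+ (m * 2))).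
    by rewrite -exprM; apply: ler_wiXn2l; [exact: ltW | exact: q1 | lia].
  have qK0 : 0 <= q ^+ K by rewrite exprn_ge0 // ltW.
  rewrite exprM; apply: lerXn2r; first by rewrite nnegrE exprn_ge0.
    by rewrite nnegrE exprn_ge0 // ltW.
  by apply: lerXn2r => //; rewrite nnegrE // ltW.
rewrite NegzE -exprnN -exprVn -exprM.
apply: (@le_trans _ _ 1); first by rewrite exprn_ile1 // ltW.
by rewrite exprn_ege1 // invf_ge1.
Qed.

(** Write [q = 1 - a ^+ 2], [r = (1 - a) / (1 + a)] and choose [q ^+ K <= r]. The bound
    [g^2 r^j <= q^n] of [green_left] leaves [g^4 <= q^n] as long as [2 K j <= n]; of this geometric
    decay only polynomial decay of every order is kept. *)
Lemma green_far a : 0 < a < 1 -> exists2 K : nat, (0 < K)%N &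
  forall k, exists2 C : R, 0 < C &
  forall n j, K%:Z * j <= n%:Z -> `|green a n j| <= C / n.+1%:R ^+ k.
Proof.
move=> a01; have /andP[a0 a1] := a01.
have q0 : 0 < 1 - a ^+ 2 by rewrite subr_gt0 expr_lt1 // ltW.
have q1 : 1 - a ^+ 2 < 1 by rewrite ltrBlDr ltrDl exprn_gt0.
have r0 : 0 < (1 - a) / (1 + a) by rewrite divr_gt0; lra.
have r1 : (1 - a) / (1 + a) <= 1 by rewrite ler_pdivrMr; lra.
set q := 1 - a ^+ 2 in q0 q1 *; set r := (1 - a) / (1 + a) in r0 r1 *.
have [C C0 HC] : exists2 C : R, 0 < C & forall n, n.+1%:R ^+ 1 * q ^+ n <= C.
  by apply: geom_poly; rewrite ltW.
pose K := (Num.truncn (C / r)).+1.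
have qK : q ^+ K <= r.
  have h := HC K; rewrite expr1 in h.
  have CK : C / r < K%:R by have /andP[] := truncn_itv (divr_ge0 (ltW C0) (ltW r0)).
  have KK : C < r * K%:R by rewrite mulrC -ltr_pdivrMr.
  have Kp : 0 < K.+1%:R :> R by rewrite ltr0n.
  rewrite -(ler_pM2l Kp); apply: le_trans h _; rewrite -[K.+1%:R]natr1.
  by rewrite mulrDl mul1r [_ * r]mulrC; lra.
exists (K * 2)%N => // k.
have [D D0 HD] : exists2 D : R, 0 < D & forall n, n.+1%:R ^+ (4 * k) * q ^+ n <= D.
  by apply: geom_poly; rewrite (ltW q0).
exists (D + 1); first lra.
move=> n j Kj; have Np : 0 < n.+1%:R ^+ k :> R by rewrite exprn_gt0 // ltr0n.
rewrite ler_pdivlMr //.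
have l0 : 0 <= `|green a n j| * n.+1%:R ^+ k by rewrite mulr_ge0 // ltW.
have D10 : 0 <= D + 1 by lra.
rewrite -(@ler_pXn2r _ 4) ?nnegrE //.
apply: (@le_trans _ _ D); last first.
  by apply: (@le_trans _ _ (D + 1)); [lra | rewrite ler_eXnr //; lra].
apply: le_trans (HD n); rewrite exprMn -exprM mulnC mulrC ler_pM2l ?exprn_gt0 ?ltr0n //.
have qn : 0 < q ^+ n by rewrite exprn_gt0.
rewrite -(ler_pM2r qn).
have Kj' : K%:Z * (2 * j) <= n%:Z by clear -Kj; lia.
have rj : q ^+ n <= (r ^ j) ^+ 2.
  by apply: (ratio_expz_ge q0 (ltW q1) _ qK Kj'); rewrite r0.
have h := green_left n j a01; rewrite -/q -/r in h.
have g0 : 0 <= green a n j ^+ 2 * r ^ j.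
  by rewrite mulr_ge0 ?sqr_ge0 // exprz_ge0 // ltW.
apply: (@le_trans _ _ ((green a n j ^+ 2 * r ^ j) ^+ 2)).
  rewrite exprMn (exprM _ 2 2) real_normK ?num_real //.
  by apply: ler_wpM2l => //; exact: sqr_ge0.
by rewrite -expr2; apply: lerXn2r; rewrite ?nnegrE // ltW.
Qed.

Lemma tailsum_far a : 0 < a < 1 -> exists2 K : nat, (0 < K)%N &
  forall k, exists2 C : R, 0 < C &
  forall n p, K%:Z * p <= n%:Z -> `|1 - tailsum a n p| <= C / n.+1%:R ^+ k.
Proof.
move=> a01; have [K K0 HK] := green_far a01; exists K => // k.
have [C C0 HC] := HK k.+1; exists (2 * C); first lra.
move=> n p Kp.
have Np : 0 < n.+1%:R ^+ k.+1 :> R by rewrite exprn_gt0 // ltr0n.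
have -> : 1 - tailsum a n p =
    zsum n (fun j => green a n j - if p <= j then green a n j else 0).
  by rewrite -[in LHS](zsum_green a (leqnn n)) /tailsum -sumrB.
apply: (@le_trans _ _ (zsum n (fun=> C / n.+1%:R ^+ k.+1))).
  apply: le_trans (ler_norm_zsum _ _) _; apply: le_zsum => j.
  case: ifP => pj; last first.
    by rewrite subr0; apply: HC; clear -pj Kp K0; nia.
  by rewrite subrr normr0 divr_ge0 // ltW.
rewrite /zsum sumr_const card_ord -[leLHS]mulr_natl exprS.
rewrite (_ : 2 * C / n.+1%:R ^+ k = (2 * n.+1%:R) * (C / (n.+1%:R * n.+1%:R ^+ k))).
  apply: ler_wpM2r; first by apply: divr_ge0; [exact: ltW | rewrite mulr_ge0 // exprn_ge0].
  by rewrite -natrM ler_nat; lia.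
have : n.+1%:R != 0 :> R by rewrite pnatr_eq0.
by move: (n.+1%:R) => z z0; field; rewrite ?expf_neq0 ?z0.
Qed.

End Tail.

(** * Formal power series *)

(** Wrapping the coefficients in a record keeps the convolution product apart from the pointwise
    operations on functions. *)
Record fps (K : Type) := Fps { fcoef : nat -> K }.

HB.instance Definition _ K := gen_eqMixin (fps K).
HB.instance Definition _ K := gen_choiceMixin (fps K).

Section FpsRing.
Context {K : comNzRingType}.
Implicit Types (f g h : fps K) (n N : nat) (c : K).

Lemma fpsP f g : (forall n, fcoef f n = fcoef g n) -> f = g.
Proof. by case: f; case: g => f g /= e; congr Fps; apply/funext. Qed.

Definition fadd f g := Fps (fun n => fcoef f n + fcoef g n).
Definition fopp f := Fps (fun n => - fcoef f n).
Definition fconst c := Fps (fun n => if n == 0%N then c else 0).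
Definition fmul f g := Fps (fun n => \sum_(i < n.+1) fcoef f i * fcoef g (n - i)).
Definition ftrunc N f := \poly_(i < N) fcoef f i.

Lemma coef_ftrunc N f n : (n < N)%N -> (ftrunc N f)`_n = fcoef f n.
Proof. by move=> nN; rewrite coef_poly nN. Qed.

(** A coefficient only sees truncations, so the ring laws are inherited from polynomials. *)
Lemma fmul_trunc N f g n : (n < N)%N ->
  fcoef (fmul f g) n = (ftrunc N f * ftrunc N g)`_n.
Proof.
move=> nN; rewrite coefM; apply: eq_bigr => i _.
by rewrite !coef_ftrunc //; have := ltn_ord i; lia.
Qed.

Fact faddA : associative fadd.
Proof. by move=> f g h; apply: fpsP => n /=; rewrite addrA. Qed.
Fact faddC : commutative fadd.
Proof. by move=> f g; apply: fpsP => n /=; rewrite addrC. Qed.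
Fact fadd0 : left_id (fconst 0) fadd.
Proof. by move=> f; apply: fpsP => n /=; rewrite if_same add0r. Qed.
Fact faddN : left_inverse (fconst 0) fopp fadd.
Proof. by move=> f; apply: fpsP => n /=; rewrite if_same addNr. Qed.

HB.instance Definition _ := GRing.isZmodule.Build (fps K) faddA faddC fadd0 faddN.

Fact fmulC : commutative fmul.
Proof.
move=> f g; apply: fpsP => n.
by rewrite !(@fmul_trunc n.+1) // mulrC.
Qed.

Fact fmulA : associative fmul.
Proof.
move=> f g h; apply: fpsP => n.
have e p q : forall i, (i < n.+1)%N ->
    (ftrunc n.+1 (fmul p q))`_i = (ftrunc n.+1 p * ftrunc n.+1 q)`_i.
  by move=> i iN; rewrite coef_ftrunc // (@fmul_trunc n.+1).
rewrite !(@fmul_trunc n.+1) //.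
have -> : (ftrunc n.+1 f * ftrunc n.+1 (fmul g h))`_n =
          (ftrunc n.+1 f * (ftrunc n.+1 g * ftrunc n.+1 h))`_n.
  by rewrite ![LHS]coefM [RHS]coefM; apply: eq_bigr => i _; rewrite e // ltnS leq_subr.
rewrite mulrA ![RHS]coefM coefM; apply: eq_bigr => i _; rewrite e //.
Qed.

Fact fmul1 : left_id (fconst 1) fmul.
Proof.
move=> f; apply: fpsP => n /=; rewrite big_ord_recl /= mul1r subn0.
by rewrite big1 ?addr0 // => i _; rewrite mul0r.
Qed.

Fact fmulDl : left_distributive fmul fadd.
Proof.
move=> f g h; apply: fpsP => n /=; rewrite -big_split /=.
by apply: eq_bigr => i _; rewrite mulrDl.
Qed.

Fact f1_neq0 : fconst 1 != fconst 0.
Proof. by apply/eqP => -[] /(congr1 (fun u => u 0%N)) /eqP; rewrite oner_eq0. Qed.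

HB.instance Definition _ :=
  GRing.Zmodule_isComNzRing.Build (fps K) fmulA fmulC fmul1 fmulDl f1_neq0.

Definition fX : fps K := Fps (fun n => (n == 1%N)%:R).

Lemma fcoefD f g n : fcoef (f + g) n = fcoef f n + fcoef g n. Proof. by []. Qed.
Lemma fcoefN f n : fcoef (- f) n = - fcoef f n. Proof. by []. Qed.
Lemma fcoefB f g n : fcoef (f - g) n = fcoef f n - fcoef g n. Proof. by []. Qed.
Lemma fcoefM f g n : fcoef (f * g) n = \sum_(i < n.+1) fcoef f i * fcoef g (n - i).
Proof. by []. Qed.
Lemma fcoef0 n : fcoef (0 : fps K) n = 0. Proof. by rewrite /= if_same. Qed.
Lemma fcoef1 n : fcoef (1 : fps K) n = (n == 0%N)%:R. Proof. by case: n. Qed.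

Lemma fcoefM0 f g : fcoef (f * g) 0 = fcoef f 0 * fcoef g 0.
Proof. by rewrite fcoefM big_ord_recl big_ord0 addr0. Qed.

Lemma fcoef_sum (I : Type) (r : seq I) (P : pred I) (F : I -> fps K) n :
  fcoef (\sum_(i <- r | P i) F i) n = \sum_(i <- r | P i) fcoef (F i) n.
Proof. by elim/big_rec2: _ => [|i x y _ <-]; rewrite ?fcoef0. Qed.

Lemma fcoefXM f n : fcoef (fX * f) n = if n is m.+1 then fcoef f m else 0.
Proof.
case: n => [|n]; first by rewrite fcoefM0 /= mul0r.
rewrite fcoefM big_ord_recl /= mul0r add0r big_ord_recl /= mul1r subSS subn0.
by rewrite big1 ?addr0 // => i _; rewrite /= mul0r.
Qed.

Lemma fcoefCM c f n : fcoef (fconst c * f) n = c * fcoef f n.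
Proof.
rewrite fcoefM big_ord_recl /= subn0 big1 ?addr0 // => i _.
by rewrite /= mul0r.
Qed.

Fact fconst_additive : additive fconst.
Proof. by move=> x y; apply: fpsP => -[|n] /=; rewrite ?subr0. Qed.
Fact fconst_multiplicative : multiplicative fconst.
Proof.
split=> // x y; apply: fpsP => n; rewrite fcoefCM /=.
by case: ifP => // _; rewrite mulr0.
Qed.
HB.instance Definition _ := GRing.isAdditive.Build K (fps K) fconst fconst_additive.
HB.instance Definition _ :=
  GRing.isMultiplicative.Build K (fps K) fconst fconst_multiplicative.

Lemma fX_inj f g : fX * f = fX * g -> f = g.
Proof.
move=> e; apply: fpsP => n.
by have := congr1 (fun u => fcoef u n.+1) e; rewrite !fcoefXM.
Qed.

(** Fixed point of a contraction for the X-adic distance: each application of [T] makes one more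
    coefficient correct. *)
Lemma fps_fixpoint (T : fps K -> fps K) :
  (forall f g N, (forall n, (n < N)%N -> fcoef f n = fcoef g n) ->
     forall n, (n <= N)%N -> fcoef (T f) n = fcoef (T g) n) ->
  exists f, T f = f.
Proof.
move=> TP; pose it N := iter N T 0.
have st N n : (n < N)%N -> fcoef (it N) n = fcoef (it N.+1) n.
  elim: N n => // N IH n; rewrite ltnS => nN.
  by rewrite [in LHS]/it [in RHS]/it !iterS; apply: TP (N) _ _ nN => k kN; apply: IH.
have st' N M n : (n < N)%N -> (N <= M)%N -> fcoef (it N) n = fcoef (it M) n.
  move=> nN; elim: M => [|M IH]; first by rewrite leqn0 => /eqP <-.
  rewrite leq_eqVlt => /orP[/eqP <- //|NM].
  by rewrite (IH NM); apply: st; lia.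
exists (Fps (fun n => fcoef (it n.+1) n)); apply: fpsP => n /=.
apply: (TP _ _ n) (leqnn n) => k kn /=.
exact: (st' k.+1 n k).
Qed.

Lemma eq_fcoefM f f' g g' N :
  (forall n, (n < N)%N -> fcoef f n = fcoef f' n) ->
  (forall n, (n < N)%N -> fcoef g n = fcoef g' n) ->
  forall n, (n < N)%N -> fcoef (f * g) n = fcoef (f' * g') n.
Proof.
move=> ef eg n nN; rewrite !fcoefM; apply: eq_bigr => i _.
by have := ltn_ord i => ilt; rewrite ef ?eg //; lia.
Qed.

Lemma fps_inv1 g : exists f, (1 - fX * g) * f = 1.
Proof.
have [f fE] : exists f, 1 + fX * (g * f) = f.
  apply: fps_fixpoint => u v N uv [|n] nN; rewrite !fcoefD !fcoefXM //.
  by congr (_ + _); apply: (eq_fcoefM _ uv) => //; lia.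
by exists f; rewrite mulrBl mul1r -{1}fE mulrA addrK.
Qed.

End FpsRing.

Section FpsField.
Context {K : fieldType}.
Implicit Types (f g : fps K).

Lemma fps_decomp f : exists g, f = fconst (fcoef f 0) + fX * g.
Proof.
exists (Fps (fun n => fcoef f n.+1)); apply: fpsP => -[|n].
  by rewrite fcoefD fcoefXM /= addr0.
by rewrite fcoefD fcoefXM /= add0r.
Qed.

Lemma fps_mul_neq0 f g : f != 0 -> g != 0 -> f * g != 0.
Proof.
have low (u : fps K) : u != 0 -> exists (m : nat) (v : fps K), fcoef v 0 != 0 /\ u = fX ^+ m * v.
  move=> u0; have [n un] : exists n, fcoef u n != 0.
    apply: contrapT => hn; case/eqP: u0; apply: fpsP => n; rewrite fcoef0.
    by apply/eqP/negPn/negP => h; apply: hn; exists n.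
  elim: n u {u0} un => [|n IH] u un; first by exists 0%N, u; rewrite expr0 mul1r.
  have [u00|u00] := eqVneq (fcoef u 0) 0; last by exists 0%N, u; rewrite expr0 mul1r.
  have [v vE] := fps_decomp u; rewrite u00 rmorph0 add0r in vE.
  have [|m [w [w0 wE]]] := IH v; first by move: un; rewrite vE fcoefXM.
  by exists m.+1, w; split=> //; rewrite exprS -mulrA -wE.
move=> /low[m [f' [f0 ->]]] /low[k [g' [g0 ->]]].
apply/eqP => e.
have {}e : f' * g' = 0.
  have cancel i (u : fps K) : fX ^+ i * u = 0 -> u = 0.
    elim: i => [|i IH]; first by rewrite expr0 mul1r.
    by rewrite exprS -mulrA => h; apply: IH; apply: fX_inj; rewrite h mulr0.
  by apply: (cancel (m + k)%N); rewrite exprD -[RHS]e; ring.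
have := congr1 (fun u => fcoef u 0) e; rewrite fcoefM0 fcoef0 => /eqP.
by rewrite mulf_eq0 (negbTE f0) (negbTE g0).
Qed.

End FpsField.

(** * Weighted Wiener algebras *)

Local Open Scope complex_scope.

Section AbsSeries.
Context {R : realType}.
Implicit Types (x : nat -> R) (K : R).
Local Open Scope classical_set_scope.

Definition abs_le x K := forall N, \sum_(i < N) `|x i| <= K.

Definition rsum x : R := limn (series x).

Lemma series_ord x N : series x N = \sum_(i < N) x i.
Proof. by rewrite /series /= big_mkord. Qed.

Lemma abs_series_cvg x K : abs_le x K -> cvgn (series x).
Proof.
move=> h; apply: normed_cvg; apply: nondecreasing_is_cvgn.
  by apply: nondecreasing_series => n _ _; exact: normr_ge0.
by exists K => _ [N _ <-]; rewrite /normed_series_of /= series_ord.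
Qed.

Lemma rsum_le x K : abs_le x K -> `|rsum x| <= K.
Proof.
move=> h; have c := abs_series_cvg h.
have b N : `|series x N| <= K.
  by rewrite series_ord; apply: le_trans (h N); exact: ler_norm_sum.
rewrite ler_norml; apply/andP; split.
  by apply: limr_ge => //; apply: nearW => N; have := b N; rewrite ler_norml => /andP[].
by apply: limr_le => //; apply: nearW => N; have := b N; rewrite ler_norml => /andP[].
Qed.

Lemma rsum_recl x K : abs_le x K ->
  rsum x = x 0%N + rsum (fun i => x i.+1).
Proof.
move=> h; have c := abs_series_cvg h.
have h' : abs_le (fun i => x i.+1) K.
  by move=> N; apply: le_trans (h N.+1); rewrite big_ord_recl lerDr.
have c' := abs_series_cvg h'.
apply/cvg_lim => //; rewrite -cvg_shiftS.
have -> : (fun n => series x n.+1) = (fun n => x 0%N + series (fun i => x i.+1) n).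
  by apply/funext => n; rewrite !series_ord big_ord_recl.
by apply: cvgD => //; exact: cvg_cst.
Qed.

Lemma rsumZ c x K : abs_le x K ->
  rsum (fun i => c * x i) = c * rsum x.
Proof.
move=> h; have cv := abs_series_cvg h.
apply/cvg_lim => //.
have -> : series (fun i => c * x i) = (fun n => c * series x n).
  by apply/funext => n; rewrite !series_ord mulr_sumr.
exact: cvgMr.
Qed.

Lemma rsumD x (y : nat -> R) K L : abs_le x K ->
  abs_le y L ->
  rsum (fun i => x i + y i) = rsum x + rsum y.
Proof.
move=> hx hy; have cx := abs_series_cvg hx; have cy := abs_series_cvg hy.
apply/cvg_lim => //.
have -> : series (fun i => x i + y i) = (fun n => series x n + series y n).
  by apply/funext => n; rewrite !series_ord big_split.
exact: cvgD.
Qed.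

End AbsSeries.

Section Modulus.
Context {R : realType}.
Implicit Types z : R[i].

Definition cn z : R := Normc.normc z.

Lemma cnE z : `|z| = (cn z)%:C. Proof. by []. Qed.
Lemma cn_ge0 z : 0 <= cn z. Proof. by rewrite -ler0c -cnE normr_ge0. Qed.
Lemma cnM z1 z2 : cn (z1 * z2) = cn z1 * cn z2. Proof. exact: Normc.normcM. Qed.
Lemma cnD z1 z2 : cn (z1 + z2) <= cn z1 + cn z2.
Proof. by rewrite -lecR rmorphD -!cnE ler_normD. Qed.
Lemma cnN z : cn (- z) = cn z.
Proof. by apply: complexI; rewrite -!cnE normrN. Qed.
Lemma cnB z1 z2 : cn (z1 - z2) <= cn z1 + cn z2.
Proof. by rewrite -[cn z2]cnN cnD. Qed.
Lemma cn0 : cn 0 = 0. Proof. by apply: complexI; rewrite -cnE normr0. Qed.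
Lemma cn1 : cn 1 = 1. Proof. by apply: complexI; rewrite -cnE normr1. Qed.
Lemma cnX z n : cn (z ^+ n) = cn z ^+ n.
Proof. by apply: complexI; rewrite -cnE normrX rmorphXn. Qed.
Lemma cnV z : cn z^-1 = (cn z)^-1.
Proof. by apply: complexI; rewrite -cnE normfV fmorphV. Qed.
Lemma cn_real (x : R) : cn x%:C = `|x|.
Proof. by rewrite /cn /= expr0n addr0 sqrtr_sqr. Qed.
Lemma cn_eq0 z : (cn z == 0) = (z == 0).
Proof. by rewrite -[RHS]normr_eq0 cnE eq_complex /= eqxx andbT. Qed.
Lemma cn_gt0 z : (0 < cn z) = (z != 0).
Proof. by rewrite lt_def cn_ge0 andbT cn_eq0. Qed.
Lemma cn_sum (I : Type) (r : seq I) (P : pred I) (F : I -> R[i]) :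
  cn (\sum_(i <- r | P i) F i) <= \sum_(i <- r | P i) cn (F i).
Proof.
elim/big_rec2: _ => [|i x y _ h]; first by rewrite cn0.
by apply: le_trans (cnD _ _) _; rewrite lerD2l.
Qed.
Lemma Re_le_cn z : `|complex.Re z| <= cn z.
Proof.
case: z => x y; rewrite /cn /= -sqrtr_sqr ler_sqrt; last by rewrite addr_ge0 ?sqr_ge0.
by rewrite lerDl sqr_ge0.
Qed.
Lemma Im_le_cn z : `|complex.Im z| <= cn z.
Proof.
case: z => x y; rewrite /cn /= -sqrtr_sqr ler_sqrt; last by rewrite addr_ge0 ?sqr_ge0.
by rewrite lerDr sqr_ge0.
Qed.
Lemma cn_le_ReIm z : cn z <= `|complex.Re z| + `|complex.Im z|.
Proof.
rewrite [z in leLHS]complexE; apply: le_trans (cnD _ _) _.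
rewrite cnM !cn_real (_ : cn 'i = 1) ?mul1r //.
by rewrite /cn /= expr0n add0r expr1n sqrtr1.
Qed.
End Modulus.

#[global] Arguments cn {R} z : simpl never.

Section Wiener.
Context {R : realType}.
Local Notation C := R[i].
Implicit Types (f g : fps C) (w K L : R) (n N : nat) (z c : C).

(** The weighted l^1 algebra of series absolutely convergent on [|z| <= w], its norm handled as a
    bound on partial sums. For [w > 1] membership forces geometric decay of the coefficients. *)
Definition wn w K f := forall N, \sum_(i < N) cn (fcoef f i) * w ^+ i <= K.
Definition inW w f := exists K, wn w K f.

Lemma wn_ge0 w K f : wn w K f -> 0 <= K.
Proof. by move=> /(_ 0%N); rewrite big_ord0. Qed.

Lemma wn_coef w K f n : 0 <= w -> wn w K f -> cn (fcoef f n) * w ^+ n <= K.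
Proof.
move=> w0 /(_ n.+1); apply: le_trans; rewrite big_ord_recr /= lerDr.
by apply: sumr_ge0 => i _; rewrite mulr_ge0 ?cn_ge0 ?exprn_ge0.
Qed.

Lemma wn_le w w' K f : 0 <= w' <= w -> wn w K f -> wn w' K f.
Proof.
move=> /andP[w0 ww] h N; apply: le_trans (h N); apply: ler_sum => i _.
by rewrite ler_wpM2l ?cn_ge0 // lerXn2r // nnegrE // (le_trans w0).
Qed.

Lemma inW_le w w' f : 0 <= w' <= w -> inW w f -> inW w' f.
Proof. by move=> ww [K h]; exists K; exact: wn_le h. Qed.

Lemma wnD w K L f g : 0 <= w -> wn w K f -> wn w L g -> wn w (K + L) (f + g).
Proof.
move=> w0 hf hg N; apply: le_trans (lerD (hf N) (hg N)).
rewrite -big_split; apply: ler_sum => i _ /=.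
by rewrite -mulrDl ler_wpM2r ?exprn_ge0 // cnD.
Qed.

Lemma wnN w K f : wn w K f -> wn w K (- f).
Proof. by move=> h N; under eq_bigr do rewrite fcoefN cnN. Qed.

Lemma triangular_sum (a b : nat -> R) N :
  \sum_(n < N) \sum_(i < n.+1) a i * b (n - i)%N =
  \sum_(i < N) a i * \sum_(j < (N - i)%N) b j.
Proof.
elim: N => [|N IH]; first by rewrite !big_ord0.
rewrite big_ord_recr IH [RHS]big_ord_recr /= subSnn big_ord1.
rewrite [X in _ + X]big_ord_recr /= subnn addrA -big_split /=; congr (_ + _).
apply: eq_bigr => i _; have iN := ltn_ord i.
by rewrite subSn ?(ltnW iN) // big_ord_recr /= mulrDr.
Qed.

Lemma wnM w K L f g : 0 <= w -> wn w K f -> wn w L g -> wn w (K * L) (f * g).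
Proof.
move=> w0 hf hg N.
pose a i := cn (fcoef f i) * w ^+ i; pose b i := cn (fcoef g i) * w ^+ i.
have a0 i : 0 <= a i by rewrite mulr_ge0 ?cn_ge0 ?exprn_ge0.
apply: (@le_trans _ _ (\sum_(n < N) \sum_(i < n.+1) a i * b (n - i)%N)).
  apply: ler_sum => n _; rewrite fcoefM.
  apply: (@le_trans _ _ ((\sum_(i < n.+1) cn (fcoef f i * fcoef g (n - i))) * w ^+ n)).
    by rewrite ler_wpM2r ?exprn_ge0 // cn_sum.
  rewrite mulr_suml; apply: ler_sum => i _.
  have -> : w ^+ n = w ^+ i * w ^+ (n - i) by rewrite -exprD subnKC // -ltnS ltn_ord.
  by rewrite cnM /a /b le_eqVlt; apply/orP; left; apply/eqP; ring.
rewrite triangular_sum; apply: (@le_trans _ _ (\sum_(i < N) a i * L)).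
  by apply: ler_sum => i _; apply: ler_wpM2l.
by rewrite -mulr_suml ler_wpM2r // (wn_ge0 hg).
Qed.

Lemma wn_const w c : wn w (cn c) (fconst c).
Proof.
case=> [|N]; first by rewrite big_ord0 cn_ge0.
rewrite big_ord_recl /= mulr1 big1 ?addr0 // => i _.
by rewrite /= cn0 mul0r.
Qed.

Lemma wn_X w : 0 <= w -> wn w w fX.
Proof.
move=> w0 [|[|N]]; rewrite ?big_ord0 // !big_ord_recl /= ?big_ord0 ?addr0; first by rewrite cn0 mul0r.
by rewrite cn0 mul0r add0r cn1 mul1r big1 ?addr0 // => i _; rewrite mul0r.
Qed.

Section Closure.
Variables (w : R) (w0 : 0 <= w).
Lemma inW_D f g : inW w f -> inW w g -> inW w (f + g).
Proof. by move=> [K hf] [L hg]; exists (K + L); exact: wnD. Qed.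
Lemma inW_N f : inW w f -> inW w (- f).
Proof. by move=> [K hf]; exists K; exact: wnN. Qed.
Lemma inW_B f g : inW w f -> inW w g -> inW w (f - g).
Proof. by move=> hf hg; apply: inW_D => //; exact: inW_N. Qed.
Lemma inW_M f g : inW w f -> inW w g -> inW w (f * g).
Proof. by move=> [K hf] [L hg]; exists (K * L); exact: wnM. Qed.
Lemma inW_const c : inW w (fconst c).
Proof. by exists (cn c); exact: wn_const. Qed.
Lemma inW_1 : inW w 1. Proof. by have := inW_const 1; rewrite rmorph1. Qed.
Lemma inW_fX : inW w fX. Proof. by exists w; exact: wn_X. Qed.
Lemma inW_exp f n : inW w f -> inW w (f ^+ n).
Proof.
move=> hf; elim: n => [|n IH]; first by rewrite expr0; exact: inW_1.
by rewrite exprS; exact: inW_M.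
Qed.
End Closure.

(** Real and imaginary parts are summed separately, whence the factor 2 in [fval_le]. *)
Definition fval f z : C :=
  rsum (fun k => complex.Re (fcoef f k * z ^+ k)) +i* rsum (fun k => complex.Im (fcoef f k * z ^+ k)).
Definition fshift f : fps C := Fps (fun n => fcoef f n.+1).

Definition bsum (q : R) K f := forall N, \sum_(k < N) cn (fcoef f k) * q ^+ k <= K.

Lemma bsum_ReIm z K f : bsum (cn z) K f ->
  abs_le (fun k => complex.Re (fcoef f k * z ^+ k)) K /\
  abs_le (fun k => complex.Im (fcoef f k * z ^+ k)) K.
Proof.
by move=> h; split=> N; apply: le_trans (h N); apply: ler_sum => k _;
  rewrite -cnX -cnM ?Re_le_cn ?Im_le_cn.
Qed.

Lemma fval_le z K f : bsum (cn z) K f -> cn (fval f z) <= 2 * K.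
Proof.
move=> /bsum_ReIm[h1 h2]; apply: le_trans (cn_le_ReIm _) _ => /=.
have := rsum_le h1; have := rsum_le h2; lra.
Qed.

Lemma fval_recl z K f : bsum (cn z) K f ->
  fval f z = fcoef f 0 + z * fval (fshift f) z.
Proof.
move=> h; have [h1 h2] := bsum_ReIm h.
have hs : exists K', bsum (cn z) K' (fshift f).
  have [->|z0] := eqVneq z 0.
    exists (cn (fcoef f 1)) => -[|N]; first by rewrite big_ord0 cn_ge0.
    rewrite big_ord_recl /= mulr1 big1 ?addr0 // => i _.
    by rewrite cn0 exprS mul0r mulr0.
  exists (K / cn z) => N; have := h N.+1; rewrite big_ord_recl /= mulr1 => hN.
  rewrite ler_pdivlMr ?cn_gt0 // mulr_suml.
  apply: le_trans (_ : \sum_(i < N) cn (fcoef f (bump 0 i)) * cn z ^+ (bump 0 i) <= _); last first.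
    by have := cn_ge0 (fcoef f 0); lra.
  by apply: ler_sum => i _; rewrite -mulrA -exprSr.
have [K' hs'] := hs; have [s1 s2] := bsum_ReIm hs'.
pose x k := complex.Re (fcoef f k.+1 * z ^+ k); pose y k := complex.Im (fcoef f k.+1 * z ^+ k).
have zx (c : R) : abs_le (fun k => c * x k) (`|c| * K').
  by move=> N; under eq_bigr do rewrite normrM; rewrite -mulr_sumr ler_wpM2l //; exact: s1.
have zy (c : R) : abs_le (fun k => c * y k) (`|c| * K').
  by move=> N; under eq_bigr do rewrite normrM; rewrite -mulr_sumr ler_wpM2l //; exact: s2.
have re : rsum (fun k => complex.Re (fcoef f k.+1 * z ^+ k.+1)) =
   complex.Re z * rsum x - complex.Im z * rsum y.
  rewrite -mulNr -(@rsumZ _ (complex.Re z) x K' s1) -(@rsumZ _ (- complex.Im z) y K' s2).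
  rewrite -(rsumD (zx (complex.Re z)) (zy (- complex.Im z))); congr rsum; apply/funext => k.
  rewrite /x /y exprSr mulrA; case: (_ * _ ^+ _) => u v; case: (z) => p q /=; ring.
have im : rsum (fun k => complex.Im (fcoef f k.+1 * z ^+ k.+1)) =
   complex.Im z * rsum x + complex.Re z * rsum y.
  rewrite -(@rsumZ _ (complex.Im z) x K' s1) -(@rsumZ _ (complex.Re z) y K' s2).
  rewrite -(rsumD (zx (complex.Im z)) (zy (complex.Re z))); congr rsum; apply/funext => k.
  rewrite /x /y exprSr mulrA; case: (_ * _ ^+ _) => u v; case: (z) => p q /=; ring.
rewrite /fval (rsum_recl h1).
rewrite (rsum_recl h2) re im !expr0 !mulr1.
rewrite -/x -/y.
by case: (fcoef f 0) => u v; case: (z) => p q; apply/eqP; rewrite eq_complex /=; apply/andP; split; apply/eqP; ring.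
Qed.

Lemma bsum_wn w K f z : wn w K f -> cn z <= w -> bsum (cn z) K f.
Proof. by move=> h zw; apply: wn_le h; rewrite cn_ge0. Qed.

Lemma fshift_iter f n k : fcoef (iter n fshift f) k = fcoef f (n + k).
Proof. by elim: n k => [//|n IH] k; rewrite iterS /= IH addnS. Qed.

(** The quotient of [f - f(z)] by [X - z]: Horner's rule gives as coefficients the values at [z] of
    the shifted series. *)
Definition fquot f z : fps C := Fps (fun n => fval (iter n.+1 fshift f) z).

Lemma wn_iter_shift w K f n : 0 < w -> wn w K f -> wn w (K / w ^+ n) (iter n fshift f).
Proof.
move=> w0 h N; rewrite ler_pdivlMr ?exprn_gt0 // mulr_suml.
apply: le_trans (h (n + N)%N); rewrite big_split_ord /=.
rewrite -[leLHS]add0r; apply: lerD.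
  by apply: sumr_ge0 => i _; rewrite mulr_ge0 ?cn_ge0 ?exprn_ge0 // ltW.
apply: ler_sum => i _; rewrite fshift_iter -mulrA -exprD addnC.
by rewrite [(i + n)%N]addnC.
Qed.

Lemma fquotP w K f z : 0 < w -> wn w K f -> cn z <= w ->
  f = fconst (fval f z) + (fX - fconst z) * fquot f z.
Proof.
move=> w0 h zw.
have rec n : fval (iter n fshift f) z = fcoef f n + z * fval (iter n.+1 fshift f) z.
  rewrite (@fval_recl z (K / w ^+ n) (iter n fshift f)) ?fshift_iter ?addn0 //.
  exact: bsum_wn (wn_iter_shift n w0 h) zw.
apply: fpsP => -[|n]; rewrite fcoefD mulrBl fcoefB fcoefXM fcoefCM /=.
  by have := rec 0%N => /= ->; ring.
by have := rec n.+1; rewrite /= => ->; ring.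
Qed.

(** The majorants [T n], sums over k of [|f_(n+k)| q^k], satisfy [T n = |f_n| + q T (n+1)]. Summed
    against [w ^+ n] this gives [(w - q) S <= 2 K], which is useful because [q < w] strictly. *)
Lemma inW_fquot w f z : inW w f -> cn z < w -> inW w (fquot f z).
Proof.
move=> [K h] zw; have q0 := cn_ge0 z; set q := cn z in zw q0.
have w0 : 0 < w by apply: le_lt_trans zw.
pose T n := rsum (fun k => cn (fcoef f (n + k)) * q ^+ k).
have hT n : abs_le (fun k => cn (fcoef f (n + k)) * q ^+ k) (K / w ^+ n).
  move=> N.
  have hw := wn_le (K := K / w ^+ n) (w' := q) (w := w) _ (wn_iter_shift n w0 h).
  have := hw _ N; rewrite q0 (ltW zw) => /(_ isT); apply: le_trans.
  apply: ler_sum => k _; rewrite fshift_iter ger0_norm // mulr_ge0 ?cn_ge0 ?exprn_ge0 //.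
have T0 n : 0 <= T n.
  have c := abs_series_cvg (hT n); apply: limr_ge => //; apply: nearW => N.
  by rewrite series_ord; apply: sumr_ge0 => k _; rewrite mulr_ge0 ?cn_ge0 ?exprn_ge0.
have Tle n : T n <= K / w ^+ n.
  by have := rsum_le (hT n); rewrite -/(T n) ger0_norm.
have Trec n : T n = cn (fcoef f n) + q * T n.+1.
  rewrite {1}/T (rsum_recl (hT n)) addn0 expr0 mulr1; congr (_ + _).
  rewrite -(rsumZ q (hT n.+1)); congr rsum; apply/funext => k.
  by rewrite addnS addSn exprS mulrCA.
have QT n : cn (fcoef (fquot f z) n) <= 2 * T n.+1.
  have bs : bsum q (T n.+1) (iter n.+1 fshift f).
    move=> N; have c := abs_series_cvg (hT n.+1).
    have nd : {homo series (fun k => cn (fcoef f (n.+1 + k)) * q ^+ k) : a b / (a <= b)%N >-> a <= b}.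
      by apply: nondecreasing_series => k _ _; rewrite mulr_ge0 ?cn_ge0 ?exprn_ge0.
    have := nondecreasing_cvgn_le nd c N; rewrite series_ord; apply: le_trans.
    by apply: ler_sum => k _; rewrite fshift_iter.
  exact: fval_le bs.
have wq : 0 < w - q by rewrite subr_gt0.
exists (2 * (2 * K / (w - q))) => N.
apply: (@le_trans _ _ (\sum_(n < N) 2 * (T n.+1 * w ^+ n))).
  by apply: ler_sum => n _; rewrite mulrA ler_wpM2r ?exprn_ge0 ?(ltW w0).
rewrite -mulr_sumr ler_pM2l // ler_pdivlMr //.
set S := \sum_(_ < _) _.
have e : w * S + T 0%N = \sum_(n < N.+1) T n * w ^+ n.
  rewrite big_ord_recl expr0 mulr1 addrC; congr (_ + _); rewrite /S mulr_sumr.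
  by apply: eq_bigr => n _; rewrite /= exprS; ring.
have e2 : \sum_(n < N.+1) T n * w ^+ n =
    \sum_(n < N) cn (fcoef f n) * w ^+ n + q * S + T N * w ^+ N.
  rewrite big_ord_recr /=; congr (_ + _); rewrite /S mulr_sumr -big_split /=.
  by apply: eq_bigr => n _; rewrite {1}Trec; ring.
have := h N; have : T N * w ^+ N <= K by rewrite -ler_pdivlMr ?exprn_gt0.
have := T0 0%N; lra.
Qed.

End Wiener.

Section Evaluation.
Context {R : realType}.
Local Notation C := R[i].
Implicit Types (f g h : fps C) (w K L : R) (n N : nat) (z c v : C).

Lemma fps_cancel f g h : f != 0 -> f * g = f * h -> g = h.
Proof.
move=> f0 e; apply/eqP; rewrite -subr_eq0; apply/negPn/negP => gh.
by have := fps_mul_neq0 f0 gh; rewrite mulrBr e subrr eqxx.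
Qed.

Lemma fXsub_neq0 z : fX - fconst z != 0.
Proof.
apply/eqP => /(congr1 (fun u => fcoef u 1)) /eqP.
by rewrite fcoefB /= subr0 oner_eq0.
Qed.

Lemma inW_Xsub w z : 0 <= w -> inW w (fX - fconst z).
Proof. by move=> w0; apply: (inW_B w0); [exact: inW_fX | exact: inW_const]. Qed.

(* Evaluation as the remainder of the division by [X - z] inside the algebra, so that a zero of
   [f] can be divided out without leaving the algebra. *)
Definition has_val w f z v := exists2 g, inW w g & f = fconst v + (fX - fconst z) * g.

Section Fixed.
Variables (w : R) (z : C).
Hypotheses (w0 : 0 < w) (zw : cn z < w).

Lemma has_val_exists f : inW w f -> exists v, has_val w f z v.
Proof.
move=> hf; exists (fval f z); exists (fquot f z); first exact: inW_fquot.
by case: hf => K h; apply: fquotP h (ltW zw).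
Qed.

Lemma has_val_inW f v : has_val w f z v -> inW w f.
Proof.
move=> [g hg ->]; have w0' := ltW w0; apply: (inW_D w0'); first exact: inW_const.
by apply: (inW_M w0') hg; exact: inW_Xsub.
Qed.

(** If [(X - z) u] is constant then [u_0 = z^n u_n] for all n, while [u_n] is at most [K / w^n];
    hence [u_0 = 0] since [|z| < w]. *)
Lemma has_val_uniq f v v' : has_val w f z v -> has_val w f z v' -> v = v'.
Proof.
move=> [g hg fg] [h hh fh].
have : inW w (g - h) by exact: (inW_B (ltW w0)).
set u := g - h => -[K hu].
have e : (fX - fconst z) * u = fconst (v' - v).
  rewrite /u mulrBr rmorphB; apply/eqP; rewrite subr_eq; apply/eqP.
  by apply: (@addrI _ (fconst v)); rewrite -fg fh; ring.
have c0 : - z * fcoef u 0 = v' - v.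
  by have := congr1 (fun f => fcoef f 0) e; rewrite mulrBl fcoefB fcoefXM fcoefCM /= sub0r mulNr.
have cS n : fcoef u n = z * fcoef u n.+1.
  have := congr1 (fun f => fcoef f n.+1) e; rewrite mulrBl fcoefB fcoefXM fcoefCM /=.
  by move/eqP; rewrite subr_eq0 => /eqP.
have un n : fcoef u 0 = z ^+ n * fcoef u n.
  elim: n => [|n IH]; first by rewrite expr0 mul1r.
  by rewrite IH [in LHS]cS exprSr mulrA.
suff u0 : fcoef u 0 = 0 by move: c0; rewrite u0 mulr0 => /esym/eqP; rewrite subr_eq0 => /eqP ->.
have K0 : 0 <= K := wn_ge0 hu.
pose q := cn z / w; have q0 : 0 <= q by rewrite divr_ge0 ?cn_ge0 // ltW.
have q1 : q < 1 by rewrite ltr_pdivrMr // mul1r.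
have b n : cn (fcoef u 0) <= q ^+ n * K.
  have := wn_coef n (ltW w0) hu; have wn0 : 0 < w ^+ n by exact: exprn_gt0.
  rewrite -ler_pdivlMr // => hn; rewrite (un n) cnM cnX /q expr_div_n -mulrA.
  by rewrite ler_wpM2l ?exprn_ge0 ?cn_ge0 // mulrC.
apply/eqP; rewrite -cn_eq0 eq_le cn_ge0 andbT leNgt; apply/negP => pos.
have K1 : 0 < K + 1 by lra.
have : ((fun n => q ^+ n) @ \oo --> (0 : R))%classic.
  by apply: cvg_expr; rewrite ger0_norm.
move/cvgrPdist_lt => /(_ (cn (fcoef u 0) / (K + 1)) ltac:(by rewrite divr_gt0)).
case=> N _ /(_ N (leqnn N)) /=; rewrite sub0r normrN ger0_norm ?exprn_ge0 //.
rewrite ltr_pdivlMr // => hq; have := b N; have : 0 <= q ^+ N by exact: exprn_ge0.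
nra.
Qed.

Lemma has_val_const c : has_val w (fconst c) z c.
Proof.
exists 0; last by rewrite mulr0 addr0.
by have := inW_const w (0 : C); rewrite rmorph0.
Qed.

Lemma has_val_1 : has_val w 1 z 1.
Proof. by have := has_val_const 1; rewrite rmorph1. Qed.

Lemma has_val_X : has_val w fX z z.
Proof. by exists 1; [exact: inW_1 | rewrite mulr1 addrC subrK]. Qed.

Lemma has_val_D f g u v : has_val w f z u -> has_val w g z v ->
  has_val w (f + g) z (u + v).
Proof.
move=> [f' hf ->] [g' hg ->]; exists (f' + g'); first exact: (inW_D (ltW w0)).
by rewrite rmorphD; ring.
Qed.

Lemma has_val_N f v : has_val w f z v -> has_val w (- f) z (- v).
Proof. by move=> [f' hf ->]; exists (- f'); [exact: inW_N | rewrite rmorphN; ring]. Qed.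

Lemma has_val_B f g u v : has_val w f z u -> has_val w g z v ->
  has_val w (f - g) z (u - v).
Proof. by move=> hf hg; apply: has_val_D => //; exact: has_val_N. Qed.

Lemma has_val_M f g u v : has_val w f z u -> has_val w g z v ->
  has_val w (f * g) z (u * v).
Proof.
move=> hf hg; have ig := has_val_inW hg.
move: hf hg => [f' hf fE] [g' hg gE]; exists (f' * g + fconst u * g').
  have w0' := ltW w0; apply: (inW_D w0'); apply: (inW_M w0') => //; exact: inW_const.
by rewrite {1}fE mulrDl {1}gE rmorphM; ring.
Qed.

Lemma has_val_exp f v n : has_val w f z v -> has_val w (f ^+ n) z (v ^+ n).
Proof.
move=> hf; elim: n => [|n IH]; first by rewrite !expr0; exact: has_val_1.
by rewrite !exprS; exact: has_val_M.
Qed.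

Lemma has_val_le K f v : wn w K f -> has_val w f z v -> cn v <= 2 * K.
Proof.
move=> hf hv.
have hv' : has_val w f z (fval f z).
  by exists (fquot f z); [apply: inW_fquot => //; exists K | apply: fquotP hf (ltW zw)].
by rewrite (has_val_uniq hv hv'); apply: fval_le; apply: bsum_wn hf (ltW zw).
Qed.

End Fixed.

Lemma inW_geom w z : 0 <= w < cn z -> exists2 k, inW w k & (fX - fconst z) * k = 1.
Proof.
move=> /andP[w0 wz]; have cz : 0 < cn z by apply: le_lt_trans wz.
have z0 : z != 0 by rewrite -cn_gt0.
exists (Fps (fun n => - z^-1 ^+ n.+1)); last first.
  apply: fpsP => n; rewrite mulrBl fcoefB fcoefXM fcoefCM fcoef1.
  by case: n => [|n] /=; rewrite ?exprS ?expr0; field.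
pose q := w / cn z; have q0 : 0 <= q by rewrite divr_ge0 // ltW.
have q1 : q < 1 by rewrite ltr_pdivrMr // mul1r.
have c1 : 0 < cn z * (1 - q) by rewrite mulr_gt0 // subr_gt0.
exists (cn z * (1 - q))^-1 => N.
have -> : \sum_(i < N) cn (fcoef (Fps (fun n => - z^-1 ^+ n.+1)) i) * w ^+ i
   = (cn z)^-1 * \sum_(i < N) q ^+ i.
  rewrite mulr_sumr; apply: eq_bigr => i _ /=.
  by rewrite cnN cnX cnV /q expr_div_n exprS exprVn; ring.
rewrite invfM ler_wpM2l ?invr_ge0 ?cn_ge0 //.
rewrite -[leRHS]mul1r ler_pdivlMr ?subr_gt0 //.
rewrite (_ : _ * (1 - q) = 1 - q ^+ N); first by rewrite lerBlDr lerDl exprn_ge0.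
have := subrX1 q N; rewrite -/(_ - _) => e; have -> : 1 - q ^+ N = - (q ^+ N - 1) by ring.
by rewrite e; ring.
Qed.

(** At a root with [|z| <= 1] the product vanishes but [f] does not, so [X - z] divides [g]. A root
    outside the disk is absorbed into [g] as the inverse of [X - z], after the radius is lowered
    below [|z|]. As the radius may change at every root, zeros of [f] are excluded for all radii. *)
Lemma wiener_inv (s : seq C) w f g c : 1 < w -> inW w f -> inW w g -> c != 0 ->
  f * g = fconst c * \prod_(z <- s) (fX - fconst z) ->
  (forall z w', cn z <= 1 -> 1 < w' -> ~ (exists2 h, inW w' h & f = (fX - fconst z) * h)) ->
  exists w' h, [/\ 1 < w', w' <= w, inW w' h & f * h = 1].
Proof.
elim: s w g => [|z s IH] w g w1 hf hg c0 e nz.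
  exists w, (fconst c^-1 * g); split => //.
    by apply: inW_M => //; [lra | exact: inW_const].
  rewrite mulrCA e big_nil mulr1 -rmorphM mulVf // rmorph1 //.
have w0 : 0 < w by lra.
rewrite big_cons in e.
have prodW w' : 0 <= w' -> inW w' (fconst c * \prod_(z <- s) (fX - fconst z)).
  move=> w'0; apply: inW_M => //; first exact: inW_const.
  elim: (s) => [|y s' IHs]; first by rewrite big_nil; exact: inW_1.
  by rewrite big_cons; apply: inW_M => //; exact: inW_Xsub.
have [z1|z1] := leP (cn z) 1.
  have zw : cn z < w by lra.
  have [vf hvf] := has_val_exists w0 zw hf.
  have [vg hvg] := has_val_exists w0 zw hg.
  have : has_val w (f * g) z 0.
    exists (fconst c * \prod_(z <- s) (fX - fconst z)); first by apply: prodW; exact: ltW.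
    by rewrite e rmorph0; ring.
  move/(has_val_uniq w0 zw (has_val_M w0 hvf hvg))/eqP; rewrite mulf_eq0 => /orP[/eqP v0|/eqP v0].
    exfalso; apply: (nz z w z1 w1); case: hvf => h hh; rewrite v0 rmorph0 add0r => ->.
    by exists h.
  move: hvg => [g' hg']; rewrite v0 rmorph0 add0r => gE.
  apply: (IH w g' w1 hf hg' c0 _ nz); apply: (fps_cancel (fXsub_neq0 z)).
  by rewrite mulrCA -gE e; ring.
pose w1' := Num.min w ((1 + cn z) / 2).
have lt1 : 1 < w1' by rewrite lt_min w1 /=; lra.
have ltz : 0 <= w1' < cn z.
  apply/andP; split; first lra.
  by rewrite gt_min; apply/orP; right; lra.
have lew : w1' <= w by rewrite ge_min lexx.
have ww : 0 <= w1' <= w by rewrite lew andbT; lra.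
have [k hk kE] := inW_geom ltz.
have w1'0 : 0 <= w1' by lra.
have [w' [h [h1 h2 h3 h4]]] := IH w1' (g * k) lt1 (inW_le ww hf)
  (inW_M w1'0 (inW_le ww hg) hk) c0 ltac:(by rewrite mulrA e -[RHS]mul1r -kE; ring) nz.
by exists w', h; split => //; exact: le_trans lew.
Qed.

Definition fpoly (p : {poly C}) : fps C := Fps (fun n => p`_n).

Lemma fpolyM p q : fpoly (p * q) = fpoly p * fpoly q.
Proof. by apply: fpsP => n; rewrite fcoefM /= coefM. Qed.
Lemma fpolyD p q : fpoly (p + q) = fpoly p + fpoly q.
Proof. by apply: fpsP => n; rewrite fcoefD /= coefD. Qed.
Lemma fpolyN p : fpoly (- p) = - fpoly p.
Proof. by apply: fpsP => n; rewrite fcoefN /= coefN. Qed.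
Lemma fpolyC c : fpoly c%:P = fconst c.
Proof. by apply: fpsP => n; rewrite /= coefC. Qed.
Lemma fpolyX : fpoly 'X = fX.
Proof. by apply: fpsP => n; rewrite /= coefX. Qed.

Lemma wiener_inv_poly w f g p : 1 < w -> inW w f -> inW w g ->
  f * g = fpoly p -> p != 0 ->
  (forall z w', cn z <= 1 -> 1 < w' -> ~ (exists2 h, inW w' h & f = (fX - fconst z) * h)) ->
  exists w' h, [/\ 1 < w', w' <= w, inW w' h & f * h = 1].
Proof.
move=> w1 hf hg e p0 nz; have [s ps] := closed_field_poly_normal p.
apply: (@wiener_inv s w f g (lead_coef p)) => //; first by rewrite lead_coef_eq0.
rewrite e {1}ps -mul_polyC fpolyM fpolyC; congr (_ * _).
elim: (s) => [|z s' IH]; first by rewrite !big_nil; apply: fpsP => n; rewrite /= coef1; case: n.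
by rewrite !big_cons fpolyM IH fpolyD fpolyN fpolyC fpolyX.
Qed.

End Evaluation.

(** * Generating series of the kernel *)

Section GeneratingSeries.
Context {R : realType}.
Local Notation C := R[i].
Implicit Types (a w : R) (f g : fps C) (k l n : nat) (p : int).

Definition cst (x : R) : fps C := fconst x%:C.
Lemma cstD x y : cst (x + y) = cst x + cst y. Proof. by rewrite /cst !rmorphD. Qed.
Lemma cstN x : cst (- x) = - cst x. Proof. by rewrite /cst !rmorphN. Qed.
Lemma cstM x y : cst (x * y) = cst x * cst y. Proof. by rewrite /cst !rmorphM. Qed.
Lemma cst1 : cst 1 = 1. Proof. by rewrite /cst !rmorph1. Qed.
Lemma cst_nat n : cst n%:R = n%:R. Proof. by rewrite /cst !rmorph_nat. Qed.

Definition gser a p : fps C := Fps (fun n => (green a n p)%:C).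
Definition sser a p : fps C := Fps (fun n => (tailsum a n p)%:C).

Lemma gserE a p : gser a p = (p == 0)%:R +
  fX * (cst (b1 a) * gser a (p - 1) + cst (b0 a) * gser a p + cst (bm a) * gser a (p + 1)).
Proof.
have e : ((p == 0)%:R : fps C) = fconst (p == 0)%:R by rewrite rmorph_nat.
apply: fpsP => -[|n]; rewrite e fcoefD fcoefXM.
  by rewrite addr0 /= /green /= /delta0 rmorph_nat.
by rewrite !fcoefD !fcoefCM /= add0r -!rmorphM -!rmorphD.
Qed.

Lemma three_term_uniq (d F H : int -> fps C) c1 c0 cm :
  (forall p, F p = d p + fX * (c1 * F (p - 1) + c0 * F p + cm * F (p + 1))) ->
  (forall p, H p = d p + fX * (c1 * H (p - 1) + c0 * H p + cm * H (p + 1))) ->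
  forall p, F p = H p.
Proof.
move=> hF hH; suff h N : forall p n, (n < N)%N -> fcoef (F p) n = fcoef (H p) n.
  by move=> p; apply: fpsP => n; exact: (h n.+1).
elim: N => // N IH p [|n] nN; rewrite hF hH !fcoefD !fcoefXM // !fcoefD.
by congr (_ + (_ + _ + _)); apply: (@eq_fcoefM _ _ _ _ _ N) => // i iN; exact: IH.
Qed.

(** The fixed point selects the root of the quadratic that vanishes at [X = 0]. *)
Lemma lam_exists a : exists lam : fps C,
  fX * (cst (b1 a) * lam ^+ 2 + cst (b0 a) * lam + cst (bm a)) = lam.
Proof.
apply: fps_fixpoint => f g N fg [|n] nN; rewrite !fcoefXM // !fcoefD.
congr (_ + _ + _); apply: (@eq_fcoefM _ _ _ _ _ N) => // i iN.
by rewrite !expr2; apply: (@eq_fcoefM _ _ _ _ _ N).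
Qed.

(* [lam] and [1/sig] are the two roots of the dispersion relation in [1/X]: [lam] and [sig] are
   the roots that decay away from the source on its left and on its right. *)
Definition lam a : fps C := projT1 (cid (lam_exists a)).
Definition sig a : fps C := cst (b1 a / bm a) * lam a.
(** A square root of the discriminant ([disc_rootE]), and at the same time the inverse of
    [gser a 0]. *)
Definition disc_root a : fps C := 1 - fX * (cst (b0 a) + 2 * cst (b1 a) * lam a).
Local Notation D := disc_root.

Lemma lamE a : lam a = fX * (cst (b1 a) * lam a ^+ 2 + cst (b0 a) * lam a + cst (bm a)).
Proof. by rewrite /lam; case: cid => f /= ->. Qed.

Lemma b1_gt0 a : 0 < a < 1 -> 0 < b1 a.
Proof. by move=> /andP[? ?]; rewrite /b1 divr_gt0 // mulr_gt0 //; lra. Qed.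
Lemma bm_lt0 a : 0 < a < 1 -> bm a < 0.
Proof. by move=> /andP[? ?]; rewrite /bm oppr_lt0 divr_gt0 // mulr_gt0 //; lra. Qed.

Lemma cst_sum a : cst (b1 a) + cst (b0 a) + cst (bm a) = 1.
Proof. by rewrite -!cstD b_sum cst1. Qed.

Section Fixed.
Variable a : R.
Hypothesis a01 : 0 < a < 1.
Local Notation B1 := (cst (b1 a)).
Local Notation B0 := (cst (b0 a)).
Local Notation Bm := (cst (bm a)).

Lemma bm_sig : Bm * sig a = B1 * lam a.
Proof.
rewrite /sig mulrA -cstM (_ : bm a * (b1 a / bm a) = b1 a) //.
by rewrite mulrCA divff ?mulr1 // lt_eqF // bm_lt0.
Qed.

Lemma sigE : sig a = fX * (B1 + B0 * sig a + Bm * sig a ^+ 2).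
Proof.
have bm0 : bm a != 0 by rewrite lt_eqF // bm_lt0.
rewrite (expr2 (sig a)) mulrA bm_sig {1 2 3}/sig {1}lamE.
have -> : cst (b1 a / bm a) * (fX * (B1 * lam a ^+ 2 + B0 * lam a + Bm)) =
  fX * (Bm * cst (b1 a / bm a) + B0 * (cst (b1 a / bm a) * lam a) +
    B1 * lam a * (cst (b1 a / bm a) * lam a)) by ring.
by rewrite -cstM (_ : bm a * (b1 a / bm a) = b1 a) // mulrCA divff ?mulr1.
Qed.

Lemma disc_rootE : D a ^+ 2 = (1 - fX * B0) ^+ 2 - 4 * fX ^+ 2 * B1 * Bm.
Proof.
have e := lamE a; rewrite /D.
have -> : (1 - fX * (B0 + 2 * B1 * lam a)) ^+ 2 = (1 - fX * B0) ^+ 2 - 4 * fX ^+ 2 * B1 * Bm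
  - 4 * fX * B1 * (lam a - fX * (B1 * lam a ^+ 2 + B0 * lam a + Bm)) by ring.
by rewrite -e subrr mulr0 subr0.
Qed.

Lemma disc_root_neq0 : D a != 0.
Proof.
apply/eqP => /(congr1 (fun f => fcoef f 0)) /eqP.
by rewrite fcoefB fcoefXM fcoef1 fcoef0 subr0 oner_eq0.
Qed.

(** The two geometric profiles, glued at 0 with amplitude the inverse of [D a], solve the recurrence
    of [gser], whose solution is unique. *)
Lemma gser_lam_sig k : D a * gser a (- k%:Z) = lam a ^+ k /\ D a * gser a k%:Z = sig a ^+ k.
Proof.
have [E hE] : exists E, D a * E = 1.
  exact: fps_inv1.
pose H p := (if p <= 0 then lam a ^+ `|p|%N else sig a ^+ `|p|%N) * E.
have HE := three_term_uniq (d := fun p => (p == 0)%:R) (gserE a) (H := H).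
have gH p : gser a p = H p.
  apply: HE => {}p; have [pn|pp|->] := ltgtP p 0.
  - have [l ->] : exists l, p = - l.+1%:Z by exists (`|p|%N.-1); lia.
    have -> : - l.+1%:Z - 1 = - l.+2%:Z by lia.
    have -> : - l.+1%:Z + 1 = - l%:Z by lia.
    have hn i : H (- i%:Z) = lam a ^+ i * E by rewrite /H ifT ?abszN //; lia.
    rewrite !hn.
    rewrite [LHS](_ : _ = (fX * (B1 * lam a ^+ 2 + B0 * lam a + Bm)) * lam a ^+ l * E); last first.
      by rewrite -lamE -exprS.
    rewrite [RHS]add0r !exprS; ring.
  - have [l ->] : exists l, p = l.+1%:Z by exists (`|p|%N.-1); lia.
    have -> : l.+1%:Z - 1 = l%:Z by lia.
    have -> : l.+1%:Z + 1 = l.+2%:Z by lia.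
    have hp i : H i%:Z = sig a ^+ i * E by rewrite /H; case: i.
    rewrite !hp.
    rewrite [LHS](_ : _ = (fX * (B1 + B0 * sig a + Bm * sig a ^+ 2)) * sig a ^+ l * E); last first.
      by rewrite -sigE -exprS.
    rewrite [RHS]add0r !exprS; ring.
  - have H0 : H 0 = E by rewrite /H expr0 mul1r.
    have Hm : H (0 - 1) = lam a * E by rewrite /H expr1.
    have Hp : H (0 + 1) = sig a * E by rewrite /H expr1.
    rewrite H0 Hm Hp (mulrA Bm) bm_sig; change (true%:R) with (1 : fps C).
    transitivity ((1 - fX * (B0 + 2 * B1 * lam a)) * E + fX * (B0 + 2 * B1 * lam a) * E); first by ring.
    by rewrite -/(D a) hE; ring.
split; rewrite gH /H.
  by rewrite ifT; [rewrite mulrCA hE mulr1; congr (_ ^+ _); lia | lia].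
by case: k => [|k] /=; rewrite mulrCA hE mulr1.
Qed.

Lemma gser_lam k : D a * gser a (- k%:Z) = lam a ^+ k.
Proof. by case: (gser_lam_sig k). Qed.
Lemma gser_sig k : D a * gser a k%:Z = sig a ^+ k.
Proof. by case: (gser_lam_sig k). Qed.

Lemma gser_succ k : gser a k.+1%:Z = sig a * gser a k%:Z.
Proof.
apply: (fps_cancel disc_root_neq0); rewrite gser_sig exprS -gser_sig; ring.
Qed.

Lemma sser_dif p : sser a p = gser a p + sser a (p + 1).
Proof. by apply: fpsP => n /=; rewrite -rmorphD -(tailsum_dif a n p) subrK. Qed.

Lemma sser_flux p : sser a p =
  (p <= 0)%R%:R + fX * (sser a p + B1 * gser a (p - 1) - Bm * gser a p).
Proof.
have e : ((p <= 0)%R%:R : fps C) = fconst (p <= 0)%R%:R by rewrite rmorph_nat.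
apply: fpsP => -[|n]; rewrite e fcoefD fcoefXM.
  rewrite addr0 /= /tailsum /zsum big_ord1 /= /green /= /delta0 subrr.
  by case: (p <= 0).
rewrite fcoefB fcoefD !fcoefCM /= add0r -!rmorphM -rmorphD -rmorphB.
by rewrite tailsum_flux.
Qed.

(** At [X = 1] the dispersion relation has the root 1 because the weights sum to 1; this is the
    resulting factor [1 - sig a] of [1 - X]. *)
Lemma oneX_sig : 1 - fX = (1 - sig a) * (1 - fX + fX * (B1 - Bm * sig a)).
Proof.
apply/eqP; rewrite -subr_eq0; apply/eqP.
have -> : 1 - fX - (1 - sig a) * (1 - fX + fX * (B1 - Bm * sig a)) =
  (sig a - fX * (B1 + B0 * sig a + Bm * sig a ^+ 2)) + fX * sig a * (B1 + B0 + Bm - 1) by ring.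
by rewrite -sigE cst_sum !subrr mulr0 addr0.
Qed.

Lemma oneX_neq0 : (1 - fX : fps C) != 0.
Proof.
apply/eqP => /(congr1 (fun f => fcoef f 0)) /eqP.
by rewrite fcoefB /= subr0 oner_eq0.
Qed.

(** Formally a geometric series of ratio [sig a] over the positions from [k] on; the flux identity
    replaces the infinite sum. *)
Lemma sser_gser k : (1 - sig a) * sser a k%:Z = gser a k%:Z.
Proof.
have pos l : (1 - sig a) * sser a l.+1%:Z = gser a l.+1%:Z.
  have := sser_flux l.+1%:Z; rewrite /= add0r (_ : l.+1%:Z - 1 = l%:Z); last lia.
  rewrite gser_succ => e; apply: (fps_cancel oneX_neq0).
  have e1 : (1 - fX) * sser a l.+1%:Z = fX * (B1 - Bm * sig a) * gser a l%:Z.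
    by rewrite mulrBl mul1r {1}e; ring.
  rewrite mulrCA e1; set g := gser a l%:Z.
  have e2 : fX * (B1 - Bm * sig a) = (1 - fX + fX * (B1 - Bm * sig a)) * sig a.
    apply/eqP; rewrite -subr_eq0; apply/eqP.
    have -> : fX * (B1 - Bm * sig a) - (1 - fX + fX * (B1 - Bm * sig a)) * sig a =
     - (sig a - fX * (B1 + B0 * sig a + Bm * sig a ^+ 2)) - fX * sig a * (B1 + B0 + Bm - 1) by ring.
    by rewrite -sigE cst_sum !subrr mulr0 subr0 oppr0.
  by rewrite e2 [in RHS]oneX_sig; ring.
case: k => [|k]; last exact: pos.
by rewrite sser_dif mulrDr (pos 0%N) gser_succ; ring.
Qed.

(** A source at distance [k] enters the boundary equations through [sig a ^+ k]. It is traded here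
    for tail sums, with a factor that vanishes at [X = 1] and will cancel the pole of the inverse
    determinant. *)
Lemma sig_sser k : sig a ^+ k = D a * (1 - sig a) * sser a k%:Z.
Proof. by rewrite -mulrA sser_gser gser_sig. Qed.

End Fixed.
End GeneratingSeries.

Section RootTest.
Context {R : realType}.

Lemma root_test (x r K : R) : 0 <= x -> 0 < r -> (forall l : nat, x ^+ l <= K * r ^+ l) -> x <= r.
Proof.
move=> x0 r0 h; rewrite leNgt; apply/negP => rx.
pose d := x / r - 1; have d0 : 0 < d by rewrite subr_gt0 ltr_pdivlMr // mul1r.
have bern (l : nat) : 1 + l%:R * d <= (1 + d) ^+ l.
  elim: l => [|l IH]; first by rewrite mul0r addr0 expr0.
  rewrite exprS -[l.+1%:R]natr1; have : 0 <= l%:R * d ^+ 2 by rewrite mulr_ge0 ?sqr_ge0.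
  have : (1 + d) * (1 + l%:R * d) <= (1 + d) * (1 + d) ^+ l by rewrite ler_wpM2l //; lra.
  lra.
pose l := Num.bound `|K / d|.
have hl : K / d < l%:R.
  apply: le_lt_trans (ler_norm _) _; have := archi_boundP (normr_ge0 (K / d)); apply: le_lt_trans; exact: lexx.
have := h l; rewrite -ler_pdivrMr ?exprn_gt0 // -expr_div_n (_ : x / r = 1 + d); last by rewrite /d; lra.
move=> hK; have := bern l; have : K < l%:R * d by rewrite -ltr_pdivrMr.
lra.
Qed.

Lemma geom_le (q : R) N : 0 <= q -> q < 1 -> \sum_(i < N) q ^+ i <= (1 - q)^-1.
Proof.
move=> q0 q1; rewrite -[leRHS]mul1r ler_pdivlMr ?subr_gt0 //.
have e := subrX1 q N; have := exprn_ge0 N q0.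
set S := \sum_(_ < _) _ in e *; lra.
Qed.
End RootTest.

(** * The decaying root as an element of the weighted algebra *)

Section DecayingRoot.
Context {R : realType}.
Local Notation C := R[i].
Implicit Types (a w : R) (f g : fps C) (k l n : nat) (p : int).
Local Notation D := disc_root.

Lemma inW_cst w (x : R) : inW w (cst x).
Proof. exact: inW_const. Qed.
Lemma has_val_cst w z (x : R) : has_val w (cst x) z x%:C.
Proof. exact: has_val_const. Qed.
Lemma has_val_nat w (z : C) n : has_val w (n%:R) z n%:R.
Proof. by have := has_val_const w z n%:R; rewrite rmorph_nat. Qed.
Lemma inW_nat w n : inW w (n%:R : fps C).
Proof. by have := inW_const w (n%:R : C); rewrite rmorph_nat. Qed.

Definition rate a : R := Num.sqrt ((1 - a) / (1 + a)).

Lemma rate_sqr a : 0 < a < 1 -> rate a ^+ 2 = (1 - a) / (1 + a).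
Proof. by move=> a01; rewrite sqr_sqrtr // divr_ge0; lra. Qed.
Lemma rate_gt0 a : 0 < a < 1 -> 0 < rate a.
Proof. by move=> a01; rewrite sqrtr_gt0 divr_gt0; lra. Qed.
Lemma rate_lt1 a : 0 < a < 1 -> rate a < 1.
Proof.
move=> a01; rewrite -(@ltr_pXn2r _ 2) ?nnegrE ?(ltW (rate_gt0 _)) // rate_sqr // expr1n.
by rewrite ltr_pdivrMr; lra.
Qed.
Lemma b1_rate a : 0 < a < 1 -> b1 a * rate a ^+ 2 = - bm a.
Proof. by move=> a01; rewrite rate_sqr // /b1 /bm; field; lra. Qed.

Variables (a w : R).
Hypotheses (a01 : 0 < a < 1) (w1 : 1 < w) (wa : w ^+ 2 * (1 - a ^+ 2) < 1).
Local Notation B1 := (cst (b1 a)).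
Local Notation B0 := (cst (b0 a)).
Local Notation Bm := (cst (bm a)).
Local Notation r := (rate a).

Let w0 : 0 < w. Proof. exact: lt_trans w1. Qed.

(** [green_left] at [j = - l] bounds the n-th coefficient by [r^l (1 - a^2)^(n/2)]: the series
    converges as [w^2 (1 - a^2) < 1], with a norm that shrinks like [r^l]. *)
Lemma wn_gser_left : exists2 K, 0 < K & forall l, wn w (K * r ^+ l) (gser a (- l%:Z)).
Proof.
have aa : 0 < 1 - a ^+ 2 by have /andP[a0 a1] := a01; rewrite subr_gt0 expr_lt1 // ltW.
pose M := Num.sqrt (1 - a ^+ 2); have M0 : 0 < M by rewrite sqrtr_gt0.
have M2 : M ^+ 2 = 1 - a ^+ 2 by rewrite sqr_sqrtr // ltW.
have wM : w * M < 1.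
  rewrite -(@ltr_pXn2r _ 2) ?nnegrE //; last by rewrite mulr_ge0 // ltW.
  by rewrite exprMn M2 expr1n.
exists (1 - w * M)^-1; first by rewrite invr_gt0 subr_gt0.
move=> l N; have rl := exprn_gt0 l (rate_gt0 a01).
apply: (@le_trans _ _ (\sum_(i < N) r ^+ l * (w * M) ^+ i)).
  apply: ler_sum => i _; rewrite /= cn_real exprMn (mulrC (w ^+ _)) mulrA ler_wpM2r ?exprn_ge0 ?(ltW w0) //.
  have rM : 0 <= r ^+ l * M ^+ i by rewrite mulr_ge0 ?exprn_ge0 // ltW // rate_gt0.
  rewrite -(@ler_pXn2r _ 2) ?nnegrE ?normr_ge0 //.
  have := green_left i (- l%:Z) a01; rewrite -rate_sqr // real_normK ?num_real //.
  rewrite exprMn -!exprM mulnC (mulnC i) !exprM M2.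
  rewrite -exprnN ler_pdivrMr ?exprn_gt0 ?(rate_gt0 a01) //.
  by rewrite mulrC.
rewrite -mulr_sumr mulrC ler_pM2r //; apply: geom_le => //.
by rewrite mulr_ge0 // ltW.
Qed.

Lemma inW_gser0 : inW w (gser a 0).
Proof. by have [K _ /(_ 0%N)] := wn_gser_left; rewrite oppr0; exists (K * r ^+ 0). Qed.

(** No square root has to be estimated: [D a] is its square, a polynomial, times its inverse
    [gser a 0]. *)
Lemma inW_disc_root : inW w (D a).
Proof.
have -> : D a = D a ^+ 2 * gser a 0.
  by have := gser_lam a01 0; rewrite oppr0 expr0 => e; rewrite expr2 -mulrA e mulr1.
have w0' := ltW w0.
rewrite disc_rootE; apply: (inW_M w0') inW_gser0.
apply: (inW_B w0').
  apply: (inW_exp w0'); apply: (inW_B w0'); [exact: inW_1 | apply: (inW_M w0'); [exact: inW_fX | exact: inW_cst]].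
apply: (inW_M w0'); last exact: inW_cst.
apply: (inW_M w0'); last exact: inW_cst.
apply: (inW_M w0'); first exact: inW_nat.
by apply: (inW_exp w0'); exact: inW_fX.
Qed.

Lemma wn_lam : exists2 K, 0 < K & forall l, wn w (K * r ^+ l) (lam a ^+ l).
Proof.
have [K K0 hK] := wn_gser_left; have [L hL] := inW_disc_root.
have L0 : 0 < L + 1 by have := wn_ge0 hL; lra.
exists ((L + 1) * K); first exact: mulr_gt0.
move=> l; rewrite -gser_lam // -mulrA; apply: (wnM (ltW w0)) (hK l).
by move=> N; apply: le_trans (hL N) _; rewrite lerDl.
Qed.

Lemma inW_lam : inW w (lam a).
Proof. by have [K _ /(_ 1%N)] := wn_lam; rewrite expr1; exists (K * r ^+ 1). Qed.

(** [K] in [wn_lam] does not depend on [l], so it disappears when l-th roots of the bound on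
    [v ^+ l] are taken. *)
Lemma lam_val_le z v : cn z < w -> has_val w (lam a) z v -> cn v <= r.
Proof.
move=> zw hv; have [K K0 hK] := wn_lam.
apply: (@root_test _ _ _ (2 * K)); [exact: cn_ge0 | exact: rate_gt0 |].
move=> l; rewrite -cnX -mulrA.
exact: (has_val_le w0 zw (hK l) (has_val_exp w0 l hv)).
Qed.

Lemma lam_val_root z v : cn z < w -> has_val w (lam a) z v ->
  v = z * ((b1 a)%:C * v ^+ 2 + (b0 a)%:C * v + (bm a)%:C).
Proof.
move=> zw hv; apply: (has_val_uniq w0 zw hv); rewrite lamE.
apply: (has_val_M w0); first exact: has_val_X.
apply: (has_val_D w0); last exact: has_val_cst.
apply: (has_val_D w0); apply: (has_val_M w0); rewrite ?expr2 //; try exact: has_val_cst.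
exact: (has_val_M w0).
Qed.

Lemma complex_inj0 (x : R) : (x%:C == 0) = (x == 0).
Proof. by rewrite eq_complex /= eqxx andbT. Qed.

(** The roots at [X = 1] are 1 and [bm a / b1 a]; the first is excluded by [lam_val_le] since
    [rate a < 1]. *)
Lemma lam_val_1 : has_val w (lam a) 1 (bm a / b1 a)%:C.
Proof.
have c1w : cn (1 : C) < w by rewrite cn1.
have [v hv] := has_val_exists w0 c1w inW_lam.
have le := lam_val_le c1w hv; have rt := lam_val_root c1w hv.
suff -> : (bm a / b1 a)%:C = v by [].
have b10 : b1 a != 0 by rewrite gt_eqF // b1_gt0.
have v1 : v - 1 != 0.
  by apply/negP; rewrite subr_eq0 => /eqP v1; move: le; rewrite v1 cn1 leNgt rate_lt1.
have : (v - 1) * ((b1 a)%:C * v - (bm a)%:C) = 0.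
  have e : (b0 a)%:C = 1 - (b1 a)%:C - (bm a)%:C :> C.
    by rewrite -(rmorph1 (real_complex R)) -!rmorphB; congr (_%:C); have := b_sum a; lra.
  have -> : (v - 1) * ((b1 a)%:C * v - (bm a)%:C) =
    ((b1 a)%:C * v ^+ 2 + (b0 a)%:C * v + (bm a)%:C) - v by rewrite e; ring.
  by rewrite mul1r in rt; rewrite -rt subrr.
move/eqP; rewrite mulf_eq0 (negbTE v1) /= subr_eq0 => /eqP e.
have b1C : (b1 a)%:C != 0 by rewrite complex_inj0.
by rewrite rmorphM /= fmorphV -e mulrAC mulfV // mul1r.
Qed.

Lemma sig_val_1 : has_val w (sig a) 1 1.
Proof.
have e : 1 = (b1 a / bm a)%:C * (bm a / b1 a)%:C :> C.
  rewrite -rmorphM -[LHS](rmorph1 (real_complex R)); congr (_%:C).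
  have b10 : b1 a != 0 by rewrite gt_eqF // b1_gt0.
  have bm0 : bm a != 0 by rewrite lt_eqF // bm_lt0.
  by rewrite mulrA divfK // divff.
rewrite [X in has_val _ _ _ X]e.
apply: (has_val_M w0); [exact: has_val_cst | exact: lam_val_1].
Qed.

Lemma disc_root_val z v : has_val w (lam a) z v ->
  has_val w (D a) z (1 - z * ((b0 a)%:C + 2 * (b1 a)%:C * v)).
Proof.
move=> hv; apply: (has_val_B w0); first exact: has_val_1.
apply: (has_val_M w0); first exact: has_val_X.
apply: (has_val_D w0); first exact: has_val_cst.
apply: (has_val_M w0) hv; apply: (has_val_M w0); [exact: has_val_nat | exact: has_val_cst].
Qed.

Lemma disc_root_val_1 : has_val w (D a) 1 a%:C.
Proof.
have := disc_root_val lam_val_1; congr (has_val _ _ _ _).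
rewrite mul1r -[1](rmorph1 (real_complex R)) -(rmorph_nat (real_complex R)) -!rmorphM -rmorphD -rmorphB.
congr (_%:C).
have b10 : b1 a != 0 by rewrite gt_eqF // b1_gt0.
by rewrite -mulrA [b1 a * _]mulrC divfK // /b0 /bm; field.
Qed.

(* [sig = 1] at [X = 1], and [1 - X] and [1 - sig] vanish there to the same order. *)
Lemma tail_factor : exists2 e : fps C, has_val w e 1 1 &
  forall k, sig a ^+ k = (1 - fX) * e * sser a k%:Z.
Proof.
have c1w : cn (1 : C) < w by rewrite cn1.
have hD : has_val w (D a * (1 - sig a)) 1 0.
  have := has_val_M w0 disc_root_val_1 (has_val_B w0 (has_val_1 w 1) sig_val_1).
  by rewrite subrr mulr0.
have [g hg gE] := hD; exists (- g); last first.
  by move=> k; rewrite sig_sser // gE rmorph0 rmorph1; ring.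
have ig : inW w (- g) by exact: inW_N.
have [v hv] := has_val_exists w0 c1w ig.
suff v1 : v = 1 by rewrite v1 in hv.
pose eps := 1 - fX + fX * (B1 - Bm * sig a).
have heps : has_val w eps 1 a%:C.
  have -> : a%:C = 1 - 1 + 1 * ((b1 a)%:C - (bm a)%:C * 1) :> C.
    by rewrite subrr add0r mul1r mulr1 -rmorphB; congr (_%:C); rewrite /b1 /bm; field.
  apply: (has_val_D w0).
    apply: (has_val_B w0); [exact: has_val_1 | exact: has_val_X].
  apply: (has_val_M w0); first exact: has_val_X.
  apply: (has_val_B w0); first exact: has_val_cst.
  apply: (has_val_M w0); [exact: has_val_cst | exact: sig_val_1].
(* [D a] and [eps] both take the value [a] at [X = 1], so the quotient [- g] takes the value 1. *)
have e : D a = - g * eps.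
  apply: (fps_cancel oneX_neq0); rewrite {1}(oneX_sig a01) -/eps.
  transitivity (D a * (1 - sig a) * eps); first by ring.
  by rewrite gE rmorph0 rmorph1; ring.
have := has_val_M w0 hv heps; rewrite -e => /(has_val_uniq w0 c1w disc_root_val_1).
have aC : a%:C != 0 :> C by rewrite complex_inj0 gt_eqF //; case/andP: a01.
by move=> h; apply: (mulIf aC); rewrite mul1r.
Qed.

End DecayingRoot.

(** * The Lopatinskii determinant *)

Section Kappa.
Context {R : realType}.
Local Notation C := R[i].
Implicit Types (a w : R) (z v k : C).

Lemma cn_sqr v : cn v ^+ 2 = complex.Re v ^+ 2 + complex.Im v ^+ 2.
Proof. by case: v => x y; rewrite /cn /= sqr_sqrtr // addr_ge0 ?sqr_ge0. Qed.

(** If [|v| = rate a] then [bm a = - b1 a |v|^2] reduces the dispersion relation to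
    [1 = z (b0 + 2 i b1 Im v)], which forces [|z|^2 (1 - a^2) >= 1]. Strictness separates the moduli
    of the two roots and so identifies [kappa_l] and [kappa_r]. *)
Lemma lam_val_lt a w z v : 0 < a < 1 -> 1 < w -> w ^+ 2 * (1 - a ^+ 2) < 1 ->
  cn z < w -> has_val w (lam a) z v -> cn v < rate a.
Proof.
move=> a01 w1 wa zw hv.
have := lam_val_le a01 w1 wa zw hv; have := lam_val_root w1 zw hv.
rewrite le_eqVlt => rt /orP[/eqP vr|//]; exfalso.
have r0 := rate_gt0 a01.
have v0 : v != 0 by rewrite -cn_gt0 vr.
pose x := complex.Re v; pose y := complex.Im v.
have xy : x ^+ 2 + y ^+ 2 = rate a ^+ 2 by rewrite -vr cn_sqr.
have e1 : (b1 a)%:C * v ^+ 2 + (b0 a)%:C * v + (bm a)%:C = (b0 a +i* (2 * b1 a * y)) * v.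
  have bmE : bm a = - (b1 a * (x ^+ 2 + y ^+ 2)) by rewrite xy b1_rate // opprK.
  rewrite bmE /x /y; case: (v) => p q; apply/eqP; rewrite expr2 eq_complex /=.
  by apply/andP; split; apply/eqP; ring.
have e2 : 1 = z * (b0 a +i* (2 * b1 a * y)).
  by apply: (mulIf v0); rewrite mul1r {1}rt e1 mulrA.
have := congr1 (fun u => cn u ^+ 2) e2.
rewrite cn1 expr1n cnM exprMn (cn_sqr (_ +i* _)) /= => e3.
have z2 : cn z ^+ 2 <= w ^+ 2 by rewrite lerXn2r ?nnegrE ?cn_ge0 ?(ltW zw) //; lra.
have y2 : y ^+ 2 <= rate a ^+ 2 by rewrite -xy lerDr sqr_ge0.
have b2 : b0 a ^+ 2 + (2 * b1 a * y) ^+ 2 <= 1 - a ^+ 2.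
  have : b1 a ^+ 2 * y ^+ 2 <= b1 a ^+ 2 * rate a ^+ 2 by rewrite ler_wpM2l ?sqr_ge0.
  rewrite (_ : b1 a ^+ 2 * rate a ^+ 2 = - (b1 a * bm a)); last by rewrite expr2 -mulrA b1_rate // mulrN.
  rewrite b1bm /b0 => h; have : (2 * b1 a * y) ^+ 2 = 4 * (b1 a ^+ 2 * y ^+ 2) by ring.
  lra.
suff : cn z ^+ 2 * (b0 a ^+ 2 + (2 * b1 a * y) ^+ 2) <= w ^+ 2 * (1 - a ^+ 2) by rewrite -e3; lra.
by apply: ler_pM => //; rewrite ?addr_ge0 ?sqr_ge0.
Qed.

Local Open Scope classical_set_scope.

Lemma xget_max (p : C -> C) c v v' : c != 0 -> cn v' < cn v ->
  (forall k, p k = c * ((k - v) * (k - v'))) ->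
  xget 0 [set k | p k = 0 /\ forall k', p k' = 0 -> `|k'| <= `|k|] = v.
Proof.
move=> c0 vv pE.
have root k : p k = 0 -> k = v \/ k = v'.
  rewrite pE => /eqP; rewrite !mulf_eq0 (negbTE c0) /= !subr_eq0.
  by case/orP => /eqP; [left | right].
have pv : p v = 0 by rewrite pE subrr mul0r mulr0.
apply: xget_unique => /=.
  split=> // k' /root[->|->] //; by rewrite !cnE lecR ltW.
by move=> k [/root[->//|->] /(_ v pv)]; rewrite !cnE lecR leNgt vv.
Qed.

Lemma xget_min (p : C -> C) c v v' : c != 0 -> cn v < cn v' ->
  (forall k, p k = c * ((k - v) * (k - v'))) ->
  xget 0 [set k | p k = 0 /\ forall k', p k' = 0 -> `|k| <= `|k'|] = v.
Proof.
move=> c0 vv pE.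
have root k : p k = 0 -> k = v \/ k = v'.
  rewrite pE => /eqP; rewrite !mulf_eq0 (negbTE c0) /= !subr_eq0.
  by case/orP => /eqP; [left | right].
have pv : p v = 0 by rewrite pE subrr mul0r mulr0.
apply: xget_unique => /=.
  split=> // k' /root[->|->] //; by rewrite !cnE lecR ltW.
by move=> k [/root[->//|->] /(_ v pv)]; rewrite !cnE lecR leNgt vv.
Qed.

Section Fixed.
Variables (a w : R) (z v : C).
Hypotheses (a01 : 0 < a < 1) (w1 : 1 < w) (wa : w ^+ 2 * (1 - a ^+ 2) < 1).
Hypotheses (zw : cn z < w) (z0 : z != 0) (hv : has_val w (lam a) z v).

Lemma lam_val_neq0 : v != 0.
Proof.
apply/eqP => v0; have := lam_val_root w1 zw hv.
rewrite v0 expr0n /= !mulr0 !add0r => /esym/eqP.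
by rewrite mulf_eq0 (negbTE z0) complex_inj0 lt_eqF ?bm_lt0.
Qed.

Lemma dispersion_lam : z^-1 = (b1 a)%:C * v + (b0 a)%:C + (bm a)%:C / v.
Proof.
have v0 := lam_val_neq0; have rt := lam_val_root w1 zw hv.
apply: (mulfI z0); rewrite divff //; apply: (mulIf v0); rewrite mul1r {1}rt.
by field.
Qed.

Lemma cn_other : cn ((b1 a / bm a)%:C * v) < cn v^-1.
Proof.
have v0 := lam_val_neq0; have lt := lam_val_lt a01 w1 wa zw hv.
have cv : 0 < cn v by rewrite cn_gt0.
have bm0 := bm_lt0 a01; have b10 := b1_gt0 a01.
rewrite cnM cnV cn_real -[ltRHS]mul1r ltr_pdivlMr // -mulrA -expr2.
rewrite ltr0_norm; last by rewrite pmulr_rlt0 // invr_lt0.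
rewrite -mulrN -invrN mulrAC ltr_pdivrMr ?oppr_gt0 // mul1r -b1_rate //.
rewrite ltr_pM2l // ltr_pXn2r ?nnegrE ?(ltW cv) ?(ltW (rate_gt0 _)) //.
Qed.

Lemma kappa_l_lam : kappa_l a z^-1 = v^-1.
Proof.
have v0 := lam_val_neq0; have bm0 : (bm a)%:C != 0 :> C by rewrite complex_inj0 lt_eqF ?bm_lt0.
apply: (xget_max bm0 cn_other) => k; rewrite /dispersion dispersion_lam.
have -> : (a * (a - 1) / 2)%:C = (bm a)%:C :> C by congr (_%:C); rewrite /bm; field.
have -> : (a * (a + 1) / 2)%:C = (b1 a)%:C :> C by congr (_%:C); rewrite /b1; field.
have -> : (b1 a / bm a)%:C = (b1 a)%:C / (bm a)%:C :> C by rewrite [LHS]fmorph_div.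
rewrite (_ : 1 - a ^+ 2 = b0 a) //; field.
by rewrite v0 bm0.
Qed.

(** Changing [a] into [- a] exchanges the extreme coefficients of the quadratic, hence inverts its
    roots. *)
Lemma kappa_r_lam : kappa_r (- a) z^-1 = v.
Proof.
have v0 := lam_val_neq0; have b10 : (b1 a)%:C != 0 :> C by rewrite complex_inj0 gt_eqF ?b1_gt0.
have bm0 : (bm a)%:C != 0 :> C by rewrite complex_inj0 lt_eqF ?bm_lt0.
have lt : cn v < cn ((bm a / b1 a)%:C / v).
  have h := cn_other; have cv : 0 < cn v by rewrite cn_gt0.
  have e : cn ((bm a / b1 a)%:C / v) = cn v^-1 / cn (b1 a / bm a)%:C.
    rewrite cnM mulrC; congr (_ * _); rewrite -cnV; congr cn.
    by rewrite -(invf_div (b1 a)); exact: (fmorphV (real_complex R)).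
  rewrite e ltr_pdivlMr; first by rewrite mulrC -cnM.
  by rewrite cn_gt0 complex_inj0 mulf_neq0 ?invr_eq0 -?complex_inj0.
apply: (xget_min b10 lt) => k; rewrite /dispersion dispersion_lam.
have -> : (- a * (- a - 1) / 2)%:C = (b1 a)%:C :> C by congr (_%:C); rewrite /b1; field.
have -> : (- a * (- a + 1) / 2)%:C = (bm a)%:C :> C by congr (_%:C); rewrite /bm; field.
have -> : (bm a / b1 a)%:C = (bm a)%:C / (b1 a)%:C :> C by rewrite [LHS]fmorph_div.
rewrite sqrrN (_ : 1 - a ^+ 2 = b0 a) //; field.
by rewrite v0 b10.
Qed.

End Fixed.
End Kappa.

Section Boundary.
Context {R : realType}.
Local Notation C := R[i].
Implicit Types (a b m w : R) (z v k : C).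
Local Notation D := disc_root.

(* [bnd a m] is [- X a] times the first bracket of [Lopatinskii] at [z = 1/X], see [bnd_val];
   the second bracket is that of the mirror problem. *)
Definition bnd a m : fps C := 1 - fX * cst (1 - a * m) + D a.
Definition Phi a b m : fps C := bnd a m * bnd b (- m) - cst (a * b * (1 - m ^+ 2)) * fX ^+ 2.

Lemma Phi_sym a b m : Phi b a (- m) = Phi a b m.
Proof.
rewrite /Phi opprK sqrrN [b * a]mulrC.
by move: (bnd a m) (bnd b (- m)) => u v; rewrite [v * u]mulrC.
Qed.

Section Fixed.
Variables (a m w : R) (z v : C).
Hypotheses (a01 : 0 < a < 1) (w1 : 1 < w) (wa : w ^+ 2 * (1 - a ^+ 2) < 1).

Lemma bnd_val_1 : has_val w (bnd a m) 1 (a * (1 + m))%:C.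
Proof.
have w0 : 0 < w by exact: lt_trans w1.
have -> : (a * (1 + m))%:C = 1 - 1 * (1 - a * m)%:C + a%:C :> C.
  by rewrite mul1r -(rmorph1 (real_complex R)) -rmorphB -rmorphD; congr (_%:C); ring.
apply: (has_val_D w0); last exact: disc_root_val_1.
apply: (has_val_B w0); first exact: has_val_1.
by apply: (has_val_M w0); [exact: has_val_X | exact: has_val_cst].
Qed.

Lemma inW_bnd : inW w (bnd a m).
Proof. exact: (has_val_inW (lt_trans ltr01 w1) bnd_val_1). Qed.

Hypotheses (zw : cn z < w) (z0 : z != 0) (hv : has_val w (lam a) z v).

Lemma bnd_val : has_val w (bnd a m) z (- z * a%:C * ((1 - a)%:C / v + (a - m)%:C)).
Proof.
have w0 : 0 < w by exact: lt_trans w1.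
have := disc_root_val w1 hv => hD.
have -> : - z * a%:C * ((1 - a)%:C / v + (a - m)%:C) =
    1 - z * (1 - a * m)%:C + (1 - z * ((b0 a)%:C + 2 * (b1 a)%:C * v)).
  have v0 := lam_val_neq0 a01 w1 zw z0 hv.
  have := dispersion_lam a01 w1 zw z0 hv => e.
  have {}e : 1 = z * ((b1 a)%:C * v + (b0 a)%:C + (bm a)%:C / v) by rewrite -e divff.
  have -> : 1 - z * (1 - a * m)%:C + (1 - z * ((b0 a)%:C + 2 * (b1 a)%:C * v)) =
   2 * 1 - z * (1 - a * m)%:C - z * ((b0 a)%:C + 2 * (b1 a)%:C * v) by ring.
  rewrite {2}e /b0 /b1 /bm !(rmorphB, rmorphM, rmorphN, rmorphXn, rmorphD) /= !rmorph1 !fmorphV !rmorph_nat.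
  by field.
apply: (has_val_D w0) hD.
apply: (has_val_B w0); first exact: has_val_1.
by apply: (has_val_M w0); [exact: has_val_X | exact: has_val_cst].
Qed.

End Fixed.

Section Lop.
Variables (a b m w : R).
Hypotheses (a01 : 0 < a < 1) (b01 : 0 < b < 1) (w1 : 1 < w).
Hypotheses (wa : w ^+ 2 * (1 - a ^+ 2) < 1) (wb : w ^+ 2 * (1 - b ^+ 2) < 1).
Let w0 : 0 < w. Proof. exact: lt_trans w1. Qed.

Lemma Phi_val_1 : has_val w (Phi a b m) 1 0.
Proof.
have -> : 0 = (a * (1 + m))%:C * (b * (1 + - m))%:C - (a * b * (1 - m ^+ 2))%:C * 1 ^+ 2 :> C.
  by rewrite expr1n mulr1 -rmorphM -rmorphB -[LHS](rmorph0 (real_complex R)); congr (_%:C); ring.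
apply: (has_val_B w0); first by apply: (has_val_M w0); apply: bnd_val_1.
apply: (has_val_M w0); first exact: has_val_cst.
by apply: (has_val_exp w0); exact: has_val_X.
Qed.

Lemma Phi_val z : cn z < w -> z != 0 ->
  has_val w (Phi a b m) z (- (z ^+ 2 * (a * b)%:C * Lopatinskii a m (- b) z^-1)).
Proof.
move=> zw z0.
have [va hva] := has_val_exists w0 zw (inW_lam a01 w1 wa).
have [vb hvb] := has_val_exists w0 zw (inW_lam b01 w1 wb).
have va0 := lam_val_neq0 a01 w1 zw z0 hva.
have vb0 := lam_val_neq0 b01 w1 zw z0 hvb.
have -> : - (z ^+ 2 * (a * b)%:C * Lopatinskii a m (- b) z^-1) =
   (- z * a%:C * ((1 - a)%:C / va + (a - m)%:C)) * (- z * b%:C * ((1 - b)%:C / vb + (b - - m)%:C))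
   - (a * b * (1 - m ^+ 2))%:C * z ^+ 2.
  rewrite /Lopatinskii (kappa_l_lam a01 w1 wa zw z0 hva) (kappa_r_lam b01 w1 wb zw z0 hvb).
  rewrite !(rmorphB, rmorphM, rmorphN, rmorphXn, rmorphD) /= !rmorph1; field.
  by rewrite va0 vb0.
apply: (has_val_B w0).
  by apply: (has_val_M w0); apply: bnd_val.
apply: (has_val_M w0); first exact: has_val_cst.
by apply: (has_val_exp w0); exact: has_val_X.
Qed.

Lemma bnd_coef0 x y : fcoef (bnd x y) 0 = 2.
Proof. by rewrite /bnd /D fcoefD !fcoefB !fcoefXM fcoef1 /= !subr0 -natrD. Qed.

Lemma Phi_coef0 : fcoef (Phi a b m) 0 = 4.
Proof.
rewrite /Phi; move: (bnd a m) (bnd_coef0 a m) (bnd b (- m)) (bnd_coef0 b (- m)) => u u0 v v0.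
rewrite fcoefB fcoefM0 u0 v0 fcoefM0 (_ : fcoef (fX ^+ 2) 0 = 0); last by rewrite expr2 fcoefXM.
by rewrite mulr0 subr0 -natrM.
Qed.

End Lop.
End Boundary.

Lemma conj_prod (K : comNzRingType) (u y d e c : K) :
  ((u + d) * (y + e) - c) * (((u - d) * (y - e) - c) *
    (((u - d) * (y + e) - c) * ((u + d) * (y - e) - c))) =
  ((u ^+ 2 - d ^+ 2) * (y ^+ 2 - e ^+ 2) + c ^+ 2 - 2 * c * u * y) ^+ 2
    - 4 * c ^+ 2 * d ^+ 2 * e ^+ 2.
Proof. by ring. Qed.

Section Conjugates.
Context {R : realType}.
Local Notation C := R[i].
Implicit Types (a b m w : R) (z v k : C) (f g : fps C).
Local Notation D := disc_root.

Lemma fcoefM1 f g : fcoef (f * g) 1 = fcoef f 0 * fcoef g 1 + fcoef f 1 * fcoef g 0.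
Proof. by rewrite fcoefM !big_ord_recl big_ord0 addr0. Qed.
Lemma fcoefM2 f g : fcoef (f * g) 2 =
  fcoef f 0 * fcoef g 2 + (fcoef f 1 * fcoef g 1 + fcoef f 2 * fcoef g 0).
Proof. by rewrite fcoefM !big_ord_recl big_ord0 addr0. Qed.
Lemma fcoefM3 f g : fcoef (f * g) 3 = fcoef f 0 * fcoef g 3 +
  (fcoef f 1 * fcoef g 2 + (fcoef f 2 * fcoef g 1 + fcoef f 3 * fcoef g 0)).
Proof. by rewrite fcoefM !big_ord_recl big_ord0 addr0. Qed.

Definition bnd_conj a m : fps C := 1 - fX * cst (1 - a * m) - D a.

Lemma lam_coef0 a : fcoef (lam a) 0 = 0.
Proof. by rewrite lamE fcoefXM. Qed.
Lemma lam_coef1 a : fcoef (lam a) 1 = (bm a)%:C.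
Proof.
rewrite lamE fcoefXM !fcoefD !fcoefCM expr2 fcoefM0 lam_coef0 !(mulr0, mul0r) !add0r //.
Qed.
Lemma disc_coef a : [/\ fcoef (D a) 0 = 1, fcoef (D a) 1 = (- b0 a)%:C &
  fcoef (D a) 2 = (- (2 * b1 a * bm a))%:C].
Proof.
have e2 : 2 * cst (b1 a) * lam a = fconst (2 * b1 a)%:C * lam a.
  by rewrite rmorphM rmorphM /= rmorph_nat rmorph_nat.
rewrite /D; split; rewrite fcoefB fcoefXM fcoef1 ?subr0 // fcoefD e2 fcoefCM ?lam_coef0 ?lam_coef1.
  by rewrite mulr0 addr0 sub0r rmorphN.
have -> : (- (2 * b1 a * bm a))%:C = - ((2 * b1 a)%:C * (bm a)%:C) :> C.
  by rewrite -(rmorphM (real_complex R)) -(rmorphN (real_complex R)).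
by rewrite (_ : fcoef (cst (b0 a)) 1 = 0) // !add0r.
Qed.

Lemma bnd_conj_coef a m : [/\ fcoef (bnd_conj a m) 0 = 0,
  fcoef (bnd_conj a m) 1 = (a * (m - a))%:C &
  fcoef (bnd_conj a m) 2 = (- (a ^+ 2 * (1 - a ^+ 2) / 2))%:C].
Proof.
have [d0 d1 d2] := disc_coef a.
rewrite /bnd_conj; move: (D a) d0 d1 d2 => d d0 d1 d2; split; rewrite !fcoefB fcoefXM fcoef1 ?d0 ?d1 ?d2 /= ?subr0 ?subrr //.
  by rewrite [X in X - _]sub0r -rmorphN -rmorphB; congr (_%:C); rewrite /b0; ring.
rewrite sub0r -rmorphN; congr (_%:C); rewrite /b1 /bm; by field.
Qed.

Lemma fcoef_sqX (x : R) n : fcoef (cst x * fX ^+ 2) n = if n == 2%N then x%:C else 0.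
Proof.
rewrite fcoefCM expr2 fcoefXM; case: n => [|[|[|n]]] /=; rewrite ?mulr0 ?mulr1 //.
Qed.

Variables (a b m : R).
Hypotheses (a01 : 0 < a < 1) (b01 : 0 < b < 1).

Lemma Phi_neq0 : Phi a b m != 0.
Proof.
apply/eqP => /(congr1 (fun f => fcoef f 0)) /eqP.
by rewrite Phi_coef0 fcoef0 pnatr_eq0.
Qed.

(** The conjugates only have to be nonzero, so that their product with [Phi] is a nonzero
    polynomial. Here the coefficient of X vanishes only if [mm = x], and then that of X^2 does
    not. *)
Lemma conj1_neq0 (x y mm : R) : 0 < x < 1 -> 0 < y < 1 ->
  bnd_conj x mm * bnd y (- mm) - cst (x * y * (1 - mm ^+ 2)) * fX ^+ 2 != 0.
Proof.
move=> x01 y01; have [p0 p1 p2] := bnd_conj_coef x mm; have q0 := bnd_coef0 y (- mm).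
move: (bnd_conj x mm) (bnd y (- mm)) p0 p1 p2 q0 => p q p0 p1 p2 q0.
apply/eqP => e.
have [xm|xm] := eqVneq mm x; last first.
  have /eqP := congr1 (fun f => fcoef f 1) e.
  rewrite fcoefB fcoef_sqX fcoefM1 p0 p1 q0 mul0r add0r fcoef0 subr0.
  rewrite mulf_eq0 pnatr_eq0 orbF complex_inj0 mulf_eq0 subr_eq0 (negbTE xm) orbF.
  by rewrite gt_eqF //; case/andP: x01.
have /eqP := congr1 (fun f => fcoef f 2) e.
rewrite fcoefB fcoef_sqX fcoefM2 p0 p1 p2 q0 xm subrr mulr0 rmorph0 !mul0r !add0r fcoef0 /=.
rewrite -(rmorph_nat (real_complex R)) -rmorphM -rmorphB complex_inj0.
apply/negP; rewrite (_ : _ - _ = - (x * (1 - x ^+ 2) * (x + y))); last by field.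
move/andP: x01 => [x0 x1]; move/andP: y01 => [y0 y1].
rewrite oppr_eq0 gt_eqF // mulr_gt0 ?addr_gt0 // mulr_gt0 // subr_gt0 expr_lt1 // ltW //.
Qed.

(* The coefficient of [X^2] vanishes only if [m (a - b) = 1 - a b]; then that of [X^3] does not. *)
Lemma conj2_neq0 :
  bnd_conj a m * bnd_conj b (- m) - cst (a * b * (1 - m ^+ 2)) * fX ^+ 2 != 0.
Proof.
have [p0 p1 p2] := bnd_conj_coef a m; have [q0 q1 q2] := bnd_conj_coef b (- m).
move: (bnd_conj a m) (bnd_conj b (- m)) p0 p1 p2 q0 q1 q2 => p q p0 p1 p2 q0 q1 q2.
move/andP: a01 => [a0 a1]; move/andP: b01 => [b0 b1].
apply/eqP => e.
have := congr1 (fun f => fcoef f 2) e.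
rewrite fcoefB fcoef_sqX fcoefM2 p0 p1 q0 q1 mul0r add0r mulr0 addr0 fcoef0 /=.
rewrite -rmorphM -rmorphB => /eqP; rewrite complex_inj0 => /eqP e2.
have ab0 : a * b != 0 by rewrite mulf_neq0 // gt_eqF.
have {e2} e2 : m * (a - b) = 1 - a * b.
  by apply: (mulfI ab0); apply/eqP; rewrite -subr_eq0; apply/eqP; rewrite -[RHS]e2; ring.
have := congr1 (fun f => fcoef f 3) e.
rewrite fcoefB fcoef_sqX fcoefM3 p0 p1 p2 q0 q1 q2 mul0r add0r mulr0 addr0 fcoef0 /= subr0.
rewrite -!rmorphM -rmorphD => /eqP; rewrite complex_inj0 => /eqP e3.
have a2 : 0 < 1 - a ^+ 2 by rewrite subr_gt0 expr_lt1 // ltW.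
have b2 : 0 < 1 - b ^+ 2 by rewrite subr_gt0 expr_lt1 // ltW.
(* Once multiplied by [a - b] the cubic coefficient loses [m] through [e2]. It forces [a = b], and
   [e2] then reads [a b = 1], which is impossible. *)
have : a * b * (1 - a ^+ 2) * (1 - b ^+ 2) * (a - b) = 0.
  have i1 : (m - a) * (a - b) = 1 - a ^+ 2 by rewrite mulrBl e2; ring.
  have i2 : (m + b) * (a - b) = 1 - b ^+ 2 by rewrite mulrDl e2; ring.
  transitivity (2 * (a * (m - a) * - (b ^+ 2 * (1 - b ^+ 2) / 2)
     + - (a ^+ 2 * (1 - a ^+ 2) / 2) * (b * (- m - b))) * (a - b)); last by rewrite e3; ring.
  transitivity (a * b * (a * (1 - a ^+ 2) * ((m + b) * (a - b)) - b * (1 - b ^+ 2) * ((m - a) * (a - b)))).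
    by rewrite i1 i2; ring.
  by field.
have P0 : a * b * (1 - a ^+ 2) * (1 - b ^+ 2) != 0 by rewrite gt_eqF // !mulr_gt0.
move/eqP; rewrite mulf_eq0 (negbTE P0) subr_eq0 => /eqP ab.
by move: e2; rewrite ab subrr mulr0 => /esym/eqP; rewrite subr_eq0 => /eqP e4; have := mulr_gt0 b0 b0; nra.
Qed.

Lemma fpolyXn (p : {poly C}) n : fpoly (p ^+ n) = fpoly p ^+ n.
Proof.
elim: n => [|n IH]; last by rewrite !exprS fpolyM IH.
by rewrite !expr0 -polyC1 fpolyC rmorph1.
Qed.
Lemma fpoly_nat n : fpoly (n%:R : {poly C}) = n%:R.
Proof. by rewrite -polyC_natr fpolyC rmorph_nat. Qed.

Lemma fpoly_conj (u y d f c : {poly C}) (d' f' c' : fps C) :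
  fpoly d = d' -> fpoly f = f' -> fpoly c = c' ->
  fpoly (((u ^+ 2 - d) * (y ^+ 2 - f) + c ^+ 2 - 2 * c * u * y) ^+ 2 - 4 * c ^+ 2 * d * f) =
  ((fpoly u ^+ 2 - d') * (fpoly y ^+ 2 - f') + c' ^+ 2
     - 2 * c' * fpoly u * fpoly y) ^+ 2 - 4 * c' ^+ 2 * d' * f'.
Proof. by move=> <- <- <-; rewrite !(fpolyD, fpolyN, fpolyXn, fpolyM, fpoly_nat). Qed.

Lemma conj_poly : exists p : {poly C}, exists g : fps C,
  [/\ p != 0, Phi a b m * g = fpoly p &
      forall w, 1 < w -> w ^+ 2 * (1 - a ^+ 2) < 1 -> w ^+ 2 * (1 - b ^+ 2) < 1 -> inW w g].
Proof.
pose U x mm : {poly C} := 1 - 'X * (1 - x * mm)%:C%:P.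
pose Q x : {poly C} := (1 - 'X * (b0 x)%:C%:P) ^+ 2 - 4 * 'X ^+ 2 * (b1 x)%:C%:P * (bm x)%:C%:P.
pose c : {poly C} := (a * b * (1 - m ^+ 2))%:C%:P * 'X ^+ 2.
have f1 : fpoly (1 : {poly C}) = 1 by rewrite -polyC1 fpolyC rmorph1.
have UE x mm : fpoly (U x mm) = 1 - fX * cst (1 - x * mm).
  by rewrite /U fpolyD fpolyN fpolyM fpolyX fpolyC f1.
have QE x : fpoly (Q x) = D x ^+ 2.
  rewrite disc_rootE /Q !(fpolyD, fpolyN, fpolyXn, fpolyM, fpolyX, fpolyC, f1, fpoly_nat) /cst; ring.
have cE : fpoly c = cst (a * b * (1 - m ^+ 2)) * fX ^+ 2 by rewrite /c fpolyM fpolyC fpolyXn fpolyX.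
pose p := ((U a m ^+ 2 - Q a) * (U b (- m) ^+ 2 - Q b) + c ^+ 2 - 2 * c * U a m * U b (- m)) ^+ 2
  - 4 * c ^+ 2 * Q a * Q b.
pose cc := cst (a * b * (1 - m ^+ 2)) * fX ^+ 2.
pose g := (bnd_conj a m * bnd_conj b (- m) - cc) *
   ((bnd_conj a m * bnd b (- m) - cc) * (bnd a m * bnd_conj b (- m) - cc)).
have pg : Phi a b m * g = fpoly p.
  have e := conj_prod (fpoly (U a m)) (fpoly (U b (- m))) (D a) (D b) cc.
  have -> : fpoly p = ((fpoly (U a m) ^+ 2 - D a ^+ 2) * (fpoly (U b (- m)) ^+ 2 - D b ^+ 2)
     + cc ^+ 2 - 2 * cc * fpoly (U a m) * fpoly (U b (- m))) ^+ 2 - 4 * cc ^+ 2 * D a ^+ 2 * D b ^+ 2.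
    exact: (fpoly_conj (U a m) (U b (- m)) (QE a) (QE b) cE).
  by rewrite -e !UE.
exists p, g; split=> //.
  have : Phi a b m * g != 0.
    apply: fps_mul_neq0; first exact: Phi_neq0.
    apply: fps_mul_neq0; first exact: conj2_neq0.
    apply: fps_mul_neq0; first exact: conj1_neq0.
    have := @conj1_neq0 b a (- m) b01 a01.
    rewrite opprK sqrrN [b * a]mulrC /cc.
    by move: (bnd_conj b (- m)) (bnd a m) => u v; rewrite [u * v]mulrC.
  rewrite pg; apply: contra => /eqP ->; apply/eqP; apply: fpsP => n.
  by rewrite fcoef0 /= coef0.
move=> w w1 wa wb; have w0 : 0 <= w by lra.
have ia := inW_bnd m a01 w1 wa; have ib := inW_bnd (- m) b01 w1 wb.
have ic x mm : 0 < x < 1 -> w ^+ 2 * (1 - x ^+ 2) < 1 -> inW w (bnd_conj x mm).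
  move=> x01 wx; apply: (inW_B w0); last exact: inW_disc_root.
  apply: (inW_B w0); first exact: inW_1.
  by apply: (inW_M w0); [exact: inW_fX | exact: inW_cst].
have icc : inW w cc.
  by apply: (inW_M w0); [exact: inW_cst | apply: (inW_exp w0); exact: inW_fX].
by apply: (inW_M w0); [|apply: (inW_M w0)]; apply: (inW_B w0) => //; apply: (inW_M w0) => //; apply: ic.
Qed.

End Conjugates.

Section SimpleZero.
Context {R : realType}.
Local Notation C := R[i].
Local Open Scope classical_set_scope.

(** Used in contrapositive form: a nonzero derivative at 1 rules out a double zero of [Phi]
    there. *)
Lemma derive1_double_zero (f : C -> C) (c : R) (d K : R) : 0 < d ->
  (forall z : C, cn (z - 1) < d -> cn (f z) <= K * cn (z - 1) ^+ 2) ->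
  derive1 (f : C -> C^o) 1 = 0.
Proof.
move=> d0 h.
have f1 : f 1 = 0.
  apply/eqP; rewrite -cn_eq0 eq_le cn_ge0 andbT; have := h 1.
  by rewrite subrr cn0 expr0n mulr0 => /(_ d0).
apply/cvg_lim => //; apply/cvgr0Pnorm_lt => e e0.
have eR : e = (complex.Re e)%:C by case: e e0 => x y; rewrite ltcE /= => /andP[/eqP -> _].
pose e' := complex.Re e; have e'0 : 0 < e' by move: e0; rewrite eR ltcR.
have K1 : 0 < `|K| + 1 by have := normr_ge0 K; lra.
pose d' := Num.min d (e' / (`|K| + 1)).
have d'0 : 0 < d' by rewrite lt_min d0 divr_gt0.
have d'C : 0 < d'%:C :> C by rewrite ltcR.
near=> x.
have x0 : x != 0 by near: x; exact: nbhs_dnbhs_neq.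
have : `|x| < d'%:C by near: x; exact: dnbhs0_lt.
rewrite cnE ltcR lt_min => /andP[xd xe].
rewrite /= f1 subr0 /GRing.scale /= cnE eR ltcR cnM cnV.
have cx : 0 < cn x by rewrite cn_gt0.
have := h (x + 1); rewrite addrK => /(_ xd) hx.
rewrite mulrC ltr_pdivrMr //; apply: le_lt_trans hx _.
rewrite expr2 mulrA ltr_pM2r //.
apply: (@le_lt_trans _ _ ((`|K| + 1) * cn x)).
  by rewrite ler_pM2r //; have := ler_norm K; lra.
by rewrite mulrC -ltr_pdivlMr.
Unshelve. all: end_near.
Qed.

End SimpleZero.

Section Lopatinskii.
Context {R : realType}.
Local Notation C := R[i].
Implicit Types (a b m w : R) (z v k : C) (f g : fps C).
Local Open Scope classical_set_scope.

Lemma radius_exists a b : 0 < a < 1 -> 0 < b < 1 ->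
  exists w, [/\ 1 < w, w ^+ 2 * (1 - a ^+ 2) < 1 & w ^+ 2 * (1 - b ^+ 2) < 1].
Proof.
move=> /andP[a0 a1] /andP[b0 b1]; pose c := Num.min a b.
have c0 : 0 < c by rewrite lt_min a0.
have ca : c <= a by rewrite ge_min lexx.
have cb : c <= b by rewrite ge_min lexx orbT.
have c2 : 0 < c ^+ 2 by exact: exprn_gt0.
have c1 : c ^+ 2 < 1 by rewrite expr_lt1 ?ltW //; lra.
pose w := 1 + c ^+ 2 / 4.
have key x : c <= x -> w ^+ 2 * (1 - x ^+ 2) < 1.
  move=> cx; have cx2 : c ^+ 2 <= x ^+ 2 by rewrite lerXn2r ?nnegrE // ?(ltW c0) // (le_trans (ltW c0)).
  apply: (@le_lt_trans _ _ (w ^+ 2 * (1 - c ^+ 2))); first by rewrite ler_wpM2l ?sqr_ge0 //; lra.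
  rewrite /w; set t := c ^+ 2 in c1 c2 *.
  have : 0 < t * t by exact: mulr_gt0.
  nra.
by exists w; split; [rewrite /w; lra | exact: key | exact: key].
Qed.

(** [Psi] inverts the series [- h0], that is [Phi] divided by [1 - X], to which [wiener_inv_poly]
    applies. *)
Lemma Lopatinskii_inverse a b m : 0 < a < 1 -> 0 < b < 1 ->
  derive1 (Lopatinskii a m (- b) : C -> C^o) 1 != 0 ->
  (forall z : C, 1 <= `|z| -> z != 1 -> Lopatinskii a m (- b) z != 0) ->
  exists w Psi, [/\ 1 < w, w ^+ 2 * (1 - a ^+ 2) < 1, w ^+ 2 * (1 - b ^+ 2) < 1,
    inW w Psi & Phi a b m * Psi = 1 - fX].
Proof.
move=> a01 b01 dL nL; have [w [w1 wa wb]] := radius_exists a01 b01.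
have w0 : 0 < w by lra.
have [p [g [p0 pg ig]]] := conj_poly m a01 b01.
have c1w : cn (1 : C) < w by rewrite cn1.
have [h0 ih0 hE] := Phi_val_1 m a01 b01 w1 wa wb.
have abC : (a * b)%:C != 0 :> C.
  by move/andP: a01 => [? _]; move/andP: b01 => [? _]; rewrite complex_inj0 mulf_neq0 // gt_eqF.
have PhiE : Phi a b m = (1 - fX) * - h0 by rewrite hE rmorph0 rmorph1; ring.
(* A zero of [- h0] at 0 contradicts [Phi_coef0]; at another point of the disk different from 1 it
   makes [Lopatinskii] vanish at [1/z]; at 1 it makes [Lopatinskii] quadratically small near 1. *)
have fac z w' : cn z <= 1 -> 1 < w' -> ~ (exists2 h, inW w' h & - h0 = (fX - fconst z) * h).
  move=> z1 w'1 [h hh e].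
  pose w2 := Num.min w w'.
  have w21 : 1 < w2 by rewrite lt_min w1.
  have w2w : 0 <= w2 <= w by rewrite ge_min lexx andbT; lra.
  have w2w' : 0 <= w2 <= w' by rewrite ge_min lexx orbT andbT; lra.
  have le2 x : 0 < x < 1 -> w ^+ 2 * (1 - x ^+ 2) < 1 -> w2 ^+ 2 * (1 - x ^+ 2) < 1.
    move=> /andP[x0 x1] hx; apply: le_lt_trans hx; rewrite ler_wpM2r //.
      by rewrite subr_ge0 expr_le1 // ltW.
    by case/andP: w2w => ? ?; rewrite lerXn2r ?nnegrE // ltW.
  have wa2 := le2 a a01 wa; have wb2 := le2 b b01 wb.
  have ih : inW w2 h := inW_le w2w' hh.
  have w20 : 0 < w2 by lra.
  have zw2 : cn z < w2 by exact: le_lt_trans w21.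
  have Pz : has_val w2 (Phi a b m) z 0.
    exists ((1 - fX) * h); last by rewrite PhiE e rmorph0; ring.
    apply: (inW_M (ltW w20)) => //; apply: (inW_B (ltW w20)); [exact: inW_1 | exact: (inW_fX (ltW w20))].
  have [zz|zn0] := eqVneq z 0.
    move: PhiE; rewrite e zz rmorph0 subr0 => /(congr1 (fun f => fcoef f 0)).
    rewrite Phi_coef0 mulrCA fcoefXM => /eqP; by rewrite pnatr_eq0.
  have [zz|zn1] := eqVneq z 1; last first.
    have := has_val_uniq w20 zw2 Pz (Phi_val m a01 b01 w21 wa2 wb2 zw2 zn0).
    move/esym/eqP; rewrite oppr_eq0 !mulf_eq0 (negbTE zn0) (negbTE abC) /=.
    apply/negP; apply: nL; last by rewrite invr_eq1.
    rewrite normfV cnE -fmorphV -[1]/(1%:C) lecR invf_ge1 // cn_gt0 //.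
  move/eqP: dL; apply; have [K hK] := ih.
  (* Within [d] of 1, [x] is nonzero and [|1/x| < w2], so [Phi] can be evaluated at [1/x]. *)
  pose d := Num.min (1 / 2) (1 - w2^-1).
  have wi : 0 < w2^-1 < 1 by rewrite invr_gt0 w20 invf_lt1.
  have d0 : 0 < d by rewrite lt_min; apply/andP; split; clear -wi; lra.
  pose K' := 2 * K / (a * b).
  apply: (@derive1_double_zero R _ 0 d K' d0) => x xd.
  have {xd} [xd1 xd2] : cn (x - 1) < 1 / 2 /\ cn (x - 1) < 1 - w2^-1 by move: xd; rewrite lt_min => /andP[].
  have cx : 1 <= cn x + cn (x - 1).
    by rewrite -(@cn1 R) -[cn (x - 1)]cnN opprB -[X in cn X <= _](subrK x) addrC cnD.
  have x0 : x != 0 by rewrite -cn_gt0; clear -cx xd1; lra.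
  have cx0 : 0 < cn x by rewrite cn_gt0.
  have xw2 : cn x^-1 < w2.
    by rewrite cnV -[w2]invrK ltf_pV2 ?posrE ?invr_gt0 //; clear -cx xd2; lra.
  have xi0 : x^-1 != 0 by rewrite invr_eq0.
  have [v hv] := has_val_exists w20 xw2 ih.
  have P1 := Phi_val m a01 b01 w21 wa2 wb2 xw2 xi0.
  have P2 : has_val w2 (Phi a b m) x^-1 ((1 - x^-1) * ((x^-1 - 1) * v)).
    rewrite PhiE e zz; apply: (has_val_M w20).
      by apply: (has_val_B w20); [exact: has_val_1 | exact: has_val_X].
    apply: (has_val_M w20) hv; apply: (has_val_B w20); [exact: has_val_X | exact: has_val_const].
  have {P1 P2} := has_val_uniq w20 xw2 P1 P2; rewrite invrK => P.
  have vK : cn v <= 2 * K := has_val_le w20 xw2 hK hv.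
  have -> : Lopatinskii a m (- b) x = (x - 1) ^+ 2 * (v / (a * b)%:C).
    have -> : Lopatinskii a m (- b) x = - (- (x^-1 ^+ 2 * (a * b)%:C * Lopatinskii a m (- b) x)) * (x ^+ 2 / (a * b)%:C).
      by move: (a * b)%:C abC (Lopatinskii _ _ _ _) => AB AB0 L; field; rewrite AB0 x0.
    by rewrite P; move: (a * b)%:C abC => AB AB0; field; rewrite AB0 x0.
  have ab0 : 0 < a * b by move/andP: a01 => [? _]; move/andP: b01 => [? _]; exact: mulr_gt0.
  rewrite cnM cnX mulrC ler_wpM2r ?exprn_ge0 ?cn_ge0 // cnM cnV cn_real gtr0_norm //.
  by rewrite /K' ler_wpM2r // invr_ge0 ltW.
have ih0' : inW w (- h0) by exact: inW_N.
have ig' : inW w ((1 - fX) * g).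
  apply: (inW_M (ltW w0)); last exact: ig.
  by apply: (inW_B (ltW w0)); [exact: inW_1 | exact: (inW_fX (ltW w0))].
have e : - h0 * ((1 - fX) * g) = fpoly p by rewrite -pg PhiE; ring.
have [w' [Psi [w'1 w'w iP PE]]] := wiener_inv_poly w1 ih0' ig' e p0 fac.
have le2 x : 0 < x < 1 -> w ^+ 2 * (1 - x ^+ 2) < 1 -> w' ^+ 2 * (1 - x ^+ 2) < 1.
  move=> /andP[x0 x1] hx; apply: le_lt_trans hx; rewrite ler_wpM2r //.
    by rewrite subr_ge0 expr_le1 // ltW.
  by rewrite lerXn2r ?nnegrE // ?(ltW w0) //; lra.
exists w', Psi; split; rewrite ?le2 //.
by rewrite PhiE -mulrA PE mulr1.
Qed.

End Lopatinskii.

(** * The scheme with a shock *)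

Section ThreePointScheme.
Context {R : realType}.
Local Notation C := R[i].
Implicit Types (a b m : R) (h u : int -> C) (j : int) (n k : nat).

(** Here [b] is the opposite of the Courant number on the right. The reflection [j -> 1 - j] maps
    [(a, b, m)] to [(b, a, - m)], and [coef_hi] is defined through it so that the mirror symmetry of
    the scheme is immediate. *)
Definition coef_lo a b m j : R :=
  if j <= 0 then b1 a else if j == 1 then a * (1 + m) / 2 else bm b.
Definition coef_hi a b m j : R := coef_lo b a (- m) (1 - j).
Definition coef_mid a b m j : R :=
  if j <= -1 then b0 a else if j == 0 then 1 - a * (a + m) / 2
  else if j == 1 then 1 - b * (b - m) / 2 else b0 b.

Definition scheme a b m u j : C :=
  (coef_lo a b m j)%:C * u (j - 1) + (coef_mid a b m j)%:C * u j
    + (coef_hi a b m j)%:C * u (j + 1).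

Lemma coef_left a b m j : j <= -1 ->
  [/\ coef_lo a b m j = b1 a, coef_mid a b m j = b0 a & coef_hi a b m j = bm a].
Proof.
by move=> hj; rewrite /coef_hi /coef_mid /coef_lo; split;
  repeat (case: ifP => ? //; try (exfalso; lia)).
Qed.
Lemma coef_right a b m j : 2 <= j ->
  [/\ coef_lo a b m j = bm b, coef_mid a b m j = b0 b & coef_hi a b m j = b1 b].
Proof.
by move=> hj; rewrite /coef_hi /coef_mid /coef_lo; split;
  repeat (case: ifP => ? //; try (exfalso; lia)).
Qed.

Lemma lax_wendroff_scheme a b m u j : lax_wendroff a m (- b) u j = scheme a b m u j.
Proof.
have two : 2 = (2 : R)%:C :> C by rewrite rmorph_nat.
have rc := (rmorphB (real_complex R), rmorphM (real_complex R), rmorphN (real_complex R),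
  rmorphXn (real_complex R), rmorphD (real_complex R), rmorph1 (real_complex R), fmorphV (real_complex R)).
rewrite /lax_wendroff /scheme.
have [j2|j2] := boolP (2 <= j).
  have [-> -> ->] := coef_right a b m j2.
  by rewrite /b0 /b1 /bm !rc; field.
have [jm|jm] := boolP (j <= -1).
  have [-> -> ->] := coef_left a b m jm.
  by rewrite /b0 /b1 /bm !rc; field.
rewrite /coef_hi /coef_mid /coef_lo.
have [->|j0] := eqVneq j 0.
  by rewrite /= sub0r add0r /b1 !rc; field.
have -> : j = 1 by lia.
rewrite /= subrr /b1 (_ : 1 + 1 = 2 :> int) //.
by rewrite !rc; field.
Qed.

Lemma coef_mid_mirror a b m j : coef_mid b a (- m) (1 - j) = coef_mid a b m j.
Proof.
rewrite /coef_mid; have [jm|jm] := boolP (j <= -1).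
  by rewrite !ifF //; lia.
have [->|j0] := eqVneq j 0; first by rewrite /= opprK.
have [->|j1] := eqVneq j 1; first by rewrite /=.
by rewrite ifT //; lia.
Qed.

Lemma scheme_mirror a b m u j :
  scheme a b m u j = scheme b a (- m) (fun i => u (1 - i)) (1 - j).
Proof.
rewrite /scheme /coef_hi opprK (_ : 1 - (1 - j) = j); last lia.
rewrite (_ : 1 - (1 - j - 1) = j + 1); last lia.
rewrite (_ : 1 - (1 - j + 1) = j - 1); last lia.
rewrite coef_mid_mirror; ring.
Qed.

Lemma iter_scheme_mirror a b m u n j :
  iter n (scheme a b m) u j = iter n (scheme b a (- m)) (fun i => u (1 - i)) (1 - j).
Proof.
elim: n j => [|n IH] j; first by rewrite /= (_ : 1 - (1 - j) = j) //; lia.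
rewrite !iterS scheme_mirror; rewrite /scheme !IH.
by rewrite !(_ : forall i : int, 1 - (1 - i) = i) //; lia.
Qed.

Lemma iter_scheme_local a b m u v n j :
  (forall i, (`|i - j| <= n)%N -> u i = v i) ->
  iter n (scheme a b m) u j = iter n (scheme a b m) v j.
Proof.
elim: n j => [|n IH] j h; first by apply: h; lia.
by rewrite !iterS /scheme !IH // => i hi; apply: h; lia.
Qed.

Lemma iter_scheme_coef a b m (U : int -> fps C) (d : int -> C) :
  (forall j, U j = fconst (d j) + fX * (cst (coef_lo a b m j) * U (j - 1)
     + cst (coef_mid a b m j) * U j + cst (coef_hi a b m j) * U (j + 1))) ->
  forall n j, fcoef (U j) n = iter n (scheme a b m) d j.
Proof.
move=> hU; elim=> [|n IH] j; rewrite hU fcoefD fcoefXM; first by rewrite addr0.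
by rewrite !fcoefD !fcoefCM !IH iterS [X in X + _](_ : _ = 0) // add0r.
Qed.

(* Solution for a unit mass at [- k]: the free left evolution corrected by the decaying modes
   on either side, whose amplitudes are forced by the two equations at [j = 0] and [j = 1]. *)
Definition source a b m (T : fps C) k j : fps C :=
  if j <= 0 then gser a (j + k%:Z) + (2 * bnd b (- m) * T - gser a k%:Z) * lam a ^+ `|j|%N
  else 2 * cst (a * (1 + m)) * fX * T * lam b ^+ `|j - 1|%N.

(** Eliminating the two amplitudes leaves the single scalar equation
    [Phi a b m * T = sig a ^+ k]. *)
Lemma source_rec a b m T k : 0 < a < 1 -> Phi a b m * T = sig a ^+ k ->
  forall j, source a b m T k j = fconst (j == - k%:Z)%:R +
   fX * (cst (coef_lo a b m j) * source a b m T k (j - 1)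
     + cst (coef_mid a b m j) * source a b m T k j
     + cst (coef_hi a b m j) * source a b m T k (j + 1)).
Proof.
move=> a01 PT j.
have gE p : gser a p = fconst (p == 0)%:R + fX * (cst (b1 a) * gser a (p - 1)
    + cst (b0 a) * gser a p + cst (bm a) * gser a (p + 1)).
  by rewrite {1}gserE rmorph_nat.
have sL i : source a b m T k (- i%:Z) =
   gser a (k%:Z - i%:Z) + (2 * bnd b (- m) * T - gser a k%:Z) * lam a ^+ i.
  by rewrite /source ifT; [rewrite abszN absz_nat (addrC (- i%:Z)) | lia].
have sR i : source a b m T k (1 + i%:Z) = 2 * cst (a * (1 + m)) * fX * T * lam b ^+ i.
  rewrite /source (_ : absz ((1 : int) + i%:Z - 1)%R = i); last lia.
  by have -> : (1 + i%:Z <= 0) = false by lia.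
have lE (x : R) := lamE x.
have [jm|jm] := boolP (j <= -1).
  have [i ji] : exists i, j = - i.+1%:Z by exists (`|j|%N.-1); lia.
  have -> : j - 1 = - i.+2%:Z by lia.
  have -> : j + 1 = - i%:Z by lia.
  have [-> -> ->] := coef_left a b m jm.
  rewrite ji !sL [X in X + _ = _]gE.
  have -> : k%:Z - i.+1%:Z - 1 = k%:Z - i.+2%:Z by lia.
  have -> : k%:Z - i.+1%:Z + 1 = k%:Z - i%:Z by lia.
  have -> : (k%:Z - i.+1%:Z == 0) = (- i.+1%:Z == - k%:Z) by lia.
  have e : lam a ^+ i.+1 = fX * (cst (b1 a) * lam a ^+ i.+2 + cst (b0 a) * lam a ^+ i.+1
      + cst (bm a) * lam a ^+ i).
    by rewrite exprS {1}lE !exprS expr0; ring.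
  move: (2 * bnd b (- m) * T - gser a k%:Z) => A.
  rewrite {1}e; ring.
have [j2|j2] := boolP (2 <= j).
  have [i ji] : exists i, j = 1 + i.+1%:Z by exists (`|j|%N.-2); lia.
  have -> : j - 1 = 1 + i%:Z by lia.
  have -> : j + 1 = 1 + i.+2%:Z by lia.
  have [-> -> ->] := coef_right a b m j2.
  rewrite ji !sR.
  have -> : (1 + i.+1%:Z == - k%:Z) = false by lia.
  have e : lam b ^+ i.+1 = fX * (cst (b1 b) * lam b ^+ i.+2 + cst (b0 b) * lam b ^+ i.+1
      + cst (bm b) * lam b ^+ i).
    by rewrite exprS {1}lE !exprS expr0; ring.
  rewrite rmorph0 add0r; move: (2 * cst (a * (1 + m)) * fX * T) => A.
  rewrite {1}e; ring.
(* The equation at [j = 0] is the one that uses the relation satisfied by [T]; the coefficients of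
   the scheme there contribute the factor 1/2. *)
have [j0|j0] := eqVneq j 0.
  have := sL 0%N; have := sL 1%N; have := sR 0%N; rewrite j0 oppr0 addr0 subr0 sub0r add0r (_ : k%:Z - 1%:Z = k%:Z - 1) //.
  rewrite expr1 [X in (_ = X) -> _]mulr1 => -> ->; rewrite [X in (_ = _ + X) -> _]mulr1 => ->.
  rewrite /coef_lo /coef_mid /coef_hi /coef_lo /=.
  have -> : (0 == - k%:Z) = (k%:Z == 0) by lia.
  have := gE k%:Z; rewrite (_ : k%:Z + 1 = k.+1%:Z); last lia.
  rewrite gser_succ //; have := bm_sig a01; have := gser_sig a01 k; rewrite -PT.
  rewrite /Phi {1}/bnd /disc_root.
  have -> : cst (1 - a * (a + m) / 2) = (1 + cst (b0 a) + cst (1 - a * m) - 1) * cst (1 / 2) by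
    rewrite -cst1 -!cstN -!cstD -cstM; congr cst; rewrite /b0; field.
  have -> : cst (b * (1 - m) / 2) = cst (b * (1 - m)) * cst (1 / 2) by rewrite -cstM; congr cst; field.
  have -> : cst (a * b * (1 - m ^+ 2)) = cst (a * (1 + m)) * cst (b * (1 - m)).
    by rewrite -cstM; congr cst; ring.
  have h2 : 2 * cst (1 / 2 : R) = 1 by rewrite -cst_nat -cstM -cst1; congr cst; field.
  move: (cst (b1 a)) (cst (b0 a)) (cst (bm a)) (cst (1 - a * m)) (cst (1 / 2)) h2.
  move: (cst (a * (1 + m))) (cst (b * (1 - m))) (lam a) (sig a) (gser a (k%:Z - 1)) (gser a k%:Z).
  move: (bnd b (- m)) (fconst _) => q d am bm' l s g1 g0 B1 B0 Bm u hf h2 e1 e2 e3.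
  apply/eqP; rewrite -subr_eq0; apply/eqP.
  have {}e3 : d = g0 - fX * (B1 * g1 + B0 * g0 + Bm * (s * g0)) by rewrite {1}e3; ring.
  rewrite e3.
  have e4 : Bm * (s * g0) = B1 * l * g0 by rewrite mulrA e2.
  rewrite e4.
  have e5 : (1 - fX * (B0 + 2 * B1 * l)) * g0 =
    2 * hf * ((1 - fX * u + (1 - fX * (B0 + 2 * B1 * l))) * q * T - am * bm' * fX ^+ 2 * T).
    by rewrite h2 e1; ring.
  transitivity (2 * hf * ((1 - fX * u + (1 - fX * (B0 + 2 * B1 * l))) * q * T - am * bm' * fX ^+ 2 * T)
     - (1 - fX * (B0 + 2 * B1 * l)) * g0 + (1 - 2 * hf) * (2 * q * T * (1 - fX * B1 * l))); first by ring.
  by rewrite e5 h2; ring.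
(* At [j = 1] the equation holds whatever [T] is: it is what fixes the amplitude of the mode on the
   right in terms of [T]. *)
have {j0 jm j2} j1 : j = 1 by lia.
have := sL 0%N; have := sR 0%N; have := sR 1%N; rewrite j1 oppr0 addr0 subr0 subrr.
rewrite expr1 => ->; rewrite [X in (_ = X) -> _]mulr1 => ->; rewrite [X in (_ = _ + X) -> _]mulr1 => ->.
rewrite /coef_lo /coef_mid /coef_hi /coef_lo /= addrCA subrr addr0.
have -> : (1 == - k%:Z) = false by lia.
rewrite rmorph0 add0r {1}/bnd /disc_root.
have -> : cst (1 - b * (b - m) / 2) = (1 + cst (b0 b) + cst (1 - b * - m) - 1) * cst (1 / 2) by
  rewrite -cst1 -!cstN -!cstD -cstM; congr cst; rewrite /b0; field.
have -> : cst (a * (1 + m) / 2) = cst (a * (1 + m)) * cst (1 / 2) by rewrite -cstM; congr cst; field.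
have h2 : 2 * cst (1 / 2 : R) = 1 by rewrite -cst_nat -cstM -cst1; congr cst; field.
move: (cst (b1 b)) (cst (b0 b)) (cst (1 - b * - m)) (cst (1 / 2)) h2.
move: (cst (a * (1 + m))) (lam b) => am l B1 B0 u hf h2.
apply/eqP; rewrite -subr_eq0; apply/eqP.
transitivity ((1 - 2 * hf) * (2 * am * fX * T * (1 - fX * B1 * l))); first by ring.
by rewrite h2 subrr mul0r.
Qed.

End ThreePointScheme.

(** * Weighted estimates *)

Section PowerWeight.
Context {R : realType}.
Implicit Types (g w : R) (n k i : nat).

(** The shift by 1 keeps the weight positive, avoids the value of powers at 0, and makes it
    submultiplicative ([pw_sub]). *)
Definition pw g n : R := n.+1%:R `^ g.

Lemma pw_gt0 g n : 0 < pw g n.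
Proof. by rewrite powR_gt0 // ltr0n. Qed.

Lemma pw_le g n k : 0 <= g -> (n <= k)%N -> pw g n <= pw g k.
Proof. by move=> g0 nk; apply: ge0_ler_powR => //; rewrite ?nnegrE ?ler_nat. Qed.

Lemma pw_ge1 g n : 0 <= g -> 1 <= pw g n.
Proof. by move=> g0; have := pw_le g0 (leq0n n); rewrite {1}/pw powR1. Qed.

Lemma pwD g g' n : pw (g + g') n = pw g n * pw g' n.
Proof. by rewrite /pw powRD // pnatr_eq0 implybT. Qed.

Lemma pw_le_exp g n (M : nat) : g <= M%:R -> pw g n <= n.+1%:R ^+ M.
Proof. by move=> gM; rewrite -powR_mulrn // ler_powR // ler1n. Qed.

Lemma pw_scale g n k c : 0 <= g -> (n.+1 <= c * k.+1)%N -> pw g n <= c%:R `^ g * pw g k.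
Proof.
move=> g0 h; rewrite /pw -powRM //; apply: ge0_ler_powR => //; rewrite ?nnegrE ?mulr_ge0 //.
by rewrite -natrM ler_nat.
Qed.

Lemma pw_sub g n i : 0 <= g -> (i <= n)%N -> pw g n <= pw g i * pw g (n - i).
Proof.
move=> g0 h; rewrite /pw -powRM //; apply: ge0_ler_powR => //; rewrite ?nnegrE ?mulr_ge0 //.
by rewrite -natrM ler_nat; nia.
Qed.

Lemma nat_bound (x : R) : exists M : nat, x <= M%:R.
Proof.
have h := archi_boundP (normr_ge0 x).
by exists (Num.bound `|x|); exact: le_trans (ler_norm x) (ltW h).
Qed.

Lemma pw_le_geom g w : 1 < w -> exists2 C : R, 0 < C & forall i, pw g i <= C * w ^+ i.
Proof.
move=> w1; have [M gM] := nat_bound g; have w0 : 0 < w by lra.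
have [C C0 hC] : exists2 C : R, 0 < C & forall n, n.+1%:R ^+ M * w^-1 ^+ n <= C.
  by apply: geom_poly; rewrite invr_ge0 (ltW w0) invf_lt1.
exists C => // i; apply: le_trans (pw_le_exp i gM) _.
by have := hC i; rewrite exprVn ler_pdivrMr // exprn_gt0.
Qed.

Lemma pw_geom_sum g q : 0 <= q < 1 -> exists2 C : R, 0 < C &
  forall N, \sum_(i < N) pw g i * q ^+ i <= C.
Proof.
move=> /andP[q0 q1]; pose r := (1 + q) / 2.
have r1 : r < 1 by rewrite /r; lra.
have r0 : 0 < r by rewrite /r; lra.
have [C C0 hC] := @pw_le_geom g r^-1 ltac:(by rewrite invf_gt1).
exists (C * (1 - r^-1 * q)^-1).
  by rewrite mulr_gt0 // invr_gt0 subr_gt0 mulrC ltr_pdivrMr // /r; lra.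
have rq : r^-1 * q < 1 by rewrite mulrC ltr_pdivrMr // /r; lra.
have rq0 : 0 <= r^-1 * q by rewrite mulr_ge0 // invr_ge0 ltW.
move=> N; apply: (@le_trans _ _ (\sum_(i < N) C * (r^-1 * q) ^+ i)).
  apply: ler_sum => i _; rewrite exprMn mulrA ler_wpM2r ?exprn_ge0 //; exact: hC.
by rewrite -mulr_sumr ler_pM2l // geom_le.
Qed.

(* Either the source is at distance a fraction of [n] and its weight pays for the decay, or [x]
   is small to any order. *)
Lemma far_weight (x : nat -> int -> R) (B g : R) (K : nat) : 0 <= g -> 0 < B -> (0 < K)%N ->
  (forall n j, `|x n j| <= B) ->
  (forall k, exists2 C : R, 0 < C &
     forall n j, K%:Z * j <= n%:Z -> `|x n j| <= C / n.+1%:R ^+ k) ->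
  exists2 C : R, 0 < C & forall n k j, j <= k%:Z -> `|x n j| <= C * pw g k / pw g n.
Proof.
move=> g0 B0 K0 hB hfar; have [M gM] := nat_bound g; have [C C0 hC] := hfar M.
have KB : 0 < B * (K.+1)%:R `^ g by rewrite mulr_gt0 // powR_gt0 // ltr0n.
exists (C + B * (K.+1)%:R `^ g); first exact: addr_gt0.
move=> n k j jk; have P0 := pw_gt0 g n; have Q0 := pw_gt0 g k; have Q1 := pw_ge1 k g0.
rewrite ler_pdivlMr //.
have [Kn|nK] := leqP (K * k)%N n.
  have Kj : K%:Z * j <= n%:Z by clear -Kn jk; nia.
  apply: (@le_trans _ _ C).
    have := hC n j Kj; rewrite ler_pdivlMr ?exprn_gt0 ?ltr0n //; apply: le_trans.
    by rewrite ler_wpM2l // pw_le_exp.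
  rewrite mulrDl; apply: (@le_trans _ _ (C * pw g k)); first by rewrite ler_peMr // ltW.
  by rewrite lerDl mulr_ge0 // ltW.
apply: (@le_trans _ _ (B * ((K.+1)%:R `^ g * pw g k))).
  by apply: ler_pM => //; [exact: ltW | apply: pw_scale => //; clear -nK; nia].
by rewrite mulrA ler_pM2r // lerDr ltW.
Qed.

Lemma green_weight a g : 0 < a < 1 -> 0 <= g -> exists2 C : R, 0 < C &
  forall n k j, j <= k%:Z -> `|green a n j| <= C * pw g k / pw g n.
Proof.
move=> a01 g0; have [K K0 hK] := green_far a01.
by apply: (far_weight g0 ltr01 K0) hK => n j; exact: green_le1.
Qed.

Lemma tailsum_weight a g : 0 < a < 1 -> 0 <= g -> exists2 C : R, 0 < C &
  forall n k, `|1 - tailsum a n k%:Z| <= C * pw g k / pw g n.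
Proof.
move=> a01 g0; have [K K0 hK] := tailsum_far a01; have [B B0 hB] := tailsum_bounded a01.
have [C C0 hC] : exists2 C : R, 0 < C & forall n k j, j <= k%:Z ->
    `|1 - tailsum a n j| <= C * pw g k / pw g n.
  apply: (@far_weight (fun n j => 1 - tailsum a n j) (1 + B) g K) => //; first lra.
  by move=> n j; apply: le_trans (ler_normB _ _) _; rewrite normr1 lerD2l.
by exists C => // n k; exact: hC.
Qed.

End PowerWeight.

Section Convolution.
Context {R : realType}.
Local Notation C := R[i].
Implicit Types (a b m w g A s : R) (n k i l : nat) (f c P : fps C).

(** [pw g (n - i)] is at least [pw g n / pw g i], and the geometric decay of [f] pays for [pw g i].
    The constant [s] carries the residual mass of a datum cut to a window. *)
Lemma conv_weight w g : 1 < w -> 0 <= g -> exists2 M : R, 0 < M &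
  forall K f c A s, wn w K f -> 0 <= A -> 0 <= s ->
    (forall n, cn (fcoef c n) <= A / pw g n + s) ->
    forall n, cn (fcoef (f * c) n) <= M * K * (A / pw g n + s).
Proof.
move=> w1 g0; have [M M0 hM] := pw_le_geom g w1.
exists (M + 1); first lra.
move=> K f c A s hf A0 s0 hc n; rewrite fcoefM.
apply: le_trans (cn_sum _ _ _) _.
have P0 := pw_gt0 g n; have An : 0 <= A / pw g n + s by rewrite addr_ge0 // divr_ge0 // ltW.
apply: (@le_trans _ _ (\sum_(i < n.+1) cn (fcoef f i) * w ^+ i * ((M + 1) * (A / pw g n + s)))).
  apply: ler_sum => i _; rewrite cnM -mulrA ler_wpM2l ?cn_ge0 //.
  apply: le_trans (hc _) _; have wi : 1 <= w ^+ i by rewrite exprn_ege1 // ltW.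
  have i_n : (i <= n)%N by rewrite -ltnS.
  have Q0 := pw_gt0 g (n - i).
  have h1 : A / pw g (n - i) <= M * w ^+ i * (A / pw g n).
    have one : 1 <= M * w ^+ i * pw g (n - i) / pw g n.
      rewrite ler_pdivlMr // mul1r; apply: le_trans (pw_sub g0 i_n) _.
      by rewrite ler_wpM2r ?(ltW Q0).
    rewrite ler_pdivrMr // (_ : _ * pw g (n - i) = A * (M * w ^+ i * pw g (n - i) / pw g n)); last by ring.
    by rewrite ler_peMr.
  have h2 : s <= w ^+ i * s by rewrite ler_peMl.
  have W0 := le_trans ler01 wi.
  have h3 : 0 <= M * w ^+ i * s by rewrite !mulr_ge0 // ltW.
  have h4 : 0 <= w ^+ i * (A / pw g n) by rewrite mulr_ge0 // divr_ge0 // ltW.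
  move: (A / pw g n) h1 h4 => B; move: (w ^+ i) h2 h3 => W h2 h3 B1 h4; lra.
rewrite -mulr_suml [leRHS](_ : _ = K * ((M + 1) * (A / pw g n + s))); last by ring.
rewrite ler_wpM2r //.
by rewrite mulr_ge0 //; lra.
Qed.

(** Writing [P = v + (X - 1) P'] moves the factor [X - 1] onto [sser], whose coefficients become
    time increments of tail sums; these are small because the tail sums stay close to 1 by
    [tailsum_weight]. *)
Lemma tail_value w a g P v : 1 < w -> 0 < a < 1 -> 0 <= g -> has_val w P 1 v ->
  exists2 M : R, 0 < M &
  forall n k, cn (fcoef (P * sser a k%:Z) n - v) <= M * pw g k / pw g n.
Proof.
move=> w1 a01 g0 [P' [K hP'] PE].
have [M1 M10 hT] := tailsum_weight a01 g0.
have [M2 M20 hC] := conv_weight w1 g0.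
have K0 := wn_ge0 hP'.
pose M3 := 1 + M1 + M1 * 2 `^ g.
have M30 : 0 < M3 by rewrite /M3; have := powR_ge0 (2 : R) g; nra.
exists (cn v * M1 + M2 * K * M3 + 1); first by rewrite ltr_wpDl // addr_ge0 ?mulr_ge0 ?cn_ge0 // ltW.
move=> n k; have Q0 := pw_gt0 g k; have Q1 := pw_ge1 k g0.
pose d := (fX - 1) * sser a k%:Z.
have hd i : cn (fcoef d i) <= M3 * pw g k / pw g i + 0.
  rewrite addr0 /d mulrBl mul1r fcoefB fcoefXM; have Pi := pw_gt0 g i.
  rewrite ler_pdivlMr //; case: i Pi => [|i] Pi /=.
    rewrite sub0r cnN cn_real /pw powR1 mulr1 -/(pw g k).
    have := hT 0%N k; rewrite /pw powR1 divr1 -/(pw g k) => h.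
    have : `|tailsum a 0 k| <= 1 + M1 * pw g k.
      rewrite -[tailsum a 0 k](subKr 1); apply: le_trans (ler_normB _ _) _.
      by rewrite normr1 lerD2l.
    move=> h2; apply: le_trans h2 _; rewrite /M3 !mulrDl mul1r.
    have : 0 <= M1 * 2 `^ g * pw g k by rewrite !mulr_ge0 ?powR_ge0 // ltW.
    lra.
  rewrite -rmorphB cn_real.
  have -> : tailsum a i k - tailsum a i.+1 k = (1 - tailsum a i.+1 k) - (1 - tailsum a i k) by ring.
  have h1 := hT i.+1 k; have h2 := hT i k.
  rewrite ler_pdivlMr // in h1; rewrite ler_pdivlMr ?pw_gt0 // in h2.
  have sc : pw g i.+1 <= 2 `^ g * pw g i by apply: pw_scale => //; clear; lia.
  apply: (@le_trans _ _ (`|1 - tailsum a i.+1 k| * pw g i.+1 + `|1 - tailsum a i k| * pw g i.+1)).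
    by rewrite -mulrDl ler_wpM2r ?(ltW Pi) // ler_normB.
  have h3 : `|1 - tailsum a i k| * pw g i.+1 <= 2 `^ g * (M1 * pw g k).
    apply: (@le_trans _ _ (2 `^ g * (`|1 - tailsum a i k| * pw g i))).
      by rewrite mulrCA ler_wpM2l.
    by rewrite ler_wpM2l // powR_ge0.
  rewrite /M3 !mulrDl mul1r; lra.
have := hC K P' d _ 0 hP' _ (lexx 0) hd n; rewrite mulr_ge0 ?(ltW M30) ?(ltW Q0) // => /(_ isT).
rewrite addr0 => h.
have -> : P * sser a k%:Z = fconst v * sser a k%:Z + P' * d by rewrite PE /d rmorph1; ring.
rewrite fcoefD fcoefCM addrAC -{2}[v]mulr1 -mulrBr /=.
apply: le_trans (cnD _ _) _; rewrite cnM.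
have -> : (tailsum a n k)%:C - 1 = - (1 - tailsum a n k)%:C by rewrite rmorphB rmorph1 opprB.
rewrite cnN cn_real; have hn := hT n k; have Pn := pw_gt0 g n.
have : cn v * `|1 - tailsum a n k| <= cn v * (M1 * pw g k / pw g n) by rewrite ler_wpM2l ?cn_ge0.
have : 0 <= pw g k / pw g n by rewrite divr_ge0 // ltW.
rewrite -!mulrA in h *; move: (pw g k / pw g n) h => x h x0; nra.
Qed.

End Convolution.

(** * Weighted estimates of the free evolution *)

Section FreeEvolution.
Context {R : realType}.
Implicit Types (a g : R) (n k l : nat).

(** If [n < K k], both [n] and [l] are at most multiples of [k + 1], whose weight pays. If
    [K k <= n], [green_far] beats the weights; its order [E + 2] leaves (n + 1)^(-2), which can be
    summed over the 2 n + 1 points of the window. *)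
Lemma green_transport a g1 g2 : 0 < a < 1 -> 0 <= g1 -> g1 <= g2 -> exists2 M : R, 0 < M &
  forall n k l, pw g1 l * `|green a n (k%:Z - l%:Z)| <=
    M * (pw g2 k / pw (g2 - g1) n) *
    (`|green a n (k%:Z - l%:Z)| + if (`|k%:Z - l%:Z| <= n)%N then (n.+1%:R ^+ 2)^-1 else 0).
Proof.
move=> a01 g10 g12; have [K K0 hK] := green_far a01.
have g20 : 0 <= g2 by lra.
have g3 : 0 <= g2 - g1 by lra.
have [E hE] := nat_bound g2; have [B B0 hB] := hK (E + 2)%N.
pose M1 : R := K.+2%:R `^ g1 * K.+1%:R `^ (g2 - g1); pose M2 : R := 2 `^ g1 * B.
have M10 : 0 < M1 by rewrite mulr_gt0 // powR_gt0 // ltr0n.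
have M20 : 0 < M2 by rewrite mulr_gt0 // powR_gt0.
exists (M1 + M2); first exact: addr_gt0.
move=> n k l; have P0 := pw_gt0 (g2 - g1) n.
have Q0 := pw_gt0 g2 k; have Q1 := pw_ge1 k g20.
set G := green a n _; have G0 := normr_ge0 G.
have X0 : 0 < pw g2 k / pw (g2 - g1) n by rewrite divr_gt0.
case: ifP => [kl|/negbT kl]; last first.
  by rewrite /G (@supp_green R a n) ?normr0 ?mulr0 ?addr0 ?mulr0 // ltnNge.
have N0 : 0 < n.+1%:R ^+ 2 :> R by rewrite exprn_gt0 // ltr0n.
have [Kn|nK] := leqP (K * k)%N n.
  have ln : (l.+1 <= 2 * n.+1)%N by clear -Kn kl K0; nia.
  have Kj : K%:Z * (k%:Z - l%:Z) <= n%:Z by clear -Kn; nia.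
  have h1 : `|G| <= B / n.+1%:R ^+ (E + 2) by exact: hB.
  have h2 : pw g1 l <= 2 `^ g1 * pw g1 n by exact: pw_scale.
  apply: (@le_trans _ _ (M2 * (pw g2 k / pw (g2 - g1) n) * (n.+1%:R ^+ 2)^-1)); last first.
    apply: ler_pM.
    - by apply: mulr_ge0; exact: ltW.
    - by rewrite invr_ge0 ltW.
    - by apply: ler_wpM2r; [exact: ltW | rewrite lerDr ltW].
    - by rewrite lerDr.
  apply: (@le_trans _ _ (2 `^ g1 * pw g1 n * (B / n.+1%:R ^+ (E + 2)))).
    by apply: ler_pM => //; rewrite ltW // pw_gt0.
  have NE : 0 < n.+1%:R ^+ E :> R by rewrite exprn_gt0 // ltr0n.
  have h3 : pw g1 n / n.+1%:R ^+ E <= (pw (g2 - g1) n)^-1.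
    rewrite ler_pdivrMr // mulrC ler_pdivlMr // -pwD (_ : g1 + (g2 - g1) = g2); last by clear; lra.
    exact: pw_le_exp.
  have h4 : (pw (g2 - g1) n)^-1 <= pw g2 k / pw (g2 - g1) n.
    by rewrite ler_peMl // invr_ge0 ltW.
  have h5 := le_trans h3 h4.
  have c0 : 0 <= M2 * (n.+1%:R ^+ 2)^-1 by rewrite mulr_ge0 ?invr_ge0 // ltW.
  have := ler_wpM2l c0 h5; rewrite /M2 exprD (invfM (n.+1%:R ^+ E)).
  move: (n.+1%:R ^+ E)^-1 (n.+1%:R ^+ 2)^-1 (pw g2 k / _) (2 `^ g1) (pw g1 n) => u v x y z.
  lra.
have lk : (l.+1 <= K.+2 * k.+1)%N by clear -nK kl; nia.
have nk : (n.+1 <= K.+1 * k.+1)%N by clear -nK; nia.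
apply: (@le_trans _ _ (M1 * (pw g2 k / pw (g2 - g1) n) * `|G|)); last first.
  apply: ler_pM => //; first by rewrite mulr_ge0 // ltW.
    by rewrite ler_wpM2r ?(ltW X0) // lerDl ltW.
  by rewrite lerDl invr_ge0 ltW.
rewrite ler_wpM2r // mulrA ler_pdivlMr //.
have h1 : pw g1 l <= K.+2%:R `^ g1 * pw g1 k by exact: pw_scale.
have h2 : pw (g2 - g1) n <= K.+1%:R `^ (g2 - g1) * pw (g2 - g1) k by exact: pw_scale.
apply: (@le_trans _ _ ((K.+2%:R `^ g1 * pw g1 k) * (K.+1%:R `^ (g2 - g1) * pw (g2 - g1) k))).
  by apply: ler_pM => //; rewrite ltW // pw_gt0.
rewrite (_ : pw g2 k = pw g1 k * pw (g2 - g1) k); last by rewrite -pwD; congr pw; clear; lra.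
by rewrite /M1 le_eqVlt; apply/orP; left; apply/eqP; ring.
Qed.

Lemma window_sum (f : int -> R) n (k J : nat) : (forall j, 0 <= f j) -> supp n f ->
  \sum_(l < J) f (k%:Z - l%:Z) <= zsum n f.
Proof.
move=> f0 fs; rewrite -(zsum_widen fs (leqnn n) (leq_addr (k + J) n)).
set W := (n + (k + J))%N; rewrite /zsum.
pose F (i : nat) := f (i%:Z - W%:Z).
rewrite (reindex_inj rev_ord_inj) /=.
rewrite (eq_bigr (fun j : 'I_J => F ((W + k).+1 - J + j)%N)); last first.
  by move=> l _; rewrite /F; congr f; have := ltn_ord l; rewrite /W; clear; lia.
have e : W.*2.+1 = (((W + k).+1 - J) + (J + (W - k)))%N by rewrite /W; clear; lia.
rewrite (eq_bigr (fun i : 'I_W.*2.+1 => F i)) // e !big_split_ord /=.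
rewrite addrCA lerDl addr_ge0 // sumr_ge0 // => i _; exact: f0.
Qed.

Lemma green_transport_l1 a g1 g2 : 0 < a < 1 -> 0 <= g1 -> g1 <= g2 -> exists2 M : R, 0 < M &
  forall n k J (th : R), (0 < n)%N -> 0 < th -> th ^+ 8 = n%:R ->
    \sum_(l < J) pw g1 l * `|green a n (k%:Z - l%:Z)| <= M * (pw g2 k / pw (g2 - g1) n) * th.
Proof.
move=> a01 g10 g12; have [M M0 hM] := green_transport a01 g10 g12.
have [B B0 hB] := green_l1 a01.
exists (M * (B + 2)); first by rewrite mulr_gt0 //; lra.
move=> n k J th n0 th0 thn; have X0 : 0 < pw g2 k / pw (g2 - g1) n by rewrite divr_gt0 // pw_gt0.
have th1 : 1 <= th.
  rewrite -(@ler_pXn2r _ 8) ?nnegrE ?(ltW th0) // expr1n thn ler1n //.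
pose e : R := (n.+1%:R ^+ 2)^-1; have e0 : 0 <= e by rewrite invr_ge0 exprn_ge0.
pose f j := `|green a n j| + if (`|j| <= n)%N then e else 0.
have fs : supp n f.
  by move=> j jn; rewrite /f (@supp_green R a n j jn) normr0 ifF ?addr0 //; apply/negbTE; rewrite -ltnNge.
have f0 j : 0 <= f j by rewrite /f addr_ge0 //; case: ifP.
apply: (@le_trans _ _ (\sum_(l < J) M * (pw g2 k / pw (g2 - g1) n) * f (k%:Z - l%:Z))).
  by apply: ler_sum => l _; exact: hM.
rewrite -mulr_sumr -!mulrA ler_pM2l // (mulrC (B + 2)) -!mulrA !(mulrA (pw g2 k)) ler_pM2l //.
apply: le_trans (window_sum k J f0 fs) _.
have -> : zsum n f = zsum n (fun j => `|green a n j|) + zsum n (fun j => if (`|j| <= n)%N then e else 0).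
  by rewrite -zsumD.
have h2 : zsum n (fun j => if (`|j| <= n)%N then e else 0) <= 2.
  apply: (@le_trans _ _ (zsum n (fun=> e))); first by apply: le_zsum => j; case: ifP.
  rewrite /zsum sumr_const card_ord -[leLHS]mulr_natl /e ler_pdivrMr ?exprn_gt0 ?ltr0n //.
  by rewrite -natrX -natrM ler_nat; clear; nia.
have := hB n th n0 th0 thn; lra.
Qed.

Lemma green_transport_sup a g1 g2 : 0 < a < 1 -> 0 <= g1 -> g1 <= g2 -> exists2 M : R, 0 < M &
  forall n k l (nu : R), 0 < nu -> nu ^+ 3 = n.+1%:R ->
    pw g1 l * `|green a n (k%:Z - l%:Z)| <= M * (pw g2 k / pw (g2 - g1) n) / nu.
Proof.
move=> a01 g10 g12; have [M M0 hM] := green_transport a01 g10 g12.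
have [B B0 hB] := green_sup a01.
exists (M * (B + 1)); first by rewrite mulr_gt0 //; lra.
move=> n k l nu nu0 nun; have X0 : 0 < pw g2 k / pw (g2 - g1) n by rewrite divr_gt0 // pw_gt0.
have nu1 : 1 <= nu by rewrite -(@ler_pXn2r _ 3) ?nnegrE ?(ltW nu0) // expr1n nun ler1n.
apply: le_trans (hM n k l) _.
rewrite -!mulrA ler_pM2l // (mulrCA (B + 1)) (mulrCA (B + 1)) !(mulrA (pw g2 k)) ler_pM2l //.
rewrite mulrDl mul1r; apply: lerD; first exact: hB.
case: ifP => _; last by rewrite invr_ge0 ltW.
rewrite lef_pV2 ?posrE ?exprn_gt0 ?ltr0n // -nun -exprM ler_eXnr //.
Qed.

End FreeEvolution.

(** * Boundary response and estimates on a half line *)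

Section HalfLine.
Context {R : realType}.
Local Notation C := R[i].
Implicit Types (a b m w g : R) (h : int -> C) (n k l N J : nat).

(* The value [v] at [X = 1] is the same for sources on either side of the shock. *)
Lemma boundary_series a b m w Psi : 0 < a < 1 -> 0 < b < 1 -> 1 < w ->
  w ^+ 2 * (1 - a ^+ 2) < 1 -> w ^+ 2 * (1 - b ^+ 2) < 1 ->
  inW w Psi -> Phi a b m * Psi = 1 - fX ->
  exists v, exists Ta : nat -> fps C, exists Tb : nat -> fps C,
  [/\ forall k, Phi a b m * Ta k = sig a ^+ k,
      forall k, Phi a b m * Tb k = sig b ^+ k,
      forall g, 0 <= g -> exists2 M : R, 0 < M & forall n k,
        cn (fcoef (2 * bnd b (- m) * Ta k) n - v) <= M * pw g k / pw g n &
      forall g, 0 <= g -> exists2 M : R, 0 < M & forall n k,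
        cn (fcoef (2 * cst (b * (1 + - m)) * fX * Tb k) n - v) <= M * pw g k / pw g n].
Proof.
move=> a01 b01 w1 wa wb iP PE; have w0 : 0 < w by lra.
have c1w : cn (1 : C) < w by rewrite cn1.
have [p hp] := has_val_exists w0 c1w iP.
have [ea hea sa] := tail_factor a01 w1 wa.
have [eb heb sb] := tail_factor b01 w1 wb.
(* By [bnd_val_1], [bnd b (- m)] equals [b (1 - m)] at [X = 1], which is the constant in the
   amplitude of a source on the right: hence a common [v]. *)
pose v := 2 * (b * (1 + - m))%:C * p.
exists v, (fun k => Psi * ea * sser a k%:Z), (fun k => Psi * eb * sser b k%:Z); split.
- by move=> k; rewrite sa -PE; ring.
- by move=> k; rewrite sb -PE; ring.
- move=> g g0; have hv : has_val w (2 * bnd b (- m) * (Psi * ea)) 1 v.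
    have := has_val_M w0 (has_val_M w0 (has_val_nat w 1 2) (bnd_val_1 (- m) b01 w1 wb))
      (has_val_M w0 hp hea).
    by rewrite mulr1.
  have [M M0 hM] := tail_value w1 a01 g0 hv; exists M => // n k.
  by have := hM n k; rewrite !mulrA.
- move=> g g0; have hv : has_val w (2 * cst (b * (1 + - m)) * fX * (Psi * eb)) 1 v.
    have := has_val_M w0 (has_val_M w0 (has_val_M w0 (has_val_nat w 1 2)
      (has_val_cst w 1 (b * (1 + - m)))) (has_val_X w 1)) (has_val_M w0 hp heb).
    by rewrite [X in has_val _ _ _ (X * _)]mulr1 [X in has_val _ _ _ (_ * X)]mulr1.
  have [M M0 hM] := tail_value w1 b01 g0 hv; exists M => // n k.
  by have := hM n k; rewrite !mulrA.
Qed.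

(** Amplitude of the mode [lam a ^+ l] excited on the left by all the sources, those at [- k] and
    those at [1 + k]. *)
Definition amplitude a b m (Ta Tb : nat -> fps C) h N : fps C :=
  \sum_(k < N) (fconst (h (- k%:Z)) * (2 * bnd b (- m) * Ta k - gser a k%:Z)
     + fconst (h (1 + k%:Z)) * (2 * cst (b * (1 + - m)) * fX * Tb k)).

Lemma pick_term (f : nat -> C) N i : (i < N)%N -> \sum_(k < N) f k * (i == k)%:R = f i.
Proof.
move=> iN; rewrite (bigD1 (Ordinal iN)) //= eqxx mulr1 big1 ?addr0 // => k ki.
rewrite (_ : (i == k) = false) ?mulr0 //; apply/negbTE.
by apply: contra ki => /eqP e; apply/eqP/val_inj.
Qed.

Lemma window_deltas h N j : - N%:Z < j <= N%:Z ->
  \sum_(k < N) (h (- k%:Z) * (j == - k%:Z)%:R + h (1 + k%:Z) * (1 - j == - k%:Z)%:R) = h j.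
Proof.
move=> /andP[j1 j2]; have [j0|j0] := leP j 0.
  have [i ij] : exists i : nat, j = - i%:Z by exists `|j|%N; lia.
  have iN : (i < N)%N by lia.
  rewrite ij -[RHS](@pick_term (fun k => h (- k%:Z)) N i iN); apply: eq_bigr => k _.
  have -> : (- i%:Z == - k%:Z) = (i == k) by lia.
  have -> : (1 - - i%:Z == - k%:Z) = false by lia.
  by rewrite mulr0 addr0.
have [i ij] : exists i : nat, j = 1 + i%:Z by exists `|j|%N.-1; lia.
have iN : (i < N)%N by lia.
rewrite ij -[RHS](@pick_term (fun k => h (1 + k%:Z)) N i iN); apply: eq_bigr => k _.
have -> : (1 + i%:Z == - k%:Z) = false by lia.
have -> : (1 - (1 + i%:Z) == - k%:Z) = (i == k) by lia.
by rewrite mulr0 add0r.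
Qed.

(** By finite speed of propagation the datum may be cut to a window, which keeps the superposition
    of sources finite. *)
Lemma iter_scheme_left a b m (Ta Tb : nat -> fps C) h N n l : 0 < a < 1 -> 0 < b < 1 ->
  (forall k, Phi a b m * Ta k = sig a ^+ k) ->
  (forall k, Phi a b m * Tb k = sig b ^+ k) -> (l + n < N)%N ->
  iter n (scheme a b m) h (- l%:Z) =
    \sum_(k < N) h (- k%:Z) * (green a n (k%:Z - l%:Z))%:C
      + fcoef (lam a ^+ l * amplitude a b m Ta Tb h N) n.
Proof.
move=> a01 b01 hTa hTb lN.
pose d j := \sum_(k < N) (h (- k%:Z) * (j == - k%:Z)%:R + h (1 + k%:Z) * (1 - j == - k%:Z)%:R).
pose U j := \sum_(k < N) (fconst (h (- k%:Z)) * source a b m (Ta k) k j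
  + fconst (h (1 + k%:Z)) * source b a (- m) (Tb k) k (1 - j)).
have hU j : U j = fconst (d j) + fX * (cst (coef_lo a b m j) * U (j - 1)
     + cst (coef_mid a b m j) * U j + cst (coef_hi a b m j) * U (j + 1)).
  rewrite /U /d rmorph_sum !mulr_sumr -!big_split mulr_sumr -big_split /=.
  apply: eq_bigr => k _; have e1 := source_rec a01 (hTa k) j.
  have PT : Phi b a (- m) * Tb k = sig b ^+ k by rewrite Phi_sym.
  have := source_rec b01 PT (1 - j); rewrite coef_mid_mirror {1 2}/coef_hi opprK.
  rewrite -/(coef_hi a b m j) (_ : 1 - (1 - j) = j); last lia.
  rewrite (_ : 1 - j - 1 = 1 - (j + 1)); last lia.
  rewrite (_ : 1 - j + 1 = 1 - (j - 1)); last lia.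
  have fE (x y z t : C) : fconst (x * y + z * t) = fconst x * fconst y + fconst z * fconst t.
    by rewrite rmorphD !rmorphM.
  rewrite fE.
  move: (source a b m (Ta k) k) (source b a (- m) (Tb k) k) e1 => S S' e1 e2.
  rewrite [in LHS]e1 [in LHS]e2.
  move: (S (j - 1)) (S j) (S (j + 1)) (S' (1 - (j + 1))) (S' (1 - j)) (S' (1 - (j - 1))) => s1 s2 s3 s4 s5 s6.
  by rewrite /=; ring.
have hd j : - N%:Z < j <= N%:Z -> d j = h j by exact: window_deltas.
rewrite (@iter_scheme_local _ a b m h d n); last first.
  by move=> i hi; rewrite hd //; clear -hi lN; lia.
rewrite -(iter_scheme_coef hU) /U /amplitude mulr_sumr !fcoef_sum.
rewrite -big_split; apply: eq_bigr => k _; cbv beta.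
have -> : source a b m (Ta k) k (- l%:Z) =
    gser a (k%:Z - l%:Z) + (2 * bnd b (- m) * Ta k - gser a k%:Z) * lam a ^+ l.
  by rewrite /source ifT; [rewrite abszN absz_nat (addrC (- l%:Z)) | lia].
have -> : source b a (- m) (Tb k) k (1 - - l%:Z) = 2 * cst (b * (1 + - m)) * fX * Tb k * lam a ^+ l.
  rewrite opprK /source (_ : absz ((1 : int) + l%:Z - 1)%R = l); last lia.
  by have -> : (1 + l%:Z <= 0) = false by lia.
move: (2 * bnd b (- m) * Ta k - gser a k%:Z) (2 * cst (b * (1 + - m)) * fX * Tb k) => X Y.
have -> : h (- k%:Z) * (green a n (k%:Z - l%:Z))%:C =
  fcoef (fconst (h (- k%:Z)) * gser a (k%:Z - l%:Z)) n by rewrite fcoefCM.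
rewrite -[RHS]fcoefD; congr (fcoef _ n); ring.
Qed.

(** [s] bounds the mass inside the window; it need not vanish for a finite window, even for a datum
    of total mass 0. *)
Lemma half_line a b m w Psi g1 g2 : 0 < a < 1 -> 0 < b < 1 -> 1 < w ->
  w ^+ 2 * (1 - a ^+ 2) < 1 -> w ^+ 2 * (1 - b ^+ 2) < 1 ->
  inW w Psi -> Phi a b m * Psi = 1 - fX -> 0 <= g1 -> g1 <= g2 ->
  exists2 M : R, 0 < M & forall h N J n H s, (J + n < N)%N -> (0 < n)%N ->
    \sum_(k < N) pw g2 k * (cn (h (- k%:Z)) + cn (h (1 + k%:Z))) <= H ->
    cn (\sum_(k < N) (h (- k%:Z) + h (1 + k%:Z))) <= s ->
    (forall th : R, 0 < th -> th ^+ 8 = n%:R ->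
      \sum_(l < J) pw g1 l * cn (iter n (scheme a b m) h (- l%:Z))
        <= M * (H / pw (g2 - g1) n * th + s)) /\
    (forall nu : R, 0 < nu -> nu ^+ 3 = n.+1%:R -> forall l, (l < J)%N ->
      pw g1 l * cn (iter n (scheme a b m) h (- l%:Z))
        <= M * (H / pw (g2 - g1) n * (nu^-1 + (pw g1 n)^-1) + s)).
Proof.
move=> a01 b01 w1 wa wb iP PE g10 g12.
have g20 : 0 <= g2 by lra.
have [v [Ta [Tb [hTa hTb vTa vTb]]]] := boundary_series a01 b01 w1 wa wb iP PE.
have [Ma Ma0 hMa] := vTa g2 g20; have [Mb Mb0 hMb] := vTb g2 g20.
have [Mg Mg0 hMg] := green_weight a01 g20.
have [Mc Mc0 hMc] := conv_weight w1 g20.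
have [K K0 hK] := wn_lam a01 w1 wa.
have r01 : 0 <= rate a < 1 by rewrite rate_lt1 // andbT ltW // rate_gt0.
have [S S0 hS] := pw_geom_sum g1 r01.
have [F1 F10 hF1] := green_transport_l1 a01 g10 g12.
have [F2 F20 hF2] := green_transport_sup a01 g10 g12.
pose Mt := Ma + Mg + Mb + cn v.
have Mt0 : 0 < Mt by rewrite /Mt; have := cn_ge0 v; clear -Ma0 Mg0 Mb0; lra.
pose Q := Mc * K * Mt; have Q0 : 0 < Q by rewrite !mulr_gt0.
exists (F1 + F2 + Q * S); first by rewrite !addr_gt0 // mulr_gt0.
have [F1' F2' Q' S'] : [/\ 0 <= F1, 0 <= F2, 0 <= Q & 0 <= S] by split; exact: ltW.
move=> h N J n H s JN n0 hH hs.
have H0 : 0 <= H.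
  apply: le_trans hH; apply: sumr_ge0 => k _.
  by rewrite mulr_ge0 ?addr_ge0 ?cn_ge0 // ltW // pw_gt0.
have s0 : 0 <= s := le_trans (cn_ge0 _) hs.
(* Once [v] is subtracted from each response the rest decays like the tail of the datum; the
   subtracted constants add up to [v] times the mass in the window. *)
have amp i : cn (fcoef (amplitude a b m Ta Tb h N) i) <= (Mt * H) / pw g2 i + Mt * s.
  have Pi := pw_gt0 g2 i; rewrite /amplitude fcoef_sum.
  rewrite (eq_bigr (fun k : 'I_N =>
    (h (- k%:Z) * (fcoef (2 * bnd b (- m) * Ta k) i - v - (green a i k%:Z)%:C)
      + h (1 + k%:Z) * (fcoef (2 * cst (b * (1 + - m)) * fX * Tb k) i - v))
      + v * (h (- k%:Z) + h (1 + k%:Z)))); last first.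
    move=> k _; rewrite fcoefD !fcoefCM fcoefB (_ : fcoef (gser a k) i = (green a i k)%:C) //.
    by ring.
  rewrite big_split -mulr_sumr; apply: le_trans (cnD _ _) _; apply: lerD; last first.
    rewrite cnM; apply: ler_pM; rewrite ?cn_ge0 //.
    by rewrite /Mt; clear -Ma0 Mg0 Mb0; lra.
  apply: le_trans (cn_sum _ _ _) _; rewrite [leRHS](_ : _ = Mt / pw g2 i * H); last by ring.
  apply: (@le_trans _ _ (\sum_(k < N) Mt / pw g2 i * (pw g2 k * (cn (h (- k%:Z)) + cn (h (1 + k%:Z)))))).
    apply: ler_sum => k _; apply: le_trans (cnD _ _) _; rewrite !cnM.
    have q0 : 0 <= pw g2 k / pw g2 i by rewrite divr_ge0 // ltW // pw_gt0.
    have e1 : cn (fcoef (2 * bnd b (- m) * Ta k) i - v - (green a i k)%:C)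
        <= Mt * (pw g2 k / pw g2 i).
      apply: le_trans (cnB _ _) _; rewrite cn_real.
      have h1 := hMa i k; have h2 := hMg i k k%:Z (lexx _).
      rewrite -(mulrA Ma) in h1; rewrite -(mulrA Mg) in h2; move: (pw g2 k / pw g2 i) q0 h1 h2 => x x0 h1 h2.
      have : 0 <= Mb * x by rewrite mulr_ge0 // ltW.
      have : 0 <= cn v * x by rewrite mulr_ge0 // cn_ge0.
      rewrite /Mt; clear -h1 h2; lra.
    have e2 : cn (fcoef (2 * cst (b * (1 + - m)) * fX * Tb k) i - v) <= Mt * (pw g2 k / pw g2 i).
      have h1 := hMb i k.
      rewrite -(mulrA Mb) in h1; move: (pw g2 k / pw g2 i) q0 h1 => x x0 h1.
      have : 0 <= Ma * x by rewrite mulr_ge0 // ltW.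
      have : 0 <= Mg * x by rewrite mulr_ge0 // ltW.
      have : 0 <= cn v * x by rewrite mulr_ge0 // cn_ge0.
      rewrite /Mt; clear -h1; lra.
    rewrite [leRHS](_ : _ = cn (h (- k%:Z)) * (Mt * (pw g2 k / pw g2 i))
      + cn (h (1 + k%:Z)) * (Mt * (pw g2 k / pw g2 i))); last by ring.
    by apply: lerD; apply: ler_wpM2l; rewrite ?cn_ge0.
  by rewrite -mulr_sumr ler_wpM2l // divr_ge0 // ltW.
(* The norm of [lam a ^+ l] is at most [K * rate a ^+ l]: the boundary layer decays geometrically
   away from the shock and absorbs any weight in [l]. *)
have bdry l : cn (fcoef (lam a ^+ l * amplitude a b m Ta Tb h N) n)
    <= Q * rate a ^+ l * (H / pw g2 n + s).
  have := hMc _ _ _ _ _ (hK l) _ _ amp n; rewrite !mulr_ge0 ?(ltW Mt0) // => /(_ isT isT).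
  rewrite /Q; set A := cn _; have : 0 <= 1 :> R by [].
  move=> _ hA; apply: le_trans hA _; rewrite le_eqVlt; apply/orP; left; apply/eqP; ring.
have uE l : (l < J)%N -> cn (iter n (scheme a b m) h (- l%:Z)) <=
    \sum_(k < N) cn (h (- k%:Z)) * `|green a n (k%:Z - l%:Z)| + Q * rate a ^+ l * (H / pw g2 n + s).
  move=> lJ; have lN : (l + n < N)%N by clear -lJ JN; lia.
  rewrite (iter_scheme_left h a01 b01 hTa hTb lN).
  apply: le_trans (cnD _ _) _; apply: lerD; last exact: bdry.
  apply: le_trans (cn_sum _ _ _) _; apply: ler_sum => k _.
  by rewrite cnM cn_real.
have P20 := pw_gt0 g2 n; have P10 := pw_gt0 g1 n; have P30 := pw_gt0 (g2 - g1) n.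
(* The boundary layer has the full decay n^(-g2), better than the common factor by n^(-g1): this is
   the term [(pw g1 n)^-1] of the sup bound. *)
have P2E : pw g2 n = pw (g2 - g1) n * pw g1 n by rewrite -pwD; congr pw; clear; lra.
have hH' : \sum_(k < N) cn (h (- k%:Z)) * pw g2 k <= H.
  apply: le_trans hH; apply: ler_sum => k _; rewrite mulrC ler_wpM2l ?(ltW (pw_gt0 _ _)) //.
  by rewrite lerDl cn_ge0.
have X0 : 0 <= H / pw (g2 - g1) n by rewrite divr_ge0 // ltW.
split=> [th th0 thn|nu nu0 nun l lJ].
  have th1 : 1 <= th by rewrite -(@ler_pXn2r _ 8) ?nnegrE ?(ltW th0) // expr1n thn ler1n.
  apply: (@le_trans _ _ (\sum_(l < J) (\sum_(k < N) cn (h (- k%:Z)) * (pw g1 l * `|green a n (k%:Z - l%:Z)|)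
      + Q * (H / pw g2 n + s) * (pw g1 l * rate a ^+ l)))).
    apply: ler_sum => l _; apply: le_trans (ler_wpM2l (ltW (pw_gt0 g1 l)) (uE l (ltn_ord l))) _.
    rewrite mulrDr mulr_sumr; apply: lerD; last by rewrite le_eqVlt; apply/orP; left; apply/eqP; ring.
    by apply: ler_sum => k _; rewrite mulrCA.
  rewrite big_split -mulr_sumr exchange_big /=.
  have f1 : \sum_(k < N) \sum_(l < J) cn (h (- k%:Z)) * (pw g1 l * `|green a n (k%:Z - l%:Z)|)
      <= F1 * (H / pw (g2 - g1) n * th).
    apply: (@le_trans _ _ (\sum_(k < N) (F1 / pw (g2 - g1) n * th) * (cn (h (- k%:Z)) * pw g2 k))).
      apply: ler_sum => k _; rewrite -mulr_sumr.
      apply: le_trans (ler_wpM2l (cn_ge0 _) (hF1 n k J th n0 th0 thn)) _.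
      by rewrite le_eqVlt; apply/orP; left; apply/eqP; ring.
    rewrite -mulr_sumr [leRHS](_ : _ = (F1 / pw (g2 - g1) n * th) * H); last by ring.
    by rewrite ler_wpM2l // mulr_ge0 ?divr_ge0 // ltW.
  have f2 : Q * (H / pw g2 n + s) * (\sum_(l < J) pw g1 l * rate a ^+ l)
      <= Q * S * (H / pw (g2 - g1) n * th + s).
    rewrite [leRHS]mulrAC; apply: ler_pM => //.
    - by rewrite mulr_ge0 ?(ltW Q0) // addr_ge0 // divr_ge0 // ltW.
    - by apply: sumr_ge0 => l _; rewrite mulr_ge0 ?exprn_ge0 ?(ltW (pw_gt0 _ _)) //; case/andP: r01.
    rewrite ler_pM2l // lerD2r P2E invfM mulrA ler_wpM2l //.
    apply: le_trans th1; rewrite invf_le1 // pw_ge1 //.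
  have f3 : 0 <= F1 * s by rewrite mulr_ge0 // ltW.
  have f4 : 0 <= F2 * (H / pw (g2 - g1) n * th + s).
    by rewrite mulr_ge0 // addr_ge0 // mulr_ge0 // ltW.
  move: (\sum_(k < N) \sum_(l < J) _) (\sum_(l < J) _) f1 f2 => x y f1 f2.
  rewrite !mulrDl (mulrDr F1) in f4 *; clear -f1 f2 f3 f4; lra.
apply: le_trans (ler_wpM2l (ltW (pw_gt0 g1 l)) (uE l lJ)) _.
rewrite mulrDr mulr_sumr.
have f1 : \sum_(k < N) pw g1 l * (cn (h (- k%:Z)) * `|green a n (k%:Z - l%:Z)|)
    <= F2 * (H / pw (g2 - g1) n * nu^-1).
  apply: (@le_trans _ _ (\sum_(k < N) (F2 / pw (g2 - g1) n / nu) * (cn (h (- k%:Z)) * pw g2 k))).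
    apply: ler_sum => k _; rewrite mulrCA.
    apply: le_trans (ler_wpM2l (cn_ge0 _) (hF2 n k l nu nu0 nun)) _.
    by rewrite le_eqVlt; apply/orP; left; apply/eqP; ring.
  rewrite -mulr_sumr [leRHS](_ : _ = (F2 / pw (g2 - g1) n / nu) * H); last by ring.
  by rewrite ler_wpM2l // !divr_ge0 // ltW.
have f2 : pw g1 l * (Q * rate a ^+ l * (H / pw g2 n + s)) <=
    Q * S * (H / pw (g2 - g1) n * (pw g1 n)^-1 + s).
  have e1 : pw g1 l * rate a ^+ l <= S.
    apply: le_trans (hS l.+1); rewrite big_ord_recr /= lerDr; apply: sumr_ge0 => i _.
    by rewrite mulr_ge0 ?exprn_ge0 ?(ltW (pw_gt0 _ _)) //; case/andP: r01.
  rewrite P2E invfM mulrA [leLHS](_ : _ = pw g1 l * rate a ^+ l * (Q * (H / pw (g2 - g1) n / pw g1 n + s))); last by ring.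
  rewrite [leRHS](_ : _ = S * (Q * (H / pw (g2 - g1) n / pw g1 n + s))); last by ring.
  by rewrite ler_wpM2r // mulr_ge0 // addr_ge0 // divr_ge0 // ltW.
have X1 : 0 <= H / pw (g2 - g1) n * nu^-1 by rewrite divr_ge0 // ltW.
have X2 : 0 <= H / pw (g2 - g1) n * (pw g1 n)^-1 by rewrite divr_ge0 // ltW.
move: (H / pw (g2 - g1) n * nu^-1) (H / pw (g2 - g1) n * (pw g1 n)^-1) f1 f2 X1 X2 (mulrDr (H / pw (g2 - g1) n) nu^-1 (pw g1 n)^-1).
move=> x y f1 f2 x0 y0 ->.
have f3 : 0 <= (F1 + F2) * s by rewrite mulr_ge0 // addr_ge0.
have f4 : 0 <= (F1 + F2) * y by rewrite mulr_ge0 // addr_ge0.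
have f5 : 0 <= F1 * x by rewrite mulr_ge0.
have f6 : 0 <= Q * S * x by apply: mulr_ge0 => //; exact: mulr_ge0.
move: (\sum_(k < N) _) f1 => z f1; clear -f1 f2 f3 f4 f5 f6; lra.
Qed.

End HalfLine.

(** * Windows of integers and summation over Z *)

Section Windows.
Implicit Types (N : nat) (j : int).

(** The window -N < j <= N rather than a symmetric one: it is invariant under [j -> 1 - j]. *)
Definition window_seq N : seq int :=
  [seq - k%:Z | k <- index_iota 0 N] ++ [seq 1 + k%:Z | k <- index_iota 0 N].
Definition window N : {fset int} := [fset j in window_seq N]%fset.

Lemma mem_window N j : (j \in window N) = (j \in window_seq N).
Proof. by rewrite /window; move: (window_seq N) => s; rewrite !inE. Qed.

Lemma in_window N j : (j \in window N) = (- N%:Z < j <= N%:Z).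
Proof.
rewrite mem_window mem_cat; apply/orP/idP => [[/mapP[k]|/mapP[k]]|].
- by rewrite mem_index_iota => /andP[_ kN] ->; lia.
- by rewrite mem_index_iota => /andP[_ kN] ->; lia.
move=> jN; have [j0|j0] := leP j 0.
  by left; apply/mapP; exists `|j|%N; [rewrite mem_index_iota; lia | lia].
by right; apply/mapP; exists `|j|%N.-1; [rewrite mem_index_iota; lia | lia].
Qed.

Lemma sum_window (V : nmodType) (F : int -> V) N :
  \sum_(j <- window N) F j = \sum_(k < N) (F (- k%:Z) + F (1 + k%:Z)).
Proof.
have pe : perm_eq (window N) (window_seq N).
  apply: uniq_perm; [exact: fset_uniq | | by move=> j; rewrite -mem_window].
  rewrite cat_uniq !map_inj_uniq ?iota_uniq /=; try by move=> x y; lia.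
  rewrite andbT; apply/hasPn => j /mapP[k _ ->]; apply/negP => /mapP[i _]; lia.
by rewrite (perm_big _ pe) big_cat !big_map big_split /= !big_mkord.
Qed.

Lemma sub_window (A : {fset int}) : exists N, forall M, (N <= M)%N -> (A `<=` window M)%fset.
Proof.
exists (\max_(j <- A) `|j|).+1 => M NM; apply/fsubsetP => j jA; rewrite in_window.
have : (`|j| <= \max_(j <- A) `|j|)%N by exact: leq_bigmax_seq.
by move: (\max_(j <- A) _) NM => m; lia.
Qed.

End Windows.

Section Weights.
Context {R : realType}.
Implicit Types (g : R) (k : nat).

Lemma weight_ge0 g j : 0 <= weight g j.
Proof. by rewrite addr_ge0 // powR_ge0. Qed.

Lemma weight_neg g k : weight g (- k%:Z) = 1 + k%:R `^ g.
Proof. by rewrite /weight mulrNz normrN normr_nat. Qed.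
Lemma weight_pos g k : weight g (1 + k%:Z) = 1 + k.+1%:R `^ g.
Proof. by rewrite /weight (_ : 1 + k%:Z = k.+1%:Z) ?normr_nat //; lia. Qed.

Lemma weight_le_pw g k : 0 <= g ->
  weight g (- k%:Z) <= 2 * pw g k /\ weight g (1 + k%:Z) <= 2 * pw g k.
Proof.
move=> g0; rewrite weight_neg weight_pos; have := pw_ge1 k g0; rewrite /pw.
have : k%:R `^ g <= k.+1%:R `^ g by apply: ge0_ler_powR => //; rewrite ?nnegrE ?ler_nat.
by move=> h1 h2; split; lra.
Qed.

Lemma pw_le_weight g k : 0 <= g ->
  pw g k <= 2 `^ g * weight g (- k%:Z) /\ pw g k <= 2 `^ g * weight g (1 + k%:Z).
Proof.
move=> g0; rewrite weight_neg weight_pos.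
have t1 : 1 <= 2 `^ g :> R by have e : (1 : R) = 1 `^ g; [rewrite powR1 | rewrite [leLHS]e; apply: ge0_ler_powR => //; rewrite ?nnegrE ?ler1n].
have p0 : 0 <= pw g k by rewrite ltW // pw_gt0.
split.
  case: k p0 => [|k] p0.
    have p1 : pw g 0 = 1 by rewrite /pw powR1.
    by have := powR_ge0 (0 : R) g; rewrite p1; nra.
  have : pw g k.+1 <= 2 `^ g * k.+1%:R `^ g.
    have d : k.+2%:R <= 2 * k.+1%:R :> R by rewrite -natrM ler_nat; lia.
    move: (ler0n R k.+2) (ler0n R k.+1) d; rewrite /pw.
    move: (k.+2%:R) (k.+1%:R) => x y x0 y0 d.
    by rewrite -powRM // ge0_ler_powR ?nnegrE ?mulr_ge0.
  rewrite mulrDr mulr1; lra.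
have : pw g k <= 2 `^ g * k.+1%:R `^ g by rewrite ler_peMl.
rewrite mulrDr mulr1; lra.
Qed.

End Weights.

Section Conclusion.
Context {R : realType}.
Local Notation C := R[i].
Implicit Types (a b m g : R) (h : int -> C) (n k N J : nat).

Lemma esum_le_window (F : int -> R) (X : R) : (forall j, 0 <= F j) ->
  (forall J, \sum_(k < J) (F (- k%:Z) + F (1 + k%:Z)) <= X) ->
  (\esum_(j in [set: int]) (F j)%:E <= X%:E)%E.
Proof.
move=> F0 hX; apply: ge_ereal_sup => _ [A [fA _] <-].
rewrite fsbig_finite // sumEFin lee_fin.
have [N hN] := sub_window (fset_set A).
apply: le_trans (hX N); rewrite -sum_window.
rewrite (big_fsetID _ (fun j => j \in fset_set A) (window N)) /=.
rewrite [X in _ <= X + _](_ : _ = \sum_(j <- fset_set A) F j).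
  by rewrite lerDl sumr_ge0.
apply: eq_fbigl => j; move: (window N) (hN N (leqnn N)) => W /fsubsetP AW.
by rewrite !inE; apply/andP/idP => [[]//|jA]; split=> //; exact: AW.
Qed.

Lemma window_le_esum (F : int -> R) N :
  ((\sum_(k < N) (F (- k%:Z) + F (1 + k%:Z)))%:E <= \esum_(j in [set: int]) (F j)%:E)%E.
Proof.
apply: esum_ge; exists [set` window N]%classic; first by split; [exact: finite_fset | ].
by rewrite fsbig_finite ?set_fsetK ?sumEFin ?sum_window //; exact: finite_fset.
Qed.

(** [half_line] is applied on the left and, after reflection, on the right; by [Phi_sym] the same
    [Psi] serves both. The factors 2 and [2 ^ g2] convert between [weight] and [pw]. *)
Lemma decay a b m g1 g2 : 0 < a < 1 -> 0 < b < 1 ->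
  derive1 (Lopatinskii a m (- b) : C -> C^o) 1 != 0 ->
  (forall z : C, 1 <= `|z| -> z != 1 -> Lopatinskii a m (- b) z != 0) ->
  0 <= g1 -> g1 <= g2 ->
  exists2 M : R, 0 < M & forall h (L : R), (forall N,
      \sum_(k < N) (weight g2 (- k%:Z) * cn (h (- k%:Z)) + weight g2 (1 + k%:Z) * cn (h (1 + k%:Z))) <= L) ->
    has_sum h 0 -> forall n, (0 < n)%N ->
    let u := iter n (scheme a b m) h in
    (forall th : R, 0 < th -> th ^+ 8 = n%:R -> forall J,
      \sum_(k < J) (weight g1 (- k%:Z) * cn (u (- k%:Z)) + weight g1 (1 + k%:Z) * cn (u (1 + k%:Z)))
        <= M * (L / pw (g2 - g1) n * th)) /\
    (forall nu : R, 0 < nu -> nu ^+ 3 = n.+1%:R -> forall j,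
      weight g1 j * cn (u j) <= M * (L / pw (g2 - g1) n * (nu^-1 + (pw g1 n)^-1))).
Proof.
move=> a01 b01 dL nL g10 g12; have g20 : 0 <= g2 by lra.
have [w [Psi [w1 wa wb iP PE]]] := Lopatinskii_inverse a01 b01 dL nL.
have PE' : Phi b a (- m) * Psi = 1 - fX by rewrite Phi_sym.
have [M1 M10 hM1] := half_line a01 b01 w1 wa wb iP PE g10 g12.
have [M2 M20 hM2] := half_line b01 a01 w1 wb wa iP PE' g10 g12.
have t0 : 0 < 2 `^ g2 :> R by rewrite powR_gt0.
exists (2 * (M1 + M2) * 2 `^ g2); first by rewrite !mulr_gt0 ?addr_gt0.
move=> h L hL h0 n n0 u; pose h' i := h (1 - i).
have uE k : u (1 + k%:Z) = iter n (scheme b a (- m)) h' (- k%:Z).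
  by rewrite /u iter_scheme_mirror (_ : 1 - (1 + k%:Z) = - k%:Z) //; clear; lia.
(* By [has_sum h 0] a wide enough window has mass at most [e]; the final bounds do not involve the
   window, so [e] may tend to 0. *)
have key (e : R) J : 0 < e -> exists N, [/\ (J + n < N)%N,
    \sum_(k < N) pw g2 k * (cn (h (- k%:Z)) + cn (h (1 + k%:Z))) <= 2 `^ g2 * L &
    cn (\sum_(k < N) (h (- k%:Z) + h (1 + k%:Z))) <= e].
  move=> e0; have [A hA] := h0 e e0; have [N hN] := sub_window A.
  exists (N + (J + n).+1)%N; split; first by clear; lia.
    apply: le_trans (ler_wpM2l (ltW t0) (hL (N + (J + n).+1)%N)).
    rewrite mulr_sumr; apply: ler_sum => k _.
    have [p1 p2] := @pw_le_weight R g2 k g20.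
    have := ler_wpM2r (cn_ge0 (h (- k%:Z))) p1; have := ler_wpM2r (cn_ge0 (h (1 + k%:Z))) p2.
    clear; lra.
  rewrite -sum_window; apply: ltW.
  by have := hA _ (hN (N + (J + n).+1)%N (leq_addr _ _)); rewrite subr0.
have mirror N : cn (\sum_(k < N) (h' (- k%:Z) + h' (1 + k%:Z))) =
    cn (\sum_(k < N) (h (- k%:Z) + h (1 + k%:Z))).
  congr cn; apply: eq_bigr => k _; rewrite addrC /h' opprK.
  by congr (h _ + _); clear; lia.
have mirror' N : \sum_(k < N) pw g2 k * (cn (h' (- k%:Z)) + cn (h' (1 + k%:Z))) =
    \sum_(k < N) pw g2 k * (cn (h (- k%:Z)) + cn (h (1 + k%:Z))).
  apply: eq_bigr => k _; rewrite [X in _ * X]addrC /h' opprK.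
  by congr (_ * (cn (h _) + _)); clear; lia.
have P0 := pw_gt0 (g2 - g1) n.
split=> [th th0 thn J|nu nu0 nun j].
  apply/ler_addgt0Pr => e e0; pose e' := e / (2 * (M1 + M2)).
  have MM : 0 < 2 * (M1 + M2) by clear -M10 M20; lra.
  have [|N [JN hH hs]] := key e' J; first exact: divr_gt0.
  have [h1 _] := hM1 h N J n _ _ JN n0 hH hs.
  have [|h2 _] := hM2 h' N J n (2 `^ g2 * L) e' JN n0 _ ltac:(by rewrite mirror).
    by rewrite mirror'.
  have {}h1 := h1 th th0 thn; have {}h2 := h2 th th0 thn.
  apply: (@le_trans _ _ (2 * (\sum_(l < J) pw g1 l * cn (iter n (scheme a b m) h (- l%:Z)))
     + 2 * (\sum_(l < J) pw g1 l * cn (iter n (scheme b a (- m)) h' (- l%:Z))))).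
    rewrite !mulr_sumr -big_split; apply: ler_sum => k _; rewrite uE.
    have [p1 p2] := @weight_le_pw R g1 k g10.
    by rewrite !mulrA; apply: lerD; apply: ler_wpM2r; rewrite ?cn_ge0.
  have -> : e = 2 * (M1 + M2) * e' by rewrite /e' mulrC divfK // gt_eqF.
  have -> : 2 * (M1 + M2) * 2 `^ g2 * (L / pw (g2 - g1) n * th) =
    2 * (M1 + M2) * (2 `^ g2 * L / pw (g2 - g1) n * th) by ring.
  clear -h1 h2; lra.
apply/ler_addgt0Pr => e e0; pose e' := e / (2 * (M1 + M2)).
have MM : 0 < 2 * (M1 + M2) by clear -M10 M20; lra.
have e'0 : 0 < e' by exact: divr_gt0.
have [N [JN hH hs]] := key e' `|j|.+1%N e'0.
have [_ h1] := hM1 h N _ n _ _ JN n0 hH hs.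
have [|_ h2] := hM2 h' N _ n (2 `^ g2 * L) e' JN n0 _ ltac:(by rewrite mirror).
  by rewrite mirror'.
have eE : e = 2 * (M1 + M2) * e' by rewrite /e' mulrC divfK // gt_eqF.
have -> : 2 * (M1 + M2) * 2 `^ g2 * (L / pw (g2 - g1) n * (nu^-1 + (pw g1 n)^-1)) + e =
   2 * ((M1 + M2) * (2 `^ g2 * L / pw (g2 - g1) n * (nu^-1 + (pw g1 n)^-1) + e')) by rewrite eE; ring.
have Y0 : 0 <= 2 `^ g2 * L / pw (g2 - g1) n * (nu^-1 + (pw g1 n)^-1) + e'.
  have L0 : 0 <= L by have := hL 0%N; rewrite big_ord0.
  apply: addr_ge0; last exact: ltW.
  by rewrite mulr_ge0 ?divr_ge0 ?mulr_ge0 ?addr_ge0 ?invr_ge0 ?(ltW P0) ?(ltW nu0) ?(ltW t0) // ltW // pw_gt0.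
have {}h1 := h1 nu nu0 nun; have {}h2 := h2 nu nu0 nun.
move: (2 `^ g2 * L / _ * _ + e') Y0 h1 h2 => Y Y0 h1 h2.
have Y1 : 0 <= M1 * Y by rewrite mulr_ge0 // ltW.
have Y2 : 0 <= M2 * Y by rewrite mulr_ge0 // ltW.
have [j0|j0] := leP j 0.
  have [k jk] : exists k : nat, j = - k%:Z by exists `|j|%N; clear -j0; lia.
  have kJ : (k < `|j|.+1)%N by rewrite jk; clear; lia.
  have := h1 k kJ; have [p1 _] := @weight_le_pw R g1 k g10.
  have := ler_wpM2r (cn_ge0 (u (- k%:Z))) p1; rewrite jk /u; clear -Y1 Y2; lra.
have [k jk] : exists k : nat, j = 1 + k%:Z by exists `|j|%N.-1; clear -j0; lia.
have kJ : (k < `|j|.+1)%N by rewrite jk; clear; lia.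
have := h2 k kJ; have [_ p1] := @weight_le_pw R g1 k g10.
have := ler_wpM2r (cn_ge0 (u (1 + k%:Z))) p1; rewrite jk uE; clear -Y1 Y2; lra.
Qed.

End Conclusion.

Local Open Scope classical_set_scope.

Theorem theorem2p4 (R : realType) (f : R -> R) (ul ur lambda : R) :
  smooth f ->
  0 < lambda ->
  let al := lambda * derive1 f ul in
  let ar := lambda * derive1 f ur in
  let am := lambda * derive1 f ((ul + ur) / 2) in
  f ul = f ur ->
  derive1 f ur < 0 -> 0 < derive1 f ul ->
  Num.max al `|ar| < 1 ->
  derive1 (Lopatinskii al am ar : R[i] -> R[i]^o) 1 != 0 ->
  (forall z : R[i], 1 <= `|z| -> z != 1 -> Lopatinskii al am ar z != 0) ->
  forall g1 g2 : R, 0 <= g1 -> g1 <= g2 ->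
  exists C : R, forall h : int -> R[i],
    (l1norm g2 h < +oo)%E -> has_sum h 0 ->
    forall n : nat, (1 <= n)%N ->
      (l1norm g1 (iter n (lax_wendroff al am ar) h)
         <= (C / n%:R `^ (g2 - g1 - 1 / 8))%:E * l1norm g2 h)%E /\
      (linftynorm g1 (iter n (lax_wendroff al am ar) h)
         <= (C / n%:R `^ (g2 - g1 + Num.min (1 / 3) g1))%:E * l1norm g2 h)%E.
Proof.
move=> _ l0 al ar am _ fr fl; rewrite gt_max => /andP[al1 ar1] dL nL g1 g2 g10 g12.
have al0 : 0 < al by rewrite mulr_gt0.
have ar0 : ar < 0 by rewrite pmulr_rlt0.
have arE : ar = - - ar by rewrite opprK.
rewrite ltr0_norm // in ar1; rewrite arE in dL nL *.
have a01 : 0 < al < 1 by rewrite al0.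
have b01 : 0 < - ar < 1 by rewrite oppr_gt0 ar0.
have [M M0 hM] := decay a01 b01 dL nL g10 g12.
(* The factor 2 absorbs the sum [nu^-1 + (pw g1 n)^-1] into the slower of the two powers of n. *)
exists (2 * M) => h hfin h0 n n1.
have -> : lax_wendroff al am (- - ar) = scheme al (- ar) am.
  by apply/funext => v; apply/funext => j; exact: lax_wendroff_scheme.
have F0 g (v : int -> R[i]) j : 0 <= weight g j * cn (v j) by rewrite mulr_ge0 ?weight_ge0 ?cn_ge0.
have [L LE] : exists L : R, l1norm g2 h = L%:E.
  have : (0 <= l1norm g2 h)%E by apply: esum_ge0 => j _; rewrite lee_fin; exact: F0.
  by case: (l1norm g2 h) hfin => [L||] // _ _; exists L.
have hL N : \sum_(k < N) (weight g2 (- k%:Z) * cn (h (- k%:Z))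
    + weight g2 (1 + k%:Z) * cn (h (1 + k%:Z))) <= L.
  by rewrite -lee_fin -LE; exact: (window_le_esum (fun j => weight g2 j * cn (h j))).
have L0 : 0 <= L by have := hL 0%N; rewrite big_ord0.
have [h1 h2] := hM h L hL h0 n n1.
have nR : 0 < n%:R :> R by rewrite ltr0n.
have n1R : 1 <= n%:R :> R by rewrite ler1n.
have powP (p : R) : 0 < n%:R `^ p by exact: powR_gt0.
have pwn (p : R) : 0 <= p -> (pw p n)^-1 <= (n%:R `^ p)^-1.
  move=> p0; rewrite lef_pV2 ?posrE ?pw_gt0 //.
  by apply: ge0_ler_powR => //; rewrite ?nnegrE ?ler_nat.
have root (x : R) (k : nat) : 0 <= x -> (0 < k)%N -> (x `^ (1 / k%:R)) ^+ k = x.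
  move=> x0 k0; rewrite -powR_mulrn ?powR_ge0 // -powRrM mul1r mulVf ?powRr1 //.
  by rewrite pnatr_eq0 -lt0n.
have g3 : 0 <= g2 - g1 by rewrite subr_ge0.
rewrite LE -!EFinM; split.
  apply: esum_le_window => [j|J]; first exact: F0.
  apply: le_trans (h1 (n%:R `^ (1 / 8)) (powP _) (root n%:R 8%N (ltW nR) isT) J) _.
  have -> : n%:R `^ (g2 - g1 - 1 / 8) = n%:R `^ (g2 - g1) / n%:R `^ (1 / 8).
    by rewrite powRD ?powRN //; apply/implyP => _; rewrite gt_eqF.
  rewrite invf_div; have := pwn _ g3.
  have := powP (1 / 8); move: (n%:R `^ (1 / 8)) => t t0 hp.
  have : M * (L * (pw (g2 - g1) n)^-1 * t) <= M * (L * (n%:R `^ (g2 - g1))^-1 * t).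
    by rewrite ler_pM2l // ler_pM2r // ler_wpM2l.
  have : 0 <= M * (L * (n%:R `^ (g2 - g1))^-1 * t).
    by rewrite !mulr_ge0 ?invr_ge0 // ltW.
  rewrite (_ : 2 * M * (t / n%:R `^ (g2 - g1)) * L = 2 * (M * (L * (n%:R `^ (g2 - g1))^-1 * t))); last by ring.
  clear; lra.
apply: ge_ereal_sup => _ [j _ <-]; rewrite lee_fin.
pose nu : R := n.+1%:R `^ (1 / 3).
have nu0 : 0 < nu by rewrite powR_gt0 // ltr0n.
apply: le_trans (h2 nu nu0 (root n.+1%:R 3%N (ler0n _ _) isT) j) _.
set p := Num.min _ _.
have p0 : 0 <= p by rewrite le_min g10 andbT; clear; lra.
(* Both [nu^-1] and [(pw g1 n)^-1] use [n + 1], which is only better than [n]. *)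
have q1 : nu^-1 <= (n%:R `^ p)^-1.
  rewrite lef_pV2 ?posrE //; apply: (@le_trans _ _ (n%:R `^ (1 / 3))).
    by apply: ler_powR => //; rewrite ge_min lexx.
  by apply: ge0_ler_powR => //; rewrite ?nnegrE ?ler_nat //; lra.
have q2 : (pw g1 n)^-1 <= (n%:R `^ p)^-1.
  apply: le_trans (pwn g1 g10) _; rewrite lef_pV2 ?posrE //.
  by apply: ler_powR => //; rewrite ge_min lexx orbT.
rewrite powRD; last by apply/implyP => _; rewrite gt_eqF.
rewrite invfM; set X := (n%:R `^ p)^-1 in q1 q2 *; set Y := (n%:R `^ (g2 - g1))^-1.
have X0 : 0 < X by rewrite invr_gt0.
have Y0 : 0 < Y by rewrite invr_gt0.
rewrite (_ : 2 * M * (Y * X) * L = M * ((L * Y) * (2 * X))); last by ring.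
rewrite ler_pM2l //; apply: ler_pM.
- by rewrite divr_ge0 // ltW // pw_gt0.
- by rewrite addr_ge0 ?invr_ge0 // ltW // pw_gt0.
- by rewrite ler_wpM2l // pwn.
- clear -q1 q2; lra.
Qed.
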